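(* Let $(\sigma_{n,\varepsilon})_{n\in\mathbb Z,\,0<\varepsilon<1}\subset\mathbb C$ be a family such that (i) for every fixed $\varepsilon\in(0,1)$, $\sup_{n\in\mathbb Z}|n|\,|\sigma_{n,\varepsilon}|<\infty$; and (ii) for every fixed $n\in\mathbb Z$, $\sigma_{n,\varepsilon}\to 1$ as $\varepsilon\downarrow 0$. Then there is a map $f\in C^{0,1/3}(\mathbb T;\mathbb S^1)$ for which $$\sum_{n\in\mathbb Z} n\,|\widehat f(n)|^2\,\sigma_{n,\varepsilon}\ \not\longrightarrow\ \deg f\qquad\text{as }\varepsilon\downarrow 0 .$$
   Context: $\mathbb T=\mathbb R/(2\pi\mathbb Z)$, with its quotient distance $d_{\mathbb T}$, and $\mathbb S^1=\{z\in\mathbb C:|z|=1\}$. $C^{0,1/3}(\mathbb T;\mathbb S^1)$ is the set of maps $f:\mathbb T\to\mathbb S^1$ with $\sup_{x\neq y}|f(x)-f(y)|/d_{\mathbb T}(x,y)^{1/3}<\infty$. Fourier coefficients are $\widehat f(n)=\int_{\mathbb T} f(x)e^{-inx}\,\frac{dx}{2\pi}$. The degree of a continuous $f:\mathbb T\to\mathbb S^1$ is defined by writing $f=e^{i\varphi}$ with $\varphi:\mathbb R\to\mathbb R$ continuous; then $\varphi(x+2\pi)=\varphi(x)+2\pi d$ for all $x\in\mathbb R$ with some $d\in\mathbb Z$, and $\deg f:=d$. By (i) the series is absolutely convergent for each $\varepsilon$, since $\sum_n|\widehat f(n)|^2=1$. ''$\not\longrightarrow \deg f$'' means that it is not the case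 that the limit as $\varepsilon\downarrow0$ exists and equals $\deg f$. *)

(* Defs.v *)
From Stdlib Require Import Reals ZArith.
From Coquelicot Require Import Coquelicot.

Open Scope R_scope.

(** Points of the circle T = R/(2 pi Z) are represented by real numbers, and
    maps T -> C by 2 pi-periodic maps R -> C. *)

Definition eqT (x y : R) : Prop := exists k : Z, x - y = 2 * PI * IZR k.

(** The set is nonempty and bounded below by 0, so its infimum is finite. *)
Definition dT (x y : R) : R :=
  real (Glb_Rbar (fun d => exists k : Z, d = Rabs (x - y + 2 * PI * IZR k))).

Definition periodic (f : R -> C) : Prop := forall x : R, f (x + 2 * PI) = f x.

Definition circle_map (f : R -> C) : Prop :=
  periodic f /\ forall x : R, Cmod (f x) = 1.

Definition holder (alpha : R) (f : R -> C) : Prop :=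
  exists M : R, forall x y : R, ~ eqT x y ->
    Cmod (f x - f y) / Rpower (dT x y) alpha <= M.

Definition expi (t : R) : C := (cos t, sin t).

Definition fourier (f : R -> C) (n : Z) : C :=
  (RtoC (/ (2 * PI)) *
   RInt (V := C_R_CompleteNormedModule)
     (fun x => f x * expi (- (IZR n * x)))%C 0 (2 * PI))%C.

(** [d] is unique: two continuous lifts of [f] differ by a constant in 2 pi Z. *)
Definition has_degree (f : R -> C) (d : Z) : Prop :=
  exists phi : R -> R,
    (forall x : R, continuous phi x) /\
    (forall x : R, f x = expi (phi x)) /\
    (forall x : R, phi (x + 2 * PI) = phi x + 2 * PI * IZR d).

(** Absolutely convergent series over Z, hence independent of the order of
    summation; here Z is split as {0, 1, 2, ...} and {-1, -2, ...}. *)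
Definition is_Zseries (a : Z -> C) (s : C) : Prop :=
  ex_series (fun k : nat => Cmod (a (Z.of_nat k))) /\
  ex_series (fun k : nat => Cmod (a (- Z.of_nat (S k))%Z)) /\
  exists s1 s2 : C,
    is_series (V := C_NormedModule) (fun k : nat => a (Z.of_nat k)) s1 /\
    is_series (V := C_NormedModule) (fun k : nat => a (- Z.of_nat (S k))%Z) s2 /\
    s = (s1 + s2)%C.

(* Main.v *)
Require Import Defs.
From Stdlib Require Import Reals ZArith Lra Lia List Classical ClassicalEpsilon.
From Coquelicot Require Import Coquelicot.
Import ListNotations.

(** Suppose that the limit is [deg f] for every [f], and write
    [S_s(f) = sum_n s(n) |f^(n)|^2] with [s(n) = n Re sigma(n, eps)].  The test maps
    are [f = exp(i phi)] with [phi] a lacunary sum of blocks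
    [2^(-l/3) (sin p(x+al) + sin q(x+al) + sin (p+q)(x+al))], [p, q = O(2^l)], which
    is Hoelder continuous of exponent 1/3 whatever the choices.  By a gliding hump it
    is enough to exclude that [|S_s(f)| <= eta] for all small [eps] and all [f] that
    extend a fixed finite phase by finitely many blocks of high level.

    Averaging over the rotation [al] of a block [g] turns [S_s(f g)] into [S_(T s)(f)],
    where [T] averages [s] over the power spectrum of [g].  If [s] is odd, the leading
    term of [(T s)(0)] is [- 2^(-l) (s(p) + s(q) - s(p+q)) / 2], a cubic flux that is
    critical exactly for the exponent 1/3.  For [p] uniform in an interval [I] and
    [q = p+1] or [p+2], the sum [p+q] is uniform in an interval twice as long and twice
    as far away, so the flux of a cascade of such blocks telescopes to the average of
    [s] over [I], up to a term that vanishes at infinity because [s] is bounded for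
    fixed [eps].  The uniform choice of [p] makes the interaction between different
    blocks summable.  One more block [(n, q)] carries the bound on averages over to
    [s(n)] itself.  Hence [|s(n)| <= 40 eta (|n| + L)] uniformly in [eps], after
    convolution with the spectrum of the fixed phase, which contradicts [s(n) -> n]
    for [n = L]. *)

(** The bound [M] on the multiplier at fixed [eps] is not uniform in [eps], so it may enter only
    where a parameter chosen later defeats it: the Taylor order [J] and the cascade length [K]. All
    other estimates rest on a growth bound [B * gauge]; one pass of the argument replaces [B] by
    [20 * eta + B / 2], so [M] only starts an iteration whose fixed point [40 * eta] is free of it.
    With h = 2^(-l/3), the obstacle is that a block acts already at order h^2, above the flux of
    order h^3. The second order is even in the frequency and vanishes at 0 on odd multipliers, but
    away from 0, where the coarser blocks look, it is of size B 2^l h^2. Averages over long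
    intervals are Lipschitz, which lowers this to B |z| h^2; the coarser blocks amplify it by at
    most a multiple of 1/h, and the resulting errors B h are summable over the levels. Degrees enter
    by modulation alone: a factor e^(idx) translates the multiplier by d. The limits assumed in
    degrees L and -L thus force the odd part at L to be close to L, whereas every block test has
    degree 0. *)

Definition contR (u : R -> R) : Prop := forall x : R, continuous u x.

Lemma contR_plus (u v : R -> R) : contR u -> contR v -> contR (fun x => u x + v x).
Proof. intros Hu Hv x; exact (continuous_plus u v x (Hu x) (Hv x)). Qed.

Lemma contR_minus (u v : R -> R) : contR u -> contR v -> contR (fun x => u x - v x).
Proof. intros Hu Hv x; exact (continuous_minus u v x (Hu x) (Hv x)). Qed.

Lemma contR_mult (u v : R -> R) : contR u -> contR v -> contR (fun x => u x * v x).
Proof. intros Hu Hv x; exact (continuous_mult u v x (Hu x) (Hv x)). Qed.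

Lemma contR_const (c : R) : contR (fun _ => c).
Proof. intros x; apply continuous_const. Qed.

Lemma contR_id : contR (fun x => x).
Proof. intros x; apply continuous_id. Qed.

Lemma contR_comp (u v : R -> R) : contR u -> contR v -> contR (fun x => u (v x)).
Proof. intros Hu Hv x; exact (continuous_comp v u x (Hv x) (Hu (v x))). Qed.

Lemma contR_cos : contR cos.
Proof. intros x; apply continuous_cos. Qed.

Lemma contR_sin : contR sin.
Proof. intros x; apply continuous_sin. Qed.

Ltac contR_tac :=
  repeat match goal with
  | H : contR ?u |- contR ?u => exact H
  | |- contR (fun _ => ?c) => exact (contR_const c)
  | |- contR (fun x => x) => exact contR_id
  | |- contR cos => exact contR_cos
  | |- contR sin => exact contR_sin
  | |- contR (fun x => @?u x + @?v x) => apply (contR_plus u v)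
  | |- contR (fun x => @?u x - @?v x) => apply (contR_minus u v)
  | |- contR (fun x => @?u x * @?v x) => apply (contR_mult u v)
  | |- contR (fun x => cos (@?u x)) => apply (contR_comp cos u contR_cos)
  | |- contR (fun x => sin (@?u x)) => apply (contR_comp sin u contR_sin)
  end.

Definition contC (f : R -> C) : Prop :=
  contR (fun x => fst (f x)) /\ contR (fun x => snd (f x)).

Lemma contC_plus (f g : R -> C) : contC f -> contC g -> contC (fun x => (f x + g x)%C).
Proof. intros [? ?] [? ?]; split; simpl; contR_tac. Qed.

Lemma contC_mult (f g : R -> C) : contC f -> contC g -> contC (fun x => (f x * g x)%C).
Proof. intros [? ?] [? ?]; split; simpl; contR_tac. Qed.

Lemma contC_const (c : C) : contC (fun _ => c).
Proof. split; simpl; contR_tac. Qed.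

Lemma contC_expi (u : R -> R) : contR u -> contC (fun x => expi (u x)).
Proof.
  intros Hu; split; simpl.
  - exact (contR_comp cos u contR_cos Hu).
  - exact (contR_comp sin u contR_sin Hu).
Qed.

Lemma contC_expi_lin (c : R) : contC (fun x => expi (c * x)).
Proof. apply (contC_expi (fun x => c * x)); contR_tac. Qed.

Lemma contC_expi_neg (n : Z) : contC (fun x => expi (- (IZR n * x))).
Proof.
  apply contC_expi; intros x.
  apply (continuous_opp (fun x => IZR n * x)); revert x.
  change (contR (fun x => IZR n * x)); contR_tac.
Qed.

Ltac contC_tac :=
  repeat match goal with
  | H : contC ?f |- contC ?f => exact H
  | |- contC (fun _ => ?c) => exact (contC_const c)
  | |- contC (fun x => Cplus (@?f x) (@?g x)) => apply (contC_plus f g)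
  | |- contC (fun x => Cmult (@?f x) (@?g x)) => apply (contC_mult f g)
  | |- contC (fun x => expi (- (IZR ?n * x))) => exact (contC_expi_neg n)
  | |- contC (fun x => expi (?c * x)) => exact (contC_expi_lin c)
  end.

Lemma expi_plus (s t : R) : expi (s + t) = (expi s * expi t)%C.
Proof.
  unfold expi, Cmult; simpl; rewrite cos_plus, sin_plus; f_equal; ring.
Qed.

Lemma Cmod_sqr (z : C) : Cmod z ^ 2 = fst z ^ 2 + snd z ^ 2.
Proof.
  unfold Cmod; rewrite pow2_sqrt; [reflexivity |].
  apply Rplus_le_le_0_compat; apply pow2_ge_0.
Qed.

Lemma Cmod_expi (t : R) : Cmod (expi t) = 1.
Proof.
  unfold Cmod, expi; simpl.
  replace (cos t * (cos t * 1) + sin t * (sin t * 1)) with (Rsqr (sin t) + Rsqr (cos t))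
    by (unfold Rsqr; ring).
  rewrite sin2_cos2; apply sqrt_1.
Qed.

Lemma expi_0 : expi 0 = RtoC 1.
Proof. unfold expi, RtoC; rewrite cos_0, sin_0; reflexivity. Qed.

Lemma expi_period (t : R) (k : Z) : expi (t + 2 * PI * IZR k) = expi t.
Proof.
  assert (Hn : forall (n : nat) (t : R), expi (t + 2 * PI * INR n) = expi t).
  { intros n s; unfold expi.
    replace (s + 2 * PI * INR n) with (s + 2 * INR n * PI) by ring.
    now rewrite cos_period, sin_period. }
  destruct (Z_le_gt_dec 0 k) as [Hk | Hk].
  - rewrite <- (Z2Nat.id k Hk), <- INR_IZR_INZ; apply Hn.
  - rewrite <- (Hn (Z.to_nat (- k)) (t + 2 * PI * IZR k)).
    f_equal; rewrite INR_IZR_INZ, Z2Nat.id by lia; rewrite opp_IZR; ring.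
Qed.

(** * Mean values over a period, Fourier coefficients, Bessel's inequality *)

Definition av (u : R -> R) : R := RInt u 0 (2 * PI) / (2 * PI).

Lemma contR_ex_RInt (u : R -> R) (a b : R) : contR u -> ex_RInt u a b.
Proof. intros Hu; apply (ex_RInt_continuous (V := R_CompleteNormedModule)); intros; apply Hu. Qed.

Lemma two_PI_pos : 0 < 2 * PI.
Proof. pose proof PI_RGT_0; lra. Qed.

Lemma av_ext (u v : R -> R) : (forall x, u x = v x) -> av u = av v.
Proof. intros H; unfold av; f_equal; apply RInt_ext; intros; apply H. Qed.

Lemma av_plus (u v : R -> R) : contR u -> contR v -> av (fun x => u x + v x) = av u + av v.
Proof.
  intros Hu Hv; unfold av.
  pose proof (RInt_plus (V := R_CompleteNormedModule) u v 0 (2 * PI)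
    (contR_ex_RInt u _ _ Hu) (contR_ex_RInt v _ _ Hv)) as E.
  unfold plus in E; simpl in E; rewrite E; field; pose proof PI_RGT_0; lra.
Qed.

Lemma av_scal (c : R) (u : R -> R) : contR u -> av (fun x => c * u x) = c * av u.
Proof.
  intros Hu; unfold av.
  pose proof (RInt_scal (V := R_CompleteNormedModule) u 0 (2 * PI) c (contR_ex_RInt u _ _ Hu)) as E.
  unfold scal in E; simpl in E; unfold mult in E; simpl in E; rewrite E; field; pose proof PI_RGT_0; lra.
Qed.

Lemma av_minus (u v : R -> R) : contR u -> contR v -> av (fun x => u x - v x) = av u - av v.
Proof.
  intros Hu Hv.
  rewrite (av_ext _ (fun x => u x + (-1) * v x)) by (intros; ring).
  rewrite av_plus, av_scal by contR_tac; ring.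
Qed.

Lemma av_const (c : R) : av (fun _ => c) = c.
Proof.
  unfold av; rewrite (RInt_const (V := R_CompleteNormedModule)).
  unfold scal; simpl; unfold mult; simpl; field; pose proof PI_RGT_0; lra.
Qed.

Lemma av_le (u v : R -> R) : contR u -> contR v -> (forall x, u x <= v x) -> av u <= av v.
Proof.
  intros Hu Hv H; unfold av.
  apply Rmult_le_compat_r.
  - left; apply Rinv_0_lt_compat, two_PI_pos.
  - apply RInt_le; try apply contR_ex_RInt; try assumption.
    + left; apply two_PI_pos.
    + intros; apply H.
Qed.

Lemma sin_2PI_Z (k : Z) : sin (IZR k * (2 * PI)) = 0.
Proof.
  pose proof (expi_period 0 k) as H; apply (f_equal snd) in H; simpl in H.
  rewrite sin_0 in H; rewrite <- H; f_equal; ring.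
Qed.

Lemma cos_2PI_Z (k : Z) : cos (IZR k * (2 * PI)) = 1.
Proof.
  pose proof (expi_period 0 k) as H; apply (f_equal fst) in H; simpl in H.
  rewrite cos_0 in H; rewrite <- H; f_equal; ring.
Qed.

Lemma av_cos (k : Z) : k <> 0%Z -> av (fun x => cos (IZR k * x)) = 0.
Proof.
  intros Hk; assert (Hk' : IZR k <> 0) by (apply not_0_IZR; exact Hk).
  unfold av.
  assert (H : is_RInt (fun x => cos (IZR k * x)) 0 (2 * PI)
     (minus (sin (IZR k * (2 * PI)) / IZR k) (sin (IZR k * 0) / IZR k))).
  { apply (is_RInt_derive (V := R_CompleteNormedModule) (fun x => sin (IZR k * x) / IZR k)).
    - intros x _; auto_derive; [exact I | field; exact Hk'].
    - intros x _; revert x; change (contR (fun x => cos (IZR k * x))); contR_tac. }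
  rewrite (is_RInt_unique _ _ _ _ H), sin_2PI_Z, Rmult_0_r, sin_0.
  unfold minus, plus, opp; simpl; unfold Rdiv; ring.
Qed.

Lemma av_sin (k : Z) : k <> 0%Z -> av (fun x => sin (IZR k * x)) = 0.
Proof.
  intros Hk; assert (Hk' : IZR k <> 0) by (apply not_0_IZR; exact Hk).
  unfold av.
  assert (H : is_RInt (fun x => sin (IZR k * x)) 0 (2 * PI)
     (minus (- cos (IZR k * (2 * PI)) / IZR k) (- cos (IZR k * 0) / IZR k))).
  { apply (is_RInt_derive (V := R_CompleteNormedModule) (fun x => - cos (IZR k * x) / IZR k)).
    - intros x _; auto_derive; [exact I | field; exact Hk'].
    - intros x _; revert x; change (contR (fun x => sin (IZR k * x))); contR_tac. }
  rewrite (is_RInt_unique _ _ _ _ H), cos_2PI_Z, Rmult_0_r, cos_0.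
  unfold minus, plus, opp; simpl; unfold Rdiv; ring.
Qed.

Definition avC (f : R -> C) : C := (av (fun x => fst (f x)), av (fun x => snd (f x))).

Lemma fourier_avC (f : R -> C) (n : Z) : contC f ->
  fourier f n = avC (fun x => (f x * expi (- (IZR n * x)))%C).
Proof.
  intros Hf; unfold fourier.
  assert (Hg : contC (fun x => (f x * expi (- (IZR n * x)))%C)) by contC_tac.
  destruct Hg as [H1 H2].
  rewrite (is_RInt_unique (V := C_R_CompleteNormedModule) _ 0 (2 * PI)
    (RInt (fun x => fst (f x * expi (- (IZR n * x)))%C) 0 (2 * PI),
     RInt (fun x => snd (f x * expi (- (IZR n * x)))%C) 0 (2 * PI))).
  - unfold avC, av, RtoC, Cmult, Rdiv; cbn [fst snd]; f_equal; ring.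
  - apply (is_RInt_fct_extend_pair (U := R_NormedModule) (V := R_NormedModule)).
    + apply (RInt_correct (V := R_CompleteNormedModule)), contR_ex_RInt; exact H1.
    + apply (RInt_correct (V := R_CompleteNormedModule)), contR_ex_RInt; exact H2.
Qed.

Lemma avC_ext (f g : R -> C) : (forall x, f x = g x) -> avC f = avC g.
Proof. intros H; unfold avC; f_equal; apply av_ext; intros; now rewrite H. Qed.

Lemma avC_plus (f g : R -> C) : contC f -> contC g ->
  avC (fun x => (f x + g x)%C) = (avC f + avC g)%C.
Proof. intros [? ?] [? ?]; unfold avC, Cplus; simpl; f_equal; now rewrite av_plus. Qed.

Lemma avC_scal (c : C) (f : R -> C) : contC f -> avC (fun x => (c * f x)%C) = (c * avC f)%C.
Proof.
  intros [? ?]; unfold avC, Cmult; simpl; f_equal.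
  - now rewrite av_minus, !av_scal by contR_tac.
  - now rewrite av_plus, !av_scal by contR_tac.
Qed.

Lemma avC_expi (k : Z) : k <> 0%Z -> avC (fun x => expi (IZR k * x)) = RtoC 0.
Proof. intros Hk; unfold avC, expi; simpl; now rewrite av_cos, av_sin. Qed.

Lemma fourier_ext (f g : R -> C) (n : Z) : (forall x, f x = g x) -> fourier f n = fourier g n.
Proof.
  intros H; unfold fourier; f_equal; apply RInt_ext; intros; now rewrite H.
Qed.

Lemma fourier_plus (f g : R -> C) (n : Z) : contC f -> contC g ->
  fourier (fun x => (f x + g x)%C) n = (fourier f n + fourier g n)%C.
Proof.
  intros Hf Hg; rewrite !fourier_avC by contC_tac.
  rewrite <- avC_plus by contC_tac; apply avC_ext; intros; ring.
Qed.

Lemma fourier_scal (c : C) (f : R -> C) (n : Z) : contC f ->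
  fourier (fun x => (c * f x)%C) n = (c * fourier f n)%C.
Proof.
  intros Hf; rewrite !fourier_avC by contC_tac.
  rewrite <- avC_scal by contC_tac; apply avC_ext; intros; ring.
Qed.

Lemma fourier_modulate (f : R -> C) (a n : Z) : contC f ->
  fourier (fun x => (f x * expi (IZR a * x))%C) n = fourier f (n - a).
Proof.
  intros Hf; rewrite !fourier_avC by contC_tac.
  apply avC_ext; intros x; rewrite <- Cmult_assoc; f_equal.
  rewrite <- expi_plus; f_equal; rewrite minus_IZR; ring.
Qed.

Lemma fourier_expi (a n : Z) : n <> a -> fourier (fun x => expi (IZR a * x)) n = RtoC 0.
Proof.
  intros H; rewrite fourier_avC by contC_tac.
  rewrite <- (avC_expi (a - n)) by lia.
  apply avC_ext; intros x; rewrite <- expi_plus; f_equal; rewrite minus_IZR; ring.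
Qed.

Definition nu (f : R -> C) (n : Z) : R := Cmod (fourier f n) ^ 2.

Lemma nu_nonneg (f : R -> C) (n : Z) : 0 <= nu f n.
Proof. apply pow2_ge_0. Qed.

Definition lsum {A : Type} (F : A -> R) (l : list A) : R :=
  fold_right (fun x s => F x + s) 0 l.

Lemma contR_Cmod2 (f : R -> C) : contC f -> contR (fun x => Cmod (f x) ^ 2).
Proof.
  intros [H1 H2] x.
  apply continuous_ext with (fun x => fst (f x) * fst (f x) + snd (f x) * snd (f x)).
  - intros y; rewrite Cmod_sqr; simpl; ring.
  - revert x; change (contR (fun x => fst (f x) * fst (f x) + snd (f x) * snd (f x))); contR_tac.
Qed.

(* Removing the [n]-th mode from [f] lowers the mean square by exactly
   [nu f n] and leaves the other coefficients unchanged, whence the induction. *)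
Lemma bessel (l : list Z) (f : R -> C) : NoDup l -> contC f ->
  lsum (nu f) l <= av (fun x => Cmod (f x) ^ 2).
Proof.
  revert f; induction l as [| n l IH]; intros f Hl Hf; unfold lsum; cbn [fold_right].
  - rewrite <- (av_const 0); apply av_le; [contR_tac | now apply contR_Cmod2 |].
    intros; apply pow2_ge_0.
  - inversion Hl as [| ? ? Hn Hl']; subst.
    set (c := fourier f n).
    set (g := fun x => (f x + (- c) * expi (IZR n * x))%C).
    assert (Hg : contC g) by (unfold g; contC_tac).
    assert (Hnu : forall m, m <> n -> nu g m = nu f m).
    { intros m Hm; unfold nu, g.
      rewrite fourier_plus, fourier_scal, fourier_expi by (assumption || contC_tac).
      f_equal; f_equal; ring. }
    assert (Hsum : lsum (nu f) l = lsum (nu g) l).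
    { clear - Hnu Hn; induction l as [| m l IHl]; simpl; [reflexivity |].
      rewrite IHl by (intros H; apply Hn; now right).
      rewrite Hnu; [reflexivity |]; intros ->; apply Hn; now left. }
    assert (Hav : av (fun x => Cmod (g x) ^ 2) = av (fun x => Cmod (f x) ^ 2) - nu f n).
    { pose (z := fun x => (f x * expi (- (IZR n * x)))%C).
      assert (Hz : contC z) by (unfold z; contC_tac).
      destruct Hz as [Hz1 Hz2].
      rewrite (av_ext _ (fun x => (Cmod (f x) ^ 2 + (fst c ^ 2 + snd c ^ 2))
         - 2 * (fst c * fst (z x) + snd c * snd (z x)))).
      - rewrite av_minus, av_plus, av_const, av_scal, av_plus, !av_scal;
          try (pose proof (contR_Cmod2 f Hf)); contR_tac.
        assert (Ec : c = (av (fun x => fst (z x)), av (fun x => snd (z x))))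
          by (unfold c; rewrite fourier_avC by exact Hf; reflexivity).
        rewrite <- (f_equal fst Ec : fst c = av (fun x => fst (z x))).
        rewrite <- (f_equal snd Ec : snd c = av (fun x => snd (z x))).
        unfold nu; fold c; rewrite Cmod_sqr; ring.
      - intros x; clear Hnu Hsum Hg; subst g z; clearbody c; cbv beta; rewrite !Cmod_sqr.
        unfold expi, Cplus, Cmult, Copp; simpl.
        rewrite cos_neg, sin_neg.
        pose proof (sin2_cos2 (IZR n * x)) as E; unfold Rsqr in E.
        set (C0 := cos (IZR n * x)) in *; set (S0 := sin (IZR n * x)) in *.
        destruct c as [c1 c2]; destruct (f x) as [f1 f2]; simpl.
        replace (c1 * (c1 * 1) + c2 * (c2 * 1))
          with ((c1 * c1 + c2 * c2) * (S0 * S0 + C0 * C0)) by (rewrite E; ring).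
        ring. }
    pose proof (IH g Hl' Hg) as H; rewrite Hav, <- Hsum in H; unfold lsum in H; lra.
Qed.

Lemma bessel_bound (l : list Z) (f : R -> C) (D : R) : NoDup l -> contC f ->
  (forall x, Cmod (f x) <= D) -> lsum (nu f) l <= D ^ 2.
Proof.
  intros Hl Hf HD; apply Rle_trans with (1 := bessel l f Hl Hf).
  rewrite <- (av_const (D ^ 2)); apply av_le; [now apply contR_Cmod2 | contR_tac |].
  intros x; apply pow_incr; split; [apply Cmod_ge_0 | apply HD].
Qed.

(** * Absolutely convergent sums over the integers *)

Definition zfold (a : Z -> R) (k : nat) : R := a (Z.of_nat k) + a (- Z.of_nat (S k))%Z.

(** [zfold] pairs k with -k-1, so that every integer occurs once and the two half-series of
    [is_Zseries] are added term by term. *)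
Definition Zsum (a : Z -> R) : R := Series (zfold a).

Definition Zsummable (a : Z -> R) : Prop := ex_series (zfold (fun n => Rabs (a n))).

Lemma zfold_abs (a : Z -> R) (k : nat) : Rabs (zfold a k) <= zfold (fun n => Rabs (a n)) k.
Proof. apply Rabs_triang. Qed.

Lemma zfold_nonneg (a : Z -> R) (k : nat) : 0 <= zfold (fun n => Rabs (a n)) k.
Proof. apply Rplus_le_le_0_compat; apply Rabs_pos. Qed.

Lemma Zsummable_ex (a : Z -> R) : Zsummable a -> ex_series (zfold a).
Proof.
  intros H; apply (ex_series_le (V := R_CompleteNormedModule)) with (2 := H).
  intros k; apply zfold_abs.
Qed.

Lemma Zsummable_plus (a b : Z -> R) : Zsummable a -> Zsummable b ->
  Zsummable (fun n => a n + b n).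
Proof.
  intros Ha Hb.
  apply (ex_series_le (V := R_CompleteNormedModule)) with
    (2 := ex_series_plus (V := R_NormedModule) _ _ Ha Hb).
  intros k; unfold norm; simpl; unfold abs; simpl.
  rewrite Rabs_pos_eq by (apply (zfold_nonneg (fun n => a n + b n))).
  unfold plus, zfold; simpl.
  pose proof (Rabs_triang (a (Z.of_nat k)) (b (Z.of_nat k))).
  pose proof (Rabs_triang (a (- Z.of_nat (S k))%Z) (b (- Z.of_nat (S k))%Z)).
  simpl in *; lra.
Qed.

Lemma Zsummable_scal (c : R) (a : Z -> R) : Zsummable a -> Zsummable (fun n => c * a n).
Proof.
  intros Ha; unfold Zsummable.
  apply ex_series_ext with (fun k => Rabs c * zfold (fun n => Rabs (a n)) k).
  - assert (E : forall k, Rabs c * zfold (fun n => Rabs (a n)) k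
      = zfold (fun n => Rabs (c * a n)) k)
      by (intros k; unfold zfold; rewrite !Rabs_mult; ring).
    exact E.
  - apply (ex_series_scal (V := R_NormedModule)); exact Ha.
Qed.

Lemma Zsummable_ext (a b : Z -> R) : (forall n, a n = b n) -> Zsummable a -> Zsummable b.
Proof. intros H; apply ex_series_ext; intros k; unfold zfold; now rewrite !H. Qed.

Lemma Zsum_ext (a b : Z -> R) : (forall n, a n = b n) -> Zsum a = Zsum b.
Proof. intros H; apply Series_ext; intros k; unfold zfold; now rewrite !H. Qed.

Lemma Zsum_plus (a b : Z -> R) : Zsummable a -> Zsummable b ->
  Zsum (fun n => a n + b n) = Zsum a + Zsum b.
Proof.
  intros Ha Hb; unfold Zsum.
  rewrite <- Series_plus by (apply Zsummable_ex; assumption).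
  apply Series_ext; intros k; unfold zfold; ring.
Qed.

Lemma Zsum_scal (c : R) (a : Z -> R) : Zsum (fun n => c * a n) = c * Zsum a.
Proof.
  unfold Zsum; rewrite <- Series_scal_l; apply Series_ext; intros k; unfold zfold; ring.
Qed.

Lemma Zsum_minus (a b : Z -> R) : Zsummable a -> Zsummable b ->
  Zsum (fun n => a n - b n) = Zsum a - Zsum b.
Proof.
  intros Ha Hb.
  rewrite (Zsum_ext _ (fun n => a n + (-1) * b n)) by (intros; ring).
  rewrite Zsum_plus, Zsum_scal by (try apply Zsummable_scal; assumption); ring.
Qed.

Lemma ex_series_bounded (u : nat -> R) (D : R) : (forall k, 0 <= u k) ->
  (forall N, sum_n u N <= D) -> ex_series u /\ Series u <= D.
Proof.
  intros Hu HD.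
  destruct (ex_finite_lim_seq_incr (sum_n u) D) as [l Hl].
  - intros N; rewrite sum_Sn; unfold plus; simpl; specialize (Hu (S N)); lra.
  - exact HD.
  - assert (Hs : is_series u l) by exact Hl.
    split; [now exists l |].
    rewrite (is_series_unique _ _ Hs).
    exact (is_lim_seq_le (sum_n u) (fun _ => D) l D HD Hl (is_lim_seq_const D)).
Qed.

(** Bessel's inequality controls finite windows only; such control yields summability and the
    estimate of the sum together. *)
Lemma Zsum_bounded (a : Z -> R) (D : R) :
  (forall N, sum_n (zfold (fun n => Rabs (a n))) N <= D) -> Zsummable a /\ Rabs (Zsum a) <= D.
Proof.
  intros H; destruct (ex_series_bounded _ D (zfold_nonneg a) H) as [H1 H2].
  split; [exact H1 |].
  assert (Hex : ex_series (fun k => Rabs (zfold a k))).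
  { apply (ex_series_le (V := R_CompleteNormedModule)) with (2 := H1).
    intros k; unfold norm; simpl; unfold abs; simpl; rewrite Rabs_Rabsolu; apply zfold_abs. }
  apply Rle_trans with (2 := H2).
  apply Rle_trans with (1 := Series_Rabs _ Hex).
  apply Series_le; [| exact H1].
  intros k; split; [apply Rabs_pos | apply zfold_abs].
Qed.

Lemma Zsummable_split (a : Z -> R) : Zsummable a <->
  ex_series (fun k => Rabs (a (Z.of_nat k))) /\
  ex_series (fun k => Rabs (a (- Z.of_nat (S k))%Z)).
Proof.
  split.
  - intros Ha; split; apply (ex_series_le (V := R_CompleteNormedModule)) with (2 := Ha);
      intros k; unfold norm, zfold; cbn -[Z.of_nat]; unfold abs; cbn -[Z.of_nat];
      rewrite Rabs_Rabsolu.
    + pose proof (Rabs_pos (a (- Z.of_nat (S k))%Z)); lra.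
    + pose proof (Rabs_pos (a (Z.of_nat k))); lra.
  - intros [H1 H2]; exact (ex_series_plus (V := R_NormedModule) _ _ H1 H2).
Qed.

Lemma Zsum_split (a : Z -> R) : Zsummable a ->
  Zsum a = Series (fun k => a (Z.of_nat k)) + Series (fun k => a (- Z.of_nat (S k))%Z).
Proof.
  intros Ha; apply Zsummable_split in Ha; destruct Ha as [H1 H2].
  apply Series_plus; apply ex_series_Rabs; assumption.
Qed.

Lemma Zsummable_succ (a : Z -> R) : Zsummable a -> Zsummable (fun n => a (n + 1)%Z).
Proof.
  rewrite !Zsummable_split; intros [H1 H2]; split.
  - apply (ex_series_incr_1 (fun k => Rabs (a (Z.of_nat k)))) in H1.
    apply ex_series_ext with (2 := H1); intros k; do 2 f_equal; lia.
  - apply (ex_series_incr_1 (fun k => Rabs (a (- Z.of_nat (S k) + 1)%Z))).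
    apply ex_series_ext with (2 := H2); intros k; do 2 f_equal; lia.
Qed.

Lemma Zsummable_pred (a : Z -> R) : Zsummable a -> Zsummable (fun n => a (n - 1)%Z).
Proof.
  rewrite !Zsummable_split; intros [H1 H2]; split.
  - apply (ex_series_incr_1 (fun k => Rabs (a (Z.of_nat k - 1)%Z))).
    apply ex_series_ext with (2 := H1); intros k; do 2 f_equal; lia.
  - apply (ex_series_incr_1 (fun k => Rabs (a (- Z.of_nat (S k))%Z))) in H2.
    apply ex_series_ext with (2 := H2); intros k; do 2 f_equal; lia.
Qed.

(** A unit shift moves the single term [a 0] from the nonnegative half to the negative one; the rest
    is reindexing. *)
Lemma Zsum_succ (a : Z -> R) : Zsummable a -> Zsum (fun n => a (n + 1)%Z) = Zsum a.
Proof.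
  intros Ha; pose proof (Zsummable_succ a Ha) as Hb; rewrite !Zsum_split by assumption.
  apply Zsummable_split in Ha; apply Zsummable_split in Hb.
  rewrite (Series_incr_1 (fun k => a (Z.of_nat k))) by (apply ex_series_Rabs, Ha).
  rewrite (Series_incr_1 (fun k => a (- Z.of_nat (S k) + 1)%Z)) by (apply ex_series_Rabs, Hb).
  rewrite (Series_ext (fun k => a (Z.of_nat k + 1)%Z) (fun k => a (Z.of_nat (S k))))
    by (intros; f_equal; lia).
  rewrite (Series_ext (fun k => a (- Z.of_nat (S (S k)) + 1)%Z) (fun k => a (- Z.of_nat (S k))%Z))
    by (intros; f_equal; lia).
  simpl; ring.
Qed.

Lemma Zsum_shift (a : Z -> R) (m : Z) : Zsummable a ->
  Zsummable (fun n => a (n + m)%Z) /\ Zsum (fun n => a (n + m)%Z) = Zsum a.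
Proof.
  intros Ha.
  apply (Z.bi_induction (fun m => Zsummable (fun n => a (n + m)%Z)
     /\ Zsum (fun n => a (n + m)%Z) = Zsum a)).
  - now intros x y ->.
  - split.
    + apply Zsummable_ext with a; [intros; f_equal; lia | exact Ha].
    + apply Zsum_ext; intros; f_equal; lia.
  - intros k; split; intros [H1 H2].
    + pose proof (Zsummable_succ _ H1) as H3; pose proof (Zsum_succ _ H1) as H4.
      cbv beta in H3, H4; split.
      * apply Zsummable_ext with (2 := H3); intros; f_equal; lia.
      * rewrite <- H2, <- H4; apply Zsum_ext; intros; f_equal; lia.
    + assert (H3 : Zsummable (fun n => a (n + k)%Z))
        by (apply Zsummable_ext with (2 := Zsummable_pred _ H1); intros; f_equal; lia).
      split; [exact H3 |].
      rewrite <- (Zsum_succ _ H3), <- H2; apply Zsum_ext; intros; f_equal; lia.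
Qed.

(** * Finite sums and averages over lists *)

Lemma lsum_ext {A : Type} (F G : A -> R) (l : list A) :
  (forall x, In x l -> F x = G x) -> lsum F l = lsum G l.
Proof.
  induction l as [| x l IH]; intros H; simpl; [reflexivity |].
  rewrite (H x) by (now left); f_equal; apply IH; intros; apply H; now right.
Qed.

Lemma lsum_cons {A : Type} (F : A -> R) (x : A) (l : list A) :
  lsum F (x :: l) = F x + lsum F l.
Proof. reflexivity. Qed.

Lemma lsum_plus {A : Type} (F G : A -> R) (l : list A) :
  lsum (fun x => F x + G x) l = lsum F l + lsum G l.
Proof. induction l as [| x l IH]; simpl; [ring | rewrite IH; ring]. Qed.

Lemma lsum_scal {A : Type} (c : R) (F : A -> R) (l : list A) :
  lsum (fun x => c * F x) l = c * lsum F l.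
Proof. induction l as [| x l IH]; simpl; [ring | rewrite IH; ring]. Qed.

Lemma lsum_app {A : Type} (F : A -> R) (l1 l2 : list A) :
  lsum F (l1 ++ l2) = lsum F l1 + lsum F l2.
Proof. induction l1 as [| x l IH]; simpl; [ring | rewrite IH; ring]. Qed.

Lemma lsum_le {A : Type} (F G : A -> R) (l : list A) :
  (forall x, In x l -> F x <= G x) -> lsum F l <= lsum G l.
Proof.
  induction l as [| x l IH]; intros H; simpl; [lra |].
  apply Rplus_le_compat; [apply H; now left | apply IH; intros; apply H; now right].
Qed.

Lemma lsum_Rabs {A : Type} (F : A -> R) (l : list A) :
  Rabs (lsum F l) <= lsum (fun x => Rabs (F x)) l.
Proof.
  induction l as [| x l IH]; simpl; [rewrite Rabs_R0; lra |].
  apply Rle_trans with (1 := Rabs_triang _ _); lra.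
Qed.

Lemma lsum_const {A : Type} (c : R) (l : list A) : lsum (fun _ => c) l = INR (length l) * c.
Proof.
  induction l as [| x l IH]; [simpl; ring |].
  change (lsum (fun _ => c) (x :: l)) with (c + lsum (fun _ => c) l).
  rewrite IH; cbn [length]; rewrite S_INR; ring.
Qed.

Lemma Rabs_div_le (x n B : R) : 0 < n -> Rabs x <= n * B -> Rabs (x / n) <= B.
Proof.
  intros Hn Hx; rewrite Rabs_div, (Rabs_pos_eq n) by lra.
  apply Rle_div_l; [exact Hn | lra].
Qed.

Lemma lsum_avg_bound {A : Type} (u : A -> R) (l : list A) (B : R) : l <> [] ->
  (forall x, In x l -> Rabs (u x) <= B) -> Rabs (lsum u l / INR (length l)) <= B.
Proof.
  intros Hl HB; apply Rabs_div_le.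
  - apply lt_0_INR; destruct l; [easy | simpl; lia].
  - apply Rle_trans with (1 := lsum_Rabs _ _).
    rewrite <- lsum_const; now apply lsum_le.
Qed.

Lemma seq_avg_bound (u : nat -> R) (m : nat) (B : R) : (0 < m)%nat ->
  (forall k, (k < m)%nat -> Rabs (u k) <= B) -> Rabs (lsum u (seq 0 m) / INR m) <= B.
Proof.
  intros Hm HB; rewrite <- (length_seq m 0) at 2; apply lsum_avg_bound.
  - now destruct m.
  - intros k Hk; apply in_seq in Hk; apply HB; lia.
Qed.

Lemma lsum_map {A B : Type} (F : B -> R) (g : A -> B) (l : list A) :
  lsum F (map g l) = lsum (fun x => F (g x)) l.
Proof. induction l as [| x l IH]; simpl; [reflexivity | now rewrite IH]. Qed.

Lemma lsum_swap {A B : Type} (F : A -> B -> R) (l : list A) (m : list B) :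
  lsum (fun x => lsum (F x) m) l = lsum (fun y => lsum (fun x => F x y) l) m.
Proof.
  induction l as [| x l IH]; simpl.
  - symmetry; rewrite lsum_const; ring.
  - rewrite IH, <- lsum_plus; reflexivity.
Qed.

Lemma Zsum_lsum {A : Type} (a : A -> Z -> R) (l : list A) :
  (forall x, In x l -> Zsummable (a x)) ->
  Zsummable (fun n => lsum (fun x => a x n) l) /\
  Zsum (fun n => lsum (fun x => a x n) l) = lsum (fun x => Zsum (a x)) l.
Proof.
  induction l as [| x l IH]; intros H; simpl.
  - split.
    + apply (Zsum_bounded _ 0); intros N.
      induction N as [| N IHN].
      * rewrite sum_O; unfold zfold; rewrite Rabs_R0; lra.
      * rewrite sum_Sn.
        replace (zfold (fun _ : Z => Rabs 0) (S N)) with 0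
          by (unfold zfold; rewrite Rabs_R0; ring).
        unfold plus; simpl; lra.
    + rewrite (Zsum_ext _ (fun n => 0 * 0)) by (intros; ring).
      rewrite (Zsum_scal 0 (fun _ => 0)); ring.
  - destruct IH as [H1 H2]; [intros; apply H; now right |].
    split.
    + apply Zsummable_plus; [apply H; now left | exact H1].
    + rewrite Zsum_plus, H2; [reflexivity | apply H; now left | exact H1].
Qed.

(** The integers met by the first N + 1 terms of [zfold], that is [-N-1, N], listed without
    repetition as Bessel's inequality demands. *)
Fixpoint zwindow (N : nat) : list Z :=
  match N with
  | O => [0; -1]%Z
  | S M => Z.of_nat N :: (- Z.of_nat (S N))%Z :: zwindow M
  end.

Lemma zwindow_bound (N : nat) (z : Z) : In z (zwindow N) ->
  (- Z.of_nat (S N) <= z <= Z.of_nat N)%Z.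
Proof.
  induction N as [| N IH]; intros H.
  - simpl in H; lia.
  - destruct H as [H | [H | H]]; [lia | lia | specialize (IH H); lia].
Qed.

Lemma zwindow_NoDup (N : nat) : NoDup (zwindow N).
Proof.
  induction N as [| N IH].
  - repeat constructor; simpl; lia.
  - cbn [zwindow]; repeat constructor.
    + intros [H | H]; [lia | apply zwindow_bound in H; lia].
    + intros H; apply zwindow_bound in H; lia.
    + exact IH.
Qed.

Lemma sum_zfold (a : Z -> R) (N : nat) : sum_n (zfold a) N = lsum a (zwindow N).
Proof.
  induction N as [| N IH].
  - rewrite sum_O; unfold zfold; simpl; ring.
  - rewrite sum_Sn, IH; unfold plus, zfold, lsum; cbn [zwindow fold_right plus]; simpl; ring.
Qed.

(** * Multipliers tested against a power spectrum *)

Definition wsum (s : Z -> R) (f : R -> C) : R := Zsum (fun n => s n * nu f n).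

Lemma wsum_fun_ext (s : Z -> R) (f g : R -> C) : (forall x, f x = g x) -> wsum s f = wsum s g.
Proof.
  intros H; apply Zsum_ext; intros n; unfold nu; now rewrite (fourier_ext f g n H).
Qed.

Lemma wsum_bounded (s : Z -> R) (f : R -> C) (M D : R) :
  (forall n, Rabs (s n) <= M) -> contC f -> (forall x, Cmod (f x) <= D) ->
  Zsummable (fun n => s n * nu f n) /\ Rabs (wsum s f) <= M * D ^ 2.
Proof.
  intros HM Hf HD; apply Zsum_bounded; intros N; rewrite sum_zfold.
  apply Rle_trans with (lsum (fun n => M * nu f n) (zwindow N)).
  - apply lsum_le; intros n _; rewrite Rabs_mult, (Rabs_pos_eq (nu f n)) by apply nu_nonneg.
    apply Rmult_le_compat_r; [apply nu_nonneg | apply HM].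
  - rewrite lsum_scal; apply Rmult_le_compat_l.
    + apply Rle_trans with (1 := Rabs_pos (s 0%Z)); apply HM.
    + apply bessel_bound; [apply zwindow_NoDup | assumption | assumption].
Qed.

(** Cauchy-Schwarz for u^2 - v^2 = (u - v)(u + v), with Bessel applied to f - g, f and g. At fixed
    [eps] this makes both the truncation of phases and the replacement of exponentials by Taylor
    polynomials harmless. *)
Lemma wsum_lip (s : Z -> R) (f g : R -> C) (M D : R) :
  (forall n, Rabs (s n) <= M) -> contC f -> contC g -> 0 < D ->
  (forall x, Cmod (f x) <= 2) -> (forall x, Cmod (g x) <= 2) ->
  (forall x, Cmod (f x - g x) <= D) ->
  Rabs (wsum s f - wsum s g) <= 9 * M * D.
Proof.
  intros HM Hf Hg HD Hf2 Hg2 Hfg.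
  assert (HM0 : 0 <= M) by (apply Rle_trans with (1 := Rabs_pos (s 0%Z)); apply HM).
  destruct (wsum_bounded s f M 2 HM Hf Hf2) as [Sf _].
  destruct (wsum_bounded s g M 2 HM Hg Hg2) as [Sg _].
  unfold wsum; rewrite <- Zsum_minus by assumption.
  apply Zsum_bounded; intros N; rewrite sum_zfold.
  set (k := fun x => (f x + (-1) * g x)%C).
  assert (Hk : contC k) by (unfold k; contC_tac).
  assert (Hfk : forall n, fourier k n = (fourier f n - fourier g n)%C).
  { intros n; unfold k; rewrite fourier_plus, fourier_scal by contC_tac; ring. }
  apply Rle_trans with
    (lsum (fun n => M * (/ (2 * D) * nu k n + (D * nu f n + D * nu g n))) (zwindow N)).
  - apply lsum_le; intros n _.
    replace (s n * nu f n - s n * nu g n) with (s n * (nu f n - nu g n)) by ring.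
    rewrite Rabs_mult; apply Rmult_le_compat; try apply Rabs_pos; [apply HM |].
    unfold nu; rewrite Hfk.
    set (u := Cmod (fourier f n)); set (v := Cmod (fourier g n));
      set (w := Cmod (fourier f n - fourier g n)).
    assert (Hw : Rabs (u - v) <= w).
    { apply Rabs_le; split.
      - assert (v <= u + w); [| lra].
        unfold u, v, w.
        replace (fourier g n) with (fourier f n + - (fourier f n - fourier g n))%C at 1 by ring.
        apply Rle_trans with (1 := Cmod_triangle _ _); rewrite Cmod_opp; lra.
      - assert (u <= v + w); [| lra].
        unfold u, v, w.
        replace (fourier f n) with (fourier g n + (fourier f n - fourier g n))%C at 1 by ring.
        apply Cmod_triangle. }
    assert (0 <= u) by apply Cmod_ge_0; assert (0 <= v) by apply Cmod_ge_0.
    replace (u ^ 2 - v ^ 2) with ((u - v) * (u + v)) by ring.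
    rewrite Rabs_mult, (Rabs_pos_eq (u + v)) by lra.
    apply Rle_trans with (w * (u + v)); [apply Rmult_le_compat_r; lra |].
    (* Young's inequality, balanced for |f - g| <= D: after summation the three parts are at most
       D/2, 4D and 4D, whence the constant 9. *)
    apply Rle_trans with (/ (2 * D) * w ^ 2 + D / 2 * (u + v) ^ 2).
    + assert (0 <= / (2 * D) * (w - D * (u + v)) ^ 2).
      { apply Rmult_le_pos; [left; apply Rinv_0_lt_compat; lra | apply pow2_ge_0]. }
      replace (/ (2 * D) * w ^ 2 + D / 2 * (u + v) ^ 2) with
        (w * (u + v) + / (2 * D) * (w - D * (u + v)) ^ 2) by (field; lra).
      lra.
    + apply Rplus_le_compat_l; pose proof (pow2_ge_0 (u - v)); nra.
  - rewrite lsum_scal, lsum_plus, lsum_plus, !lsum_scal.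
    replace (9 * M * D) with (M * (9 * D)) by ring.
    apply Rmult_le_compat_l; [exact HM0 |].
    assert (B1 : lsum (nu k) (zwindow N) <= D ^ 2).
    { apply bessel_bound; [apply zwindow_NoDup | exact Hk |].
      intros x; unfold k; replace (f x + -1 * g x)%C with (f x - g x)%C by ring; apply Hfg. }
    pose proof (bessel_bound (zwindow N) f 2 (zwindow_NoDup N) Hf Hf2) as B2.
    pose proof (bessel_bound (zwindow N) g 2 (zwindow_NoDup N) Hg Hg2) as B3.
    apply (Rmult_le_compat_l (/ (2 * D))) in B1;
      [| left; apply Rinv_0_lt_compat; lra].
    replace (/ (2 * D) * D ^ 2) with (D / 2) in B1 by (field; lra).
    nra.
Qed.

(** A character translates the spectrum. In this way a map of degree d is tested as a translated
    multiplier on a map of degree zero. *)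
Lemma wsum_modulate (s : Z -> R) (f : R -> C) (M D : R) (a : Z) :
  (forall n, Rabs (s n) <= M) -> contC f -> (forall x, Cmod (f x) <= D) ->
  wsum s (fun x => (f x * expi (IZR a * x))%C) = wsum (fun n => s (n + a)%Z) f.
Proof.
  intros HM Hf HD; unfold wsum.
  assert (H : Zsummable (fun n => s (n + a)%Z * nu f n))
    by (apply (wsum_bounded _ f M D); auto).
  rewrite <- (proj2 (Zsum_shift _ (- a) H)).
  apply Zsum_ext; intros n; unfold nu; rewrite fourier_modulate by exact Hf.
  now replace (n + - a + a)%Z with n by lia.
Qed.

(** * Trigonometric polynomials with real coefficients *)

Definition tpoly : Type := list (Z * R).

(** With c(a) = f^(n-a) this is the n-th Fourier coefficient of f times the polynomial rotated by t;
    with c = 1 it is the value of the polynomial. *)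
Fixpoint twisted (c : Z -> C) (G : tpoly) (t : R) : C :=
  match G with
  | [] => RtoC 0
  | u :: G' => (RtoC (snd u) * (expi (IZR (fst u) * t) * c (fst u)) + twisted c G' t)%C
  end.

Definition ev (G : tpoly) (t : R) : C := twisted (fun _ => RtoC 1) G t.

(** A list may repeat a frequency, so a product of two coefficients is a double sum over entries of
    equal frequency. Thus [bil mu U V] is the sum over a of mu(a) times the coefficients of U and V
    at a, and no collecting of terms is ever needed. *)
Definition pairing (u v : Z * R) : R :=
  if Z.eq_dec (fst u) (fst v) then snd u * snd v else 0.

Definition bil (mu : Z -> R) (U V : tpoly) : R :=
  lsum (fun u => lsum (fun v => pairing u v * mu (fst u)) V) U.

Definition tmul (U V : tpoly) : tpoly :=
  flat_map (fun u => map (fun v => ((fst u + fst v)%Z, snd u * snd v)) V) U.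

Definition tscal (c : R) (U : tpoly) : tpoly := map (fun u => (fst u, c * snd u)) U.

Fixpoint tpow (U : tpoly) (n : nat) : tpoly :=
  match n with O => [(0%Z, 1)] | S m => tmul U (tpow U m) end.

Definition tterm (U : tpoly) (j : nat) : tpoly := tscal (/ INR (fact j)) (tpow U j).

(** The terms of degrees k, ..., k + n - 1 of the exponential series. With the starting degree as an
    argument, low orders split off by computation. *)
Fixpoint texp (U : tpoly) (k n : nat) : tpoly :=
  match n with O => [] | S m => tterm U k ++ texp U (S k) m end.

Lemma ev_cons (u : Z * R) (G : tpoly) (t : R) :
  ev (u :: G) t = (RtoC (snd u) * expi (IZR (fst u) * t) + ev G t)%C.
Proof. unfold ev; cbn [twisted]; ring. Qed.

Lemma ev_app (U V : tpoly) (t : R) : ev (U ++ V) t = (ev U t + ev V t)%C.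
Proof.
  induction U as [| u U IH]; [unfold ev at 2; simpl; ring |].
  rewrite <- app_comm_cons, !ev_cons, IH; ring.
Qed.

Lemma ev_tscal (c : R) (U : tpoly) (t : R) : ev (tscal c U) t = (RtoC c * ev U t)%C.
Proof.
  induction U as [| u U IH]; [unfold ev; simpl; ring |].
  cbn [tscal map]; rewrite !ev_cons; fold (tscal c U); rewrite IH; cbn [fst snd].
  rewrite RtoC_mult; ring.
Qed.

Lemma ev_tmul (U V : tpoly) (t : R) : ev (tmul U V) t = (ev U t * ev V t)%C.
Proof.
  induction U as [| u U IH]; [unfold ev; simpl; ring |].
  cbn [tmul flat_map]; fold (tmul U V); rewrite ev_app, IH, ev_cons.
  assert (E : ev (map (fun v => ((fst u + fst v)%Z, snd u * snd v)) V) t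
     = (RtoC (snd u) * expi (IZR (fst u) * t) * ev V t)%C).
  { clear IH; induction V as [| v V IH]; [unfold ev; simpl; ring |].
    cbn [map]; rewrite !ev_cons, IH; cbn [fst snd].
    rewrite plus_IZR, Rmult_plus_distr_r, expi_plus, RtoC_mult; ring. }
  rewrite E; ring.
Qed.

Lemma contC_ext (f g : R -> C) : (forall x, f x = g x) -> contC f -> contC g.
Proof.
  intros H [H1 H2]; split; intros x.
  - apply continuous_ext with (2 := H1 x); intros; now rewrite H.
  - apply continuous_ext with (2 := H2 x); intros; now rewrite H.
Qed.

Lemma contC_ev_shift (G : tpoly) (al : R) : contC (fun x => ev G (x + al)).
Proof.
  induction G as [| u G IH].
  - exact (contC_const (RtoC 0)).
  - apply contC_ext with
      (fun x => (RtoC (snd u) * expi (IZR (fst u) * (x + al)) + ev G (x + al))%C).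
    + intros; now rewrite ev_cons.
    + apply contC_plus; [| exact IH].
      apply contC_mult; [apply contC_const | apply contC_expi; contR_tac].
Qed.

Lemma fourier_mult_ev (f : R -> C) (G : tpoly) (al : R) (n : Z) : contC f ->
  fourier (fun x => (f x * ev G (x + al))%C) n = twisted (fun a => fourier f (n - a)) G al.
Proof.
  intros Hf; induction G as [| u G IH].
  - rewrite (fourier_ext _ (fun x => (RtoC 0 * f x)%C)).
    + rewrite fourier_scal by exact Hf; simpl; ring.
    + intros; unfold ev; simpl; ring.
  - cbn [twisted]; rewrite <- IH.
    rewrite (fourier_ext _ (fun x => ((RtoC (snd u) * expi (IZR (fst u) * al))
         * (f x * expi (IZR (fst u) * x)) + f x * ev G (x + al))%C)).
    + rewrite fourier_plus, fourier_scal, fourier_modulate; try exact Hf.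
      * ring.
      * contC_tac.
      * contC_tac.
      * contC_tac; apply contC_ev_shift.
    + intros x; rewrite ev_cons, Rmult_plus_distr_l, expi_plus; ring.
Qed.

(** * Averaging over rotations by roots of unity *)

Definition rot (m s : nat) : R := 2 * PI / INR m * INR s.

Lemma expi_neq_1 (t : R) : 0 < Rabs t < 2 * PI -> expi t <> RtoC 1.
Proof.
  intros Ht H; apply (f_equal fst) in H; simpl in H.
  assert (Hc : cos (Rabs t) = 1).
  { unfold Rabs; destruct (Rcase_abs t); [now rewrite cos_neg | exact H]. }
  replace (Rabs t) with (2 * (Rabs t / 2)) in Hc by field.
  rewrite cos_2a_sin in Hc.
  pose proof (sin_gt_0 (Rabs t / 2)); nra.
Qed.

Definition expi_sum (t : R) (N : nat) : C :=
  (lsum (fun s => cos (t * INR s)) (seq 0 N), lsum (fun s => sin (t * INR s)) (seq 0 N)).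

Lemma expi_sum_geometric (t : R) (N : nat) :
  (expi_sum t N * (RtoC 1 - expi t))%C = (RtoC 1 - expi (t * INR N))%C.
Proof.
  induction N as [| N IH].
  - unfold expi_sum; simpl; rewrite Rmult_0_r, expi_0; apply injective_projections; simpl; ring.
  - transitivity (expi_sum t N * (RtoC 1 - expi t)
        + expi (t * INR N) * (RtoC 1 - expi t))%C.
    + unfold expi_sum; rewrite seq_S, !lsum_app.
      unfold expi, Cmult, Cminus, Cplus, Copp; simpl; f_equal; ring.
    + rewrite IH, S_INR, Rmult_plus_distr_l, expi_plus, Rmult_1_r; ring.
Qed.

Lemma root_of_unity_sum (m : nat) (k : Z) : (0 < Z.abs k < Z.of_nat m)%Z ->
  lsum (fun s => cos (IZR k * rot m s)) (seq 0 m) = 0 /\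
  lsum (fun s => sin (IZR k * rot m s)) (seq 0 m) = 0.
Proof.
  intros Hk.
  assert (Hm : 0 < INR m) by (apply lt_0_INR; lia).
  set (t := IZR k * (2 * PI / INR m)).
  pose proof (expi_sum_geometric t m) as E.
  replace (expi (t * INR m)) with (RtoC 1) in E.
  2: { replace (t * INR m) with (0 + 2 * PI * IZR k) by (unfold t; field; lra).
       now rewrite expi_period, expi_0. }
  replace (RtoC 1 - RtoC 1)%C with (RtoC 0) in E by ring.
  assert (Ht : expi t <> RtoC 1).
  { apply expi_neq_1; unfold t; rewrite Rabs_mult, <- abs_IZR.
    assert (H1 : 0 < 2 * PI / INR m)
      by (apply Rdiv_lt_0_compat; [apply two_PI_pos | exact Hm]).
    rewrite (Rabs_pos_eq (2 * PI / INR m)) by lra.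
    destruct Hk as [Hk1 Hk2]; apply IZR_lt in Hk1; apply IZR_lt in Hk2.
    rewrite <- INR_IZR_INZ in Hk2; split; [apply Rmult_lt_0_compat; assumption |].
    apply Rlt_le_trans with (INR m * (2 * PI / INR m)).
    - apply Rmult_lt_compat_r; assumption.
    - right; field; lra. }
  assert (Ht' : (RtoC 1 - expi t)%C <> RtoC 0).
  { intros H; apply Ht.
    replace (expi t) with (RtoC 1 - (RtoC 1 - expi t))%C by ring; rewrite H; ring. }
  assert (E0 : expi_sum t m = RtoC 0).
  { transitivity (expi_sum t m * (RtoC 1 - expi t) * / (RtoC 1 - expi t))%C.
    - rewrite <- Cmult_assoc, Cinv_r by exact Ht'; ring.
    - rewrite E; ring. }
  split.
  - apply (f_equal fst) in E0; cbn [fst expi_sum RtoC] in E0; rewrite <- E0.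
    apply lsum_ext; intros s _; unfold t, rot; f_equal; ring.
  - apply (f_equal snd) in E0; cbn [snd expi_sum RtoC] in E0; rewrite <- E0.
    apply lsum_ext; intros s _; unfold t, rot; f_equal; ring.
Qed.

Lemma twisted_inner (c : Z -> C) (U V : tpoly) (t : R) :
  fst (twisted c U t * Cconj (twisted c V t))%C =
  lsum (fun u => lsum (fun v => snd u * snd v *
     fst (expi (IZR (fst u - fst v) * t) * (c (fst u) * Cconj (c (fst v))))%C) V) U.
Proof.
  induction U as [| u U IH]; [simpl; ring |].
  cbn [twisted]; unfold lsum at 1; cbn [fold_right].
  fold (lsum (fun u => lsum (fun v => snd u * snd v *
     fst (expi (IZR (fst u - fst v) * t) * (c (fst u) * Cconj (c (fst v))))%C) V) U).
  rewrite <- IH, Cmult_plus_distr_r.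
  match goal with |- fst (?x + ?y)%C = _ => change (fst (x + y)%C) with (fst x + fst y) end.
  f_equal; clear IH U.
  induction V as [| v V IH]; [simpl; ring |].
  cbn [twisted]; unfold lsum; cbn [fold_right].
  fold (lsum (fun v => snd u * snd v *
     fst (expi (IZR (fst u - fst v) * t) * (c (fst u) * Cconj (c (fst v))))%C) V).
  rewrite <- IH; clear IH.
  rewrite minus_IZR, Rmult_minus_distr_r; unfold Rminus; rewrite expi_plus.
  unfold expi; rewrite cos_neg, sin_neg.
  destruct (c (fst u)) as [x1 y1]; destruct (c (fst v)) as [x2 y2].
  destruct (twisted c V t) as [x3 y3].
  unfold Cmult, Cplus, Cconj, RtoC; simpl; ring.
Qed.

(** Parseval on a finite cyclic group: the off-diagonal terms are complete sums of nontrivial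
    characters. [m] precedes [c] because one set of rotations must serve all Fourier modes of a
    product at once. *)
Lemma twisted_mean_square (G : tpoly) : exists m : nat, (0 < m)%nat /\
  forall c : Z -> C,
  lsum (fun s => Cmod (twisted c G (rot m s)) ^ 2) (seq 0 m)
    = INR m * bil (fun a => Cmod (c a) ^ 2) G G.
Proof.
  assert (Hb : exists b : Z, (0 < b)%Z /\ forall u, In u G -> (Z.abs (fst u) < b)%Z).
  { induction G as [| u G [b [Hb0 Hb]]].
    - exists 1%Z; split; [lia | intros u []].
    - exists (b + Z.abs (fst u) + 1)%Z; split; [lia |].
      intros v [<- | Hv]; [lia | specialize (Hb v Hv); lia]. }
  destruct Hb as [b [Hb0 Hb]].
  (* Two frequencies differ by less than 2b in modulus, so a nonzero difference is never a multiple
     of [m]. *)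
  exists (Z.to_nat (2 * b)); set (m := Z.to_nat (2 * b)).
  assert (Hm : (0 < m)%nat) by lia.
  split; [exact Hm |]; intros c.
  transitivity (lsum (fun s => lsum (fun u => lsum (fun v => snd u * snd v *
     fst (expi (IZR (fst u - fst v) * rot m s) * (c (fst u) * Cconj (c (fst v))))%C) G) G)
     (seq 0 m)).
  { apply lsum_ext; intros s _; rewrite <- twisted_inner, Cmod_sqr.
    unfold Cmult, Cconj; simpl; ring. }
  rewrite lsum_swap; unfold bil; rewrite <- lsum_scal.
  apply lsum_ext; intros u Hu.
  rewrite lsum_swap, <- lsum_scal.
  apply lsum_ext; intros v Hv.
  rewrite lsum_scal.
  set (z := (c (fst u) * Cconj (c (fst v)))%C).
  transitivity (snd u * snd v * (fst z * lsum (fun s => cos (IZR (fst u - fst v) * rot m s)) (seq 0 m)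
     + - snd z * lsum (fun s => sin (IZR (fst u - fst v) * rot m s)) (seq 0 m))).
  { f_equal; rewrite <- !lsum_scal, <- lsum_plus; apply lsum_ext; intros s _.
    unfold expi, Cmult; simpl; ring. }
  unfold pairing; destruct (Z.eq_dec (fst u) (fst v)) as [E | E].
  - rewrite E, Z.sub_diag.
    rewrite (lsum_ext (fun s => cos (0 * rot m s)) (fun _ => 1))
      by (intros; now rewrite Rmult_0_l, cos_0).
    rewrite (lsum_ext (fun s => sin (0 * rot m s)) (fun _ => 0))
      by (intros; now rewrite Rmult_0_l, sin_0).
    rewrite !lsum_const, length_seq, Cmod_sqr.
    unfold z; rewrite E; unfold Cmult, Cconj; simpl; ring.
  - destruct (root_of_unity_sum m (fst u - fst v)) as [H1 H2].
    + pose proof (Hb u Hu); pose proof (Hb v Hv); lia.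
    + rewrite H1, H2; ring.
Qed.

(** * The quadratic form and a weighted Wiener norm *)

Lemma bil_scal_l (c : R) (mu : Z -> R) (U V : tpoly) :
  bil (fun a => c * mu a) U V = c * bil mu U V.
Proof.
  unfold bil; rewrite <- lsum_scal; apply lsum_ext; intros u _.
  rewrite <- lsum_scal; apply lsum_ext; intros v _; ring.
Qed.

Lemma bil_plus (mu mu' : Z -> R) (U V : tpoly) :
  bil (fun a => mu a + mu' a) U V = bil mu U V + bil mu' U V.
Proof.
  unfold bil; rewrite <- lsum_plus; apply lsum_ext; intros u _.
  rewrite <- lsum_plus; apply lsum_ext; intros v _; ring.
Qed.

Lemma bil_ext (mu mu' : Z -> R) (U V : tpoly) :
  (forall a, mu a = mu' a) -> bil mu U V = bil mu' U V.
Proof.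
  intros H; unfold bil; apply lsum_ext; intros u _; apply lsum_ext; intros v _; now rewrite H.
Qed.

Lemma bil_app_l (mu : Z -> R) (U U' V : tpoly) :
  bil mu (U ++ U') V = bil mu U V + bil mu U' V.
Proof. apply lsum_app. Qed.

Lemma bil_app_r (mu : Z -> R) (U V V' : tpoly) :
  bil mu U (V ++ V') = bil mu U V + bil mu U V'.
Proof.
  unfold bil; rewrite <- lsum_plus; apply lsum_ext; intros u _; apply lsum_app.
Qed.

Lemma bil_sym (mu : Z -> R) (U V : tpoly) : bil mu U V = bil mu V U.
Proof.
  unfold bil; rewrite lsum_swap; apply lsum_ext; intros v _; apply lsum_ext; intros u _.
  unfold pairing; destruct (Z.eq_dec (fst u) (fst v)) as [E | E];
    destruct (Z.eq_dec (fst v) (fst u)) as [E' | E']; try congruence.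
  - rewrite E; ring.
  - ring.
Qed.

(* The weight is submultiplicative and absorbs multipliers of linear growth, cf. [bil_bound]. *)
Definition tweight (rho : R) (a : Z) : R := 1 + Rabs (IZR a) / rho.

(** A weighted Wiener algebra norm, taken over list entries; repeated frequencies can only increase
    it, and submultiplicativity needs no cancellation. *)
Definition tnorm (rho : R) (U : tpoly) : R :=
  lsum (fun u => Rabs (snd u) * tweight rho (fst u)) U.

Lemma tweight_ge1 (rho : R) (a : Z) : 0 < rho -> 1 <= tweight rho a.
Proof.
  intros H; unfold tweight.
  assert (0 <= Rabs (IZR a) / rho); [| lra].
  apply Rdiv_le_0_compat; [apply Rabs_pos | exact H].
Qed.

Lemma tweight_plus (rho : R) (a b : Z) : 0 < rho ->
  tweight rho (a + b) <= tweight rho a * tweight rho b.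
Proof.
  intros H; unfold tweight; rewrite plus_IZR.
  set (x := Rabs (IZR a)); set (y := Rabs (IZR b)).
  assert (0 <= x / rho) by (apply Rdiv_le_0_compat; [apply Rabs_pos | exact H]).
  assert (0 <= y / rho) by (apply Rdiv_le_0_compat; [apply Rabs_pos | exact H]).
  assert (Rabs (IZR a + IZR b) / rho <= x / rho + y / rho).
  { replace (x / rho + y / rho) with ((x + y) / rho) by (field; lra).
    apply Rmult_le_compat_r; [left; now apply Rinv_0_lt_compat | apply Rabs_triang]. }
  nra.
Qed.

Lemma tnorm_nonneg (rho : R) (U : tpoly) : 0 < rho -> 0 <= tnorm rho U.
Proof.
  intros H; unfold tnorm; induction U as [| u U IH]; [simpl; lra |].
  rewrite lsum_cons.
  pose proof (Rabs_pos (snd u)); pose proof (tweight_ge1 rho (fst u) H).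
  nra.
Qed.

Lemma tnorm_app (rho : R) (U V : tpoly) : tnorm rho (U ++ V) = tnorm rho U + tnorm rho V.
Proof. apply lsum_app. Qed.

Lemma tnorm_tscal (rho c : R) (U : tpoly) : tnorm rho (tscal c U) = Rabs c * tnorm rho U.
Proof.
  unfold tnorm, tscal; rewrite lsum_map, <- lsum_scal; apply lsum_ext; intros u _.
  cbn [fst snd]; rewrite Rabs_mult; ring.
Qed.

Lemma tnorm_tmul (rho : R) (U V : tpoly) : 0 < rho ->
  tnorm rho (tmul U V) <= tnorm rho U * tnorm rho V.
Proof.
  intros H; induction U as [| u U IH]; [simpl; lra |].
  cbn [tmul flat_map]; fold (tmul U V); rewrite tnorm_app.
  change (tnorm rho (u :: U)) with (Rabs (snd u) * tweight rho (fst u) + tnorm rho U).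
  assert (tnorm rho (map (fun v => ((fst u + fst v)%Z, snd u * snd v)) V)
     <= Rabs (snd u) * tweight rho (fst u) * tnorm rho V); [| nra].
  unfold tnorm; rewrite lsum_map, <- lsum_scal; apply lsum_le; intros v _; cbn [fst snd].
  rewrite Rabs_mult.
  pose proof (tweight_plus rho (fst u) (fst v) H).
  pose proof (Rmult_le_pos _ _ (Rabs_pos (snd u)) (Rabs_pos (snd v))).
  nra.
Qed.

Lemma tnorm_tpow (rho : R) (U : tpoly) (n : nat) : 0 < rho ->
  tnorm rho (tpow U n) <= tnorm rho U ^ n.
Proof.
  intros H; induction n as [| n IH].
  - unfold tnorm, tweight; simpl; rewrite Rabs_R0, Rabs_R1; unfold Rdiv; lra.
  - cbn [tpow pow]; apply Rle_trans with (1 := tnorm_tmul rho U (tpow U n) H).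
    apply Rmult_le_compat_l; [now apply tnorm_nonneg | exact IH].
Qed.

Lemma tweight_bound_nonneg (rho m : R) (mu : Z -> R) : 0 < rho ->
  (forall a, Rabs (mu a) <= m * tweight rho a) -> 0 <= m.
Proof.
  intros Hr Hm; specialize (Hm 0%Z); pose proof (Rabs_pos (mu 0%Z)).
  pose proof (tweight_ge1 rho 0 Hr); nra.
Qed.

(** Dropping the matching of frequencies only enlarges the double sum of absolute values; the growth
    of the multiplier is charged to the weight of the first factor. *)
Lemma bil_bound (rho m : R) (mu : Z -> R) (U V : tpoly) : 0 < rho ->
  (forall a, Rabs (mu a) <= m * tweight rho a) ->
  Rabs (bil mu U V) <= m * tnorm rho U * tnorm rho V.
Proof.
  intros H Hmu; unfold bil.
  pose proof (tweight_bound_nonneg rho m mu H Hmu) as Hm.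
  apply Rle_trans with (1 := lsum_Rabs _ _).
  unfold tnorm at 1; rewrite <- lsum_scal, Rmult_comm, <- lsum_scal.
  apply lsum_le; intros u _.
  apply Rle_trans with (1 := lsum_Rabs _ _).
  rewrite Rmult_comm; unfold tnorm; rewrite <- lsum_scal.
  apply lsum_le; intros v _.
  rewrite Rabs_mult.
  pose proof (tweight_ge1 rho (fst u) H); pose proof (tweight_ge1 rho (fst v) H).
  pose proof (Rabs_pos (snd u)) as Pu; pose proof (Rabs_pos (snd v)) as Pv.
  pose proof (Rmult_le_pos _ _ Pu Pv) as Puv.
  assert (Hp : Rabs (pairing u v) <= Rabs (snd u) * Rabs (snd v)).
  { unfold pairing; destruct (Z.eq_dec (fst u) (fst v)).
    - rewrite Rabs_mult; lra.
    - rewrite Rabs_R0; exact Puv. }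
  apply Rle_trans with (Rabs (snd u) * Rabs (snd v) * (m * tweight rho (fst u))).
  - apply Rmult_le_compat; try apply Rabs_pos; [exact Hp | apply Hmu].
  - apply Rle_trans with ((Rabs (snd u) * Rabs (snd v) * (m * tweight rho (fst u))) * tweight rho (fst v)).
    + rewrite <- (Rmult_1_r (Rabs (snd u) * Rabs (snd v) * (m * tweight rho (fst u)))) at 1.
      apply Rmult_le_compat_l; [| assumption].
      apply Rmult_le_pos; [exact Puv | apply Rmult_le_pos; lra].
    + right; ring.
Qed.

Lemma Zsum_bil (w : Z -> Z -> R) (G : tpoly) : (forall a : Z, Zsummable (w a)) ->
  Zsum (fun n => bil (fun a => w a n) G G) = bil (fun a => Zsum (w a)) G G.
Proof.
  intros H; unfold bil.
  assert (H1 : forall u, Zsummable (fun n => lsum (fun v => pairing u v * w (fst u) n) G)).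
  { intros u; apply Zsum_lsum; intros v _; apply (Zsummable_scal _ _ (H (fst u))). }
  rewrite (proj2 (Zsum_lsum (fun u n => lsum (fun v => pairing u v * w (fst u) n) G) G
     (fun u _ => H1 u))).
  apply lsum_ext; intros u _.
  rewrite (proj2 (Zsum_lsum (fun v n => pairing u v * w (fst u) n) G
     (fun v _ => Zsummable_scal _ _ (H (fst u))))).
  apply lsum_ext; intros v _; apply Zsum_scal.
Qed.

(* Averaging [f] times a rotated trigonometric polynomial over rotations
   decouples: the power spectrum becomes a convolution, carried here by the
   multiplier [s] instead of the spectrum. *)
Lemma wsum_rotation_average (G : tpoly) : exists m : nat, (0 < m)%nat /\
  (bil (fun _ => 1) G G = lsum (fun j => Cmod (ev G (rot m j)) ^ 2) (seq 0 m) / INR m) /\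
  forall (s : Z -> R) (f : R -> C) (M D : R),
  (forall n, Rabs (s n) <= M) -> contC f -> (forall x, Cmod (f x) <= D) ->
  (forall al, exists D', forall x, Cmod (f x * ev G (x + al)) <= D') ->
  lsum (fun j => wsum s (fun x => (f x * ev G (x + rot m j))%C)) (seq 0 m) / INR m
    = wsum (fun z => bil (fun a => s (z + a)%Z) G G) f.
Proof.
  destruct (twisted_mean_square G) as [m [Hm HG]].
  assert (Hm' : 0 < INR m) by now apply lt_0_INR.
  exists m; split; [exact Hm |]; split.
  - unfold ev; rewrite HG.
    rewrite (bil_ext (fun a => Cmod (RtoC 1) ^ 2) (fun _ => 1)).
    + field; lra.
    + intros _; rewrite Cmod_1; ring.
  - intros s f M D HM Hf HD HD'.
    assert (Hsm : forall a : Z, Zsummable (fun n => s n * nu f (n - a))).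
    { intros a.
      assert (H : Zsummable (fun n => s (n + a)%Z * nu f n))
        by (apply (wsum_bounded _ f M D); auto).
      apply Zsummable_ext with (2 := proj1 (Zsum_shift _ (- a) H)).
      intros n; f_equal; f_equal; lia. }
    assert (Hsp : forall j, Zsummable (fun n => s n * nu (fun x => (f x * ev G (x + rot m j))%C) n)).
    { intros j; destruct (HD' (rot m j)) as [D' HDj].
      apply (wsum_bounded _ _ M D'); [exact HM | | exact HDj].
      apply contC_mult; [exact Hf | apply contC_ev_shift]. }
    transitivity (bil (fun a => Zsum (fun n => s n * nu f (n - a))) G G).
    + rewrite <- (Zsum_bil (fun a n => s n * nu f (n - a))) by exact Hsm.
      unfold wsum.
      rewrite <- (proj2 (Zsum_lsum (fun j n => s n * nu (fun x => (f x * ev G (x + rot m j))%C) n)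
         (seq 0 m) (fun j _ => Hsp j))).
      rewrite (Zsum_ext _ (fun n => INR m * bil (fun a => s n * nu f (n - a)) G G)).
      * rewrite Zsum_scal; field; lra.
      * intros n.
        rewrite lsum_scal, bil_scal_l; unfold nu at 1.
        rewrite (lsum_ext _ (fun j => Cmod (twisted (fun a => fourier f (n - a)) G (rot m j)) ^ 2))
          by (intros j _; now rewrite fourier_mult_ev).
        rewrite HG; unfold nu; ring.
    + unfold wsum.
      assert (H0 : forall a : Z, Zsummable (fun n => s (n + a)%Z * nu f n))
        by (intros a; apply (wsum_bounded _ f M D); auto).
      rewrite (bil_ext _ (fun a => Zsum (fun n => s (n + a)%Z * nu f n))).
      2: { intros a.
           rewrite <- (proj2 (Zsum_shift _ (- a) (H0 a))); apply Zsum_ext; intros n.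
           f_equal; f_equal; lia. }
      rewrite <- (Zsum_bil (fun a n => s (n + a)%Z * nu f n)) by exact H0.
      apply Zsum_ext; intros n.
      rewrite (bil_ext _ (fun a => nu f n * s (n + a)%Z)) by (intros; ring).
      rewrite bil_scal_l; ring.
Qed.

(** * Blocks and their Taylor polynomials *)

Definition amp : R := Rpower 2 (- (1 / 3)).

Lemma amp_pos : 0 < amp.
Proof. apply exp_pos. Qed.

Lemma amp_cube : amp ^ 3 = / 2.
Proof.
  unfold amp; rewrite <- Rpower_pow by apply exp_pos.
  rewrite Rpower_mult; replace (- (1 / 3) * INR 3) with (- (1)) by (simpl; field).
  rewrite Rpower_Ropp, Rpower_1; lra.
Qed.

Lemma amp_bounds : 1 / 2 < amp < 4 / 5.
Proof.
  pose proof amp_pos as H; pose proof amp_cube as E; simpl in E.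
  split.
  - apply Rnot_le_lt; intros H1.
    assert (amp * amp <= 1 / 4) by nra.
    assert (amp * (amp * amp) <= 1 / 8) by nra; lra.
  - apply Rnot_le_lt; intros H1.
    assert (16 / 25 <= amp * amp) by nra.
    assert (64 / 125 <= amp * (amp * amp)) by nra; lra.
Qed.

Lemma amp_pow_pos (l : nat) : 0 < amp ^ l.
Proof. apply pow_lt, amp_pos. Qed.

Lemma amp_pow_le1 (l : nat) : amp ^ l <= 1.
Proof.
  rewrite <- (pow1 l); apply pow_incr; pose proof amp_bounds; lra.
Qed.

(** The criticality of 1/3: three amplitudes exactly compensate a multiplier of size 2^l. *)
Lemma amp_pow_cube (l : nat) : amp ^ l * amp ^ l * amp ^ l * 2 ^ l = 1.
Proof.
  rewrite <- !Rpow_mult_distr; replace (amp * amp * amp * 2) with (amp ^ 3 * 2) by ring.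
  rewrite amp_cube, Rinv_l by lra; apply pow1.
Qed.

Definition phase (l : nat) (p q : Z) (t : R) : R :=
  amp ^ l * (sin (IZR p * t) + sin (IZR q * t) + sin (IZR (p + q) * t)).

(* The Fourier coefficients of [i * phase] are real. *)
Definition mode (l : nat) (p q : Z) : tpoly :=
  [(p, amp ^ l / 2); ((- p)%Z, - (amp ^ l / 2)); (q, amp ^ l / 2); ((- q)%Z, - (amp ^ l / 2));
   ((p + q)%Z, amp ^ l / 2); ((- (p + q))%Z, - (amp ^ l / 2))].

(** Degrees 0, 1 and 2 are always present because the expansion of the transfer operator makes them
    explicit; [J] counts the adjustable rest. *)
Definition approx (l : nat) (p q : Z) (J : nat) : tpoly := texp (mode l p q) 0 (3 + J).

Lemma phase_bound (l : nat) (p q : Z) (t : R) : Rabs (phase l p q t) <= 3 * amp ^ l.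
Proof.
  unfold phase; rewrite Rabs_mult, (Rabs_pos_eq (amp ^ l)) by (left; apply amp_pow_pos).
  rewrite Rmult_comm; apply Rmult_le_compat_r; [left; apply amp_pow_pos |].
  apply Rabs_le.
  pose proof (SIN_bound (IZR p * t)); pose proof (SIN_bound (IZR q * t));
    pose proof (SIN_bound (IZR (p + q) * t)); lra.
Qed.

Lemma ev_mode (l : nat) (p q : Z) (t : R) : ev (mode l p q) t = (0, phase l p q t).
Proof.
  unfold mode; rewrite !ev_cons; cbn [fst snd]; unfold ev, expi, phase; cbn [twisted].
  rewrite !opp_IZR, <- !Ropp_mult_distr_l, !cos_neg, !sin_neg.
  unfold Cplus, Cmult, RtoC; simpl; f_equal; field.
Qed.

Fixpoint ipow (n : nat) : C := match n with O => RtoC 1 | S m => (Ci * ipow m)%C end.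

Fixpoint exp_taylor (n : nat) (t : R) : C :=
  match n with
  | O => RtoC 0
  | S m => (exp_taylor m t + RtoC (/ INR (fact m) * t ^ m) * ipow m)%C
  end.

Lemma ev_tpow_mode (l : nat) (p q : Z) (n : nat) (t : R) :
  ev (tpow (mode l p q) n) t = (RtoC (phase l p q t ^ n) * ipow n)%C.
Proof.
  induction n as [| n IH].
  - cbn [tpow]; rewrite ev_cons; unfold ev; simpl; rewrite Rmult_0_l, expi_0; ring.
  - cbn [tpow]; rewrite ev_tmul, IH, ev_mode; cbn [ipow pow].
    rewrite RtoC_mult.
    replace ((0, phase l p q t) : C) with (RtoC (phase l p q t) * Ci)%C
      by (unfold Cmult, RtoC, Ci; simpl; f_equal; ring).
    ring.
Qed.

Lemma ev_texp_mode (l : nat) (p q : Z) (n k : nat) (t : R) :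
  (exp_taylor k (phase l p q t) + ev (texp (mode l p q) k n) t)%C
    = exp_taylor (k + n) (phase l p q t).
Proof.
  revert k; induction n as [| n IH]; intros k.
  - rewrite Nat.add_0_r; unfold ev; simpl; ring.
  - cbn [texp]; rewrite ev_app, <- Nat.add_succ_comm, <- IH.
    unfold tterm; rewrite ev_tscal, ev_tpow_mode; cbn [exp_taylor].
    rewrite (RtoC_mult (/ INR (fact k))); ring.
Qed.

Lemma ev_approx (l : nat) (p q : Z) (J : nat) (t : R) :
  ev (approx l p q J) t = exp_taylor (3 + J) (phase l p q t).
Proof.
  change (3 + J)%nat with (0 + (3 + J))%nat; rewrite <- ev_texp_mode.
  cbn [exp_taylor]; unfold approx; ring.
Qed.

Lemma is_derive_monomial (N : nat) (c t : R) :
  is_derive (fun t => / INR (fact (S N)) * t ^ S N * c) t (/ INR (fact N) * t ^ N * c).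
Proof.
  evar_last.
  - apply (is_derive_scal_l (V := R_NormedModule) (fun t => / INR (fact (S N)) * t ^ S N) t
      (/ INR (fact (S N)) * (INR (S N) * 1 * t ^ pred (S N))) c).
    apply is_derive_scal, is_derive_pow.
    exact (is_derive_id t).
  - rewrite fact_simpl, mult_INR; unfold scal; cbn -[INR fact pow]; unfold mult; cbn -[INR fact pow].
    field; split; [apply INR_fact_neq_0 | apply not_0_INR; lia].
Qed.

(** The mean value theorem on [0, t] for t^(N+1)/(N+1)! - u(t), whose derivative is nonnegative
    there. *)
Lemma primitive_bound_nonneg (u du : R -> R) (N : nat) :
  (forall t, is_derive u t (du t)) -> u 0 = 0 ->
  (forall t, 0 <= t -> du t <= t ^ N / INR (fact N)) ->
  forall t, 0 <= t -> u t <= t ^ S N / INR (fact (S N)).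
Proof.
  intros Hd H0 Hb t Ht.
  assert (HN : 0 < INR (fact N)) by apply INR_fact_lt_0.
  assert (HS : 0 < INR (S N)) by (apply lt_0_INR; lia).
  destruct (MVT_gen (fun x => x ^ S N / INR (fact (S N)) - u x) 0 t
    (fun x => x ^ N / INR (fact N) - du x)) as [c [[Hc1 Hc2] E]].
  - intros x _.
    apply (is_derive_minus (fun x => x ^ S N / INR (fact (S N))) u); [| apply Hd].
    assert (E0 : forall t, / INR (fact (S N)) * t ^ S N * 1 = t ^ S N / INR (fact (S N)))
      by (intros; unfold Rdiv; ring).
    apply (is_derive_ext _ _ _ _ E0).
    replace (x ^ N / INR (fact N)) with (/ INR (fact N) * x ^ N * 1) by (unfold Rdiv; ring).
    apply is_derive_monomial.
  - intros x _.
    apply (continuity_pt_filterlim (fun x => x ^ S N / INR (fact (S N)) - u x)).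
    apply (continuous_minus (fun x => x ^ S N / INR (fact (S N))) u).
    + apply (ex_derive_continuous (fun x => x ^ S N / INR (fact (S N)))); auto_derive; exact I.
    + apply (ex_derive_continuous u); exists (du x); apply Hd.
  - rewrite Rmin_left in Hc1 by lra.
    rewrite H0, pow_i in E by lia.
    specialize (Hb c Hc1).
    assert (0 <= (c ^ N / INR (fact N) - du c) * (t - 0)) by (apply Rmult_le_pos; lra).
    unfold Rdiv in E at 2; rewrite Rmult_0_l in E; lra.
Qed.

Lemma primitive_bound (u du : R -> R) (N : nat) :
  (forall t, is_derive u t (du t)) -> u 0 = 0 ->
  (forall t, Rabs (du t) <= Rabs t ^ N / INR (fact N)) ->
  forall t, Rabs (u t) <= Rabs t ^ S N / INR (fact (S N)).
Proof.
  intros Hd H0 Hb.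
  assert (Hpos : forall w dw : R -> R, (forall t, is_derive w t (dw t)) -> w 0 = 0 ->
    (forall t, Rabs (dw t) <= Rabs t ^ N / INR (fact N)) ->
    forall t, 0 <= t -> Rabs (w t) <= t ^ S N / INR (fact (S N))).
  { intros w dw Hw Hw0 Hwb t Ht; apply Rabs_le; split.
    - assert (- w t <= t ^ S N / INR (fact (S N))); [| lra].
      apply (primitive_bound_nonneg (fun x => - w x) (fun x => - dw x)); try assumption.
      + intros x; apply (is_derive_opp w); apply Hw.
      + rewrite Hw0; ring.
      + intros x Hx; specialize (Hwb x); rewrite (Rabs_pos_eq x) in Hwb by exact Hx.
        apply Rabs_le_between in Hwb; lra.
    - apply (primitive_bound_nonneg w dw); try assumption.
      intros x Hx; specialize (Hwb x); rewrite (Rabs_pos_eq x) in Hwb by exact Hx.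
      apply Rabs_le_between in Hwb; lra. }
  intros t; destruct (Rle_dec 0 t) as [Ht | Ht].
  - rewrite (Rabs_pos_eq t) by exact Ht; now apply (Hpos u du).
  - rewrite (Rabs_left t) by lra.
    replace (u t) with (u (- - t)) by (f_equal; ring).
    apply (Hpos (fun x => u (- x)) (fun x => - du (- x))); [| | | lra].
    + intros x.
      evar_last.
      * apply (is_derive_comp u (fun x => - x) x (du (- x)) (- (1))); [apply Hd |].
        apply (is_derive_opp (fun x => x) x 1); exact (is_derive_id x).
      * change (- (1) * du (- x) = - du (- x)); ring.
    + rewrite Ropp_0; exact H0.
    + intros x; rewrite Rabs_Ropp, <- (Rabs_Ropp x); apply Hb.
Qed.

Lemma exp_taylor_derive (N : nat) (t : R) :
  is_derive (fun t => fst (exp_taylor (S N) t)) t (- snd (exp_taylor N t)) /\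
  is_derive (fun t => snd (exp_taylor (S N) t)) t (fst (exp_taylor N t)).
Proof.
  induction N as [| N [IH1 IH2]].
  - assert (E1 : forall x, 1 = fst (exp_taylor 1 x)) by (intros x; simpl; field).
    assert (E2 : forall x, 0 = snd (exp_taylor 1 x)) by (intros x; simpl; field).
    split; [apply (is_derive_ext _ _ _ _ E1) | apply (is_derive_ext _ _ _ _ E2)].
    + replace (- snd (exp_taylor 0 t)) with 0 by (simpl; ring).
      apply (is_derive_const (V := R_NormedModule) 1).
    + apply (is_derive_const (V := R_NormedModule) 0).
  - assert (E1 : forall x, fst (exp_taylor (S N) x)
        + / INR (fact (S N)) * x ^ S N * fst (ipow (S N)) = fst (exp_taylor (S (S N)) x))
      by (intros x; cbn [exp_taylor]; unfold Cplus, Cmult, RtoC; cbn [fst snd]; ring).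
    assert (E2 : forall x, snd (exp_taylor (S N) x)
        + / INR (fact (S N)) * x ^ S N * snd (ipow (S N)) = snd (exp_taylor (S (S N)) x))
      by (intros x; cbn [exp_taylor]; unfold Cplus, Cmult, RtoC; cbn [fst snd]; ring).
    split; [apply (is_derive_ext _ _ _ _ E1) | apply (is_derive_ext _ _ _ _ E2)].
    + replace (- snd (exp_taylor (S N) t)) with
        (- snd (exp_taylor N t) + / INR (fact N) * t ^ N * fst (ipow (S N)))
        by (cbn [exp_taylor ipow]; unfold Cplus, Cmult, RtoC, Ci; cbn [fst snd]; ring).
      apply (is_derive_plus (fun t => fst (exp_taylor (S N) t))); [exact IH1 |].
      apply is_derive_monomial.
    + replace (fst (exp_taylor (S N) t)) with
        (fst (exp_taylor N t) + / INR (fact N) * t ^ N * snd (ipow (S N)))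
        by (cbn [exp_taylor ipow]; unfold Cplus, Cmult, RtoC, Ci; cbn [fst snd]; ring).
      apply (is_derive_plus (fun t => snd (exp_taylor (S N) t))); [exact IH2 |].
      apply is_derive_monomial.
Qed.

Lemma exp_taylor_0 (N : nat) : exp_taylor (S N) 0 = RtoC 1.
Proof.
  induction N as [| N IH].
  - simpl; rewrite Rinv_1, Rmult_1_r; ring.
  - cbn [exp_taylor]; cbn [exp_taylor] in IH; rewrite IH, pow_i, Rmult_0_r by lia; ring.
Qed.

(** Up to sign and an exchange of sine and cosine, the derivative of a remainder is the remainder
    one order lower. For N = 0 the Taylor sum is empty and the claim is |cos|, |sin| <= 1. *)
Lemma exp_taylor_bound (N : nat) (t : R) :
  Rabs (cos t - fst (exp_taylor N t)) <= Rabs t ^ N / INR (fact N) /\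
  Rabs (sin t - snd (exp_taylor N t)) <= Rabs t ^ N / INR (fact N).
Proof.
  revert t; induction N as [| N IH]; intros t.
  - simpl; unfold Rdiv; rewrite Rinv_1, !Rminus_0_r, Rmult_1_r.
    split; apply Rabs_le; [apply COS_bound | apply SIN_bound].
  - split.
    + apply (primitive_bound (fun t => cos t - fst (exp_taylor (S N) t))
        (fun t => - sin t - - snd (exp_taylor N t))).
      * intros x; apply (is_derive_minus cos); [apply is_derive_cos | apply exp_taylor_derive].
      * rewrite exp_taylor_0, cos_0; simpl; ring.
      * intros x; replace (- sin x - - snd (exp_taylor N x))
          with (- (sin x - snd (exp_taylor N x))) by ring.
        rewrite Rabs_Ropp; apply IH.
    + apply (primitive_bound (fun t => sin t - snd (exp_taylor (S N) t))
        (fun t => cos t - fst (exp_taylor N t))).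
      * intros x; apply (is_derive_minus sin); [apply is_derive_sin | apply exp_taylor_derive].
      * rewrite exp_taylor_0, sin_0; simpl; ring.
      * intros x; apply IH.
Qed.

(** Phases are at most 3 at every level, so the error is uniform in level, frequencies and rotation;
    the factor 2 is a crude bound for the square root of 2. *)
Definition taylor_error (J : nat) : R := 2 * (3 ^ (3 + J) / INR (fact (3 + J))).

Lemma taylor_error_pos (J : nat) : 0 < taylor_error J.
Proof.
  unfold taylor_error; apply Rmult_lt_0_compat; [lra |].
  apply Rdiv_lt_0_compat; [apply pow_lt; lra | apply INR_fact_lt_0].
Qed.

Lemma taylor_error_small (e : R) : 0 < e -> exists J, taylor_error J < e.
Proof.
  intros He.
  destruct (cv_speed_pow_fact 3 (e / 2)) as [N HN]; [lra |].
  exists N; specialize (HN (3 + N)%nat); unfold taylor_error.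
  unfold Rdist in HN; rewrite Rminus_0_r in HN.
  assert (H : Rabs (3 ^ (3 + N) / INR (fact (3 + N))) < e / 2) by (apply HN; lia).
  apply Rabs_lt_between in H; lra.
Qed.

Lemma approx_error (l : nat) (p q : Z) (J : nat) (t : R) :
  Cmod (expi (phase l p q t) - ev (approx l p q J) t) <= taylor_error J.
Proof.
  rewrite ev_approx; set (N := (3 + J)%nat); set (y := phase l p q t).
  destruct (exp_taylor_bound N y) as [H1 H2].
  assert (Hy : Rabs y ^ N / INR (fact N) <= 3 ^ N / INR (fact N)).
  { apply Rmult_le_compat_r; [left; apply Rinv_0_lt_compat, INR_fact_lt_0 |].
    apply pow_incr; split; [apply Rabs_pos |].
    apply Rle_trans with (1 := phase_bound l p q t); pose proof (amp_pow_le1 l); lra. }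
  apply Rle_trans with (1 := Cmod_2Rmax _); unfold taylor_error; fold N.
  assert (Hs : sqrt 2 <= 2).
  { rewrite <- (sqrt_square 2) at 2 by lra; apply sqrt_le_1; lra. }
  assert (Hm : Rmax (Rabs (fst (expi y - exp_taylor N y)%C)) (Rabs (snd (expi y - exp_taylor N y)%C))
    <= 3 ^ N / INR (fact N)).
  { apply Rmax_lub; cbn [fst snd expi Cminus Cplus Copp].
    - apply Rle_trans with (2 := Hy), H1.
    - apply Rle_trans with (2 := Hy), H2. }
  apply Rmult_le_compat; try assumption; [apply sqrt_pos |].
  apply Rle_trans with (2 := Rmax_l _ _), Rabs_pos.
Qed.

(** * The transfer operator of a block *)

Definition admissible (l : nat) (c : Z * Z) : Prop :=
  Rabs (IZR (fst c)) <= 8 * 2 ^ l /\ Rabs (IZR (snd c)) <= 8 * 2 ^ l.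

(** A bound for all of p, q and p + q in an admissible block, so that their weights are at most
    2. *)
Definition rad (l : nat) : R := 16 * 2 ^ l.

Lemma pow_two_pos (l : nat) : 0 < 2 ^ l.
Proof. apply pow_lt; lra. Qed.

Lemma rad_pos (l : nat) : 0 < rad l.
Proof. pose proof (pow_two_pos l); unfold rad; lra. Qed.

Lemma tweight_le2 (l : nat) (a : Z) : Rabs (IZR a) <= 16 * 2 ^ l -> tweight (rad l) a <= 2.
Proof.
  intros H; unfold tweight.
  assert (Rabs (IZR a) / rad l <= 1); [| lra].
  apply Rle_div_l; [apply rad_pos | unfold rad; lra].
Qed.

Lemma tnorm_mode (l : nat) (p q : Z) : admissible l (p, q) ->
  tnorm (rad l) (mode l p q) <= 6 * amp ^ l.
Proof.
  intros [Hp Hq]; cbn [fst snd] in Hp, Hq.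
  pose proof (amp_pow_pos l) as Hh; pose proof (pow_two_pos l).
  assert (Hr : Rabs (IZR (p + q)) <= 16 * 2 ^ l).
  { rewrite plus_IZR; apply Rle_trans with (1 := Rabs_triang _ _); lra. }
  unfold tnorm, mode; rewrite !lsum_cons; cbn [fst snd lsum fold_right].
  rewrite !Rabs_Ropp, (Rabs_pos_eq (amp ^ l / 2)) by lra.
  assert (forall a, Rabs (IZR a) <= 16 * 2 ^ l ->
     amp ^ l / 2 * tweight (rad l) a <= amp ^ l /\ amp ^ l / 2 * tweight (rad l) (- a) <= amp ^ l) as K.
  { intros a Ha; split.
    - pose proof (tweight_le2 l a Ha); nra.
    - assert (Ha' : Rabs (IZR (- a)) <= 16 * 2 ^ l) by (rewrite opp_IZR, Rabs_Ropp; exact Ha).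
      pose proof (tweight_le2 l _ Ha'); nra. }
  destruct (K p) as [? ?]; [lra |]; destruct (K q) as [? ?]; [lra |].
  destruct (K _ Hr) as [? ?]; lra.
Qed.

(** A mode has six entries with coefficient of modulus amp^l / 2 and weight at most 2, hence norm at
    most 6 amp^l; the exponential series at 6 then dominates all tails. *)
Definition exp6 : R := exp 6.

Lemma exp6_sum (k n : nat) : lsum (fun j => 6 ^ j / INR (fact j)) (seq k n) <= exp6.
Proof.
  assert (Hpos : forall j, 0 <= 6 ^ j / INR (fact j)).
  { intros j; apply Rdiv_le_0_compat; [apply pow_le; lra | apply INR_fact_lt_0]. }
  assert (Hsum : forall N, lsum (fun j => 6 ^ j / INR (fact j)) (seq 0 (S N))
     = sum_f_R0 (fun j => 6 ^ j / INR (fact j)) N).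
  { induction N as [| N IH]; [simpl; ring |].
    rewrite seq_S, lsum_app, IH; cbn [sum_f_R0 Nat.add lsum fold_right]; ring. }
  apply Rle_trans with (lsum (fun j => 6 ^ j / INR (fact j)) (seq 0 (S (k + n)))).
  - rewrite seq_S, seq_app, !lsum_app; cbn [Nat.add].
    assert (0 <= lsum (fun j => 6 ^ j / INR (fact j)) (seq 0 k)).
    { rewrite <- (Rmult_0_r (INR (length (seq 0 k)))), <- lsum_const; apply lsum_le; auto. }
    cbn [lsum fold_right]; pose proof (Hpos (k + n)%nat); lra.
  - rewrite Hsum; unfold exp6, exp; destruct (exist_exp 6) as [e He]; cbn [proj1_sig].
    apply sum_incr; [| exact Hpos].
    intros eps Heps; destruct (He eps Heps) as [N HN]; exists N; intros m Hm.
    replace (sum_f_R0 (fun j => 6 ^ j / INR (fact j)) m)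
      with (sum_f_R0 (fun i => / INR (fact i) * 6 ^ i) m); [now apply HN |].
    apply sum_eq; intros; unfold Rdiv; ring.
Qed.

Lemma exp6_ge1 : 1 <= exp6.
Proof. unfold exp6; pose proof (exp_ineq1 6); lra. Qed.

(** A term of degree at least k supplies k small amplitudes; its surplus amplitudes are bounded by
    1. *)
Lemma tnorm_texp (l : nat) (p q : Z) (k n : nat) : admissible l (p, q) ->
  tnorm (rad l) (texp (mode l p q) k n) <= (amp ^ l) ^ k * exp6.
Proof.
  intros Ha.
  assert (H : forall n j, (k <= j)%nat -> tnorm (rad l) (texp (mode l p q) j n)
     <= (amp ^ l) ^ k * lsum (fun j => 6 ^ j / INR (fact j)) (seq j n)).
  { clear n; induction n as [| n IH]; intros j Hj; [simpl; lra |].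
    cbn [texp seq]; rewrite tnorm_app, lsum_cons, Rmult_plus_distr_l.
    apply Rplus_le_compat; [| apply IH; lia].
    unfold tterm; rewrite tnorm_tscal.
    assert (Hf : 0 < / INR (fact j)) by apply Rinv_0_lt_compat, INR_fact_lt_0.
    rewrite Rabs_pos_eq by lra.
    replace ((amp ^ l) ^ k * (6 ^ j / INR (fact j))) with (/ INR (fact j) * ((amp ^ l) ^ k * 6 ^ j))
      by (unfold Rdiv; ring).
    apply Rmult_le_compat_l; [lra |].
    apply Rle_trans with (1 := tnorm_tpow (rad l) _ j (rad_pos l)).
    apply Rle_trans with ((6 * amp ^ l) ^ j).
    - apply pow_incr; split; [apply tnorm_nonneg, rad_pos | now apply tnorm_mode].
    - rewrite Rpow_mult_distr, Rmult_comm; apply Rmult_le_compat_r; [apply pow_le; lra |].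
      replace j with (k + (j - k))%nat by lia; rewrite pow_add.
      rewrite <- (Rmult_1_r ((amp ^ l) ^ k)) at 2.
      apply Rmult_le_compat_l; [apply pow_le; left; apply amp_pow_pos |].
      rewrite <- (pow1 (j - k)); apply pow_incr; split; [left; apply amp_pow_pos | apply amp_pow_le1]. }
  apply Rle_trans with (1 := H n k (le_n k)).
  apply Rmult_le_compat_l; [apply pow_le; left; apply amp_pow_pos | apply exp6_sum].
Qed.

Definition approx_tail (l : nat) (p q : Z) (J : nat) : tpoly := texp (mode l p q) 1 (2 + J).

(* The second term restores exact preservation of constants, which [approx]
   satisfies only up to [taylor_error]. *)
Definition transfer (J l : nat) (c : Z * Z) (mu : Z -> R) (z : Z) : R :=
  let G := approx l (fst c) (snd c) J in
  bil (fun a => mu (z + a)%Z) G G + (1 - bil (fun _ => 1) G G) * mu z.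

Lemma bil_zero_mode (mu : Z -> R) (x : R) (V : tpoly) :
  bil mu [(0%Z, x)] V = bil (fun _ => 1) [(0%Z, x)] V * mu 0%Z.
Proof.
  unfold bil; rewrite !lsum_cons; cbn [lsum fold_right fst snd]; rewrite !Rplus_0_r.
  rewrite Rmult_comm, <- lsum_scal; apply lsum_ext; intros v _; ring.
Qed.

(** The constant term of the exponential pairs only at frequency 0, where the increment
    [mu (z + a) - mu z] vanishes. What remains is quadratic in the tail, so the operator is the
    identity up to two amplitudes. *)
Lemma transfer_eq (J l : nat) (p q : Z) (mu : Z -> R) (z : Z) :
  transfer J l (p, q) mu z = mu z +
    bil (fun a => mu (z + a)%Z - mu z) (approx_tail l p q J) (approx_tail l p q J).
Proof.
  unfold transfer; cbn [fst snd].
  set (T := approx_tail l p q J).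
  assert (HG : approx l p q J = [(0%Z, / INR (fact 0) * 1)] ++ T) by reflexivity.
  rewrite HG; clear HG; clearbody T; set (A := [(0%Z, / INR (fact 0) * 1)]).
  assert (E : forall m : Z -> R, bil m (A ++ T) (A ++ T)
     = m 0%Z + 2 * bil (fun _ => 1) A T * m 0%Z + bil m T T).
  { intros m; rewrite bil_app_l, !bil_app_r, (bil_sym m T A).
    unfold A; rewrite (bil_zero_mode m _ T).
    unfold bil at 1; rewrite !lsum_cons; unfold pairing; cbn [lsum fold_right fst snd fact].
    destruct (Z.eq_dec 0 0) as [_ | n]; [| now contradiction n].
    simpl; field. }
  rewrite !E, Z.add_0_r.
  rewrite (bil_ext (fun a => mu (z + a)%Z - mu z) (fun a => mu (z + a)%Z + (- mu z) * 1))
    by (intros; ring).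
  rewrite bil_plus, (bil_scal_l (- mu z) (fun _ => 1)); ring.
Qed.

Lemma transfer_diff_bound (J l : nat) (p q : Z) (mu : Z -> R) (z : Z) (m : R) :
  admissible l (p, q) -> (forall a, Rabs (mu (z + a)%Z - mu z) <= m * tweight (rad l) a) ->
  Rabs (transfer J l (p, q) mu z - mu z) <= m * exp6 ^ 2 * (amp ^ l) ^ 2.
Proof.
  intros Ha Hm; rewrite transfer_eq.
  match goal with |- Rabs (?x + ?y - ?x) <= _ => replace (x + y - x) with y by ring end.
  apply Rle_trans with (1 := bil_bound (rad l) m _ _ _ (rad_pos l) Hm).
  pose proof (tnorm_texp l p q 1 (2 + J) Ha) as H; fold (approx_tail l p q J) in H.
  pose proof (tnorm_nonneg (rad l) (approx_tail l p q J) (rad_pos l)) as H0.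
  pose proof (tweight_bound_nonneg _ m _ (rad_pos l) Hm) as Hm0.
  rewrite pow_1 in H.
  replace (m * exp6 ^ 2 * (amp ^ l) ^ 2) with (m * (amp ^ l * exp6) * (amp ^ l * exp6)) by ring.
  apply Rmult_le_compat; [now apply Rmult_le_pos | exact H0 | | exact H].
  now apply Rmult_le_compat_l.
Qed.

(** Powers of this crude constant either certify summability or multiply [taylor_error], which is
    made small after the length of the cascade is known. *)
Definition csup : R := 1 + 2 * exp6 ^ 2.

Lemma csup_ge1 : 1 <= csup.
Proof. unfold csup; pose proof (pow2_ge_0 exp6); lra. Qed.

Lemma transfer_sup (J l : nat) (c : Z * Z) (mu : Z -> R) (M : R) (z : Z) :
  admissible l c -> (forall n, Rabs (mu n) <= M) -> Rabs (transfer J l c mu z) <= csup * M.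
Proof.
  destruct c as [p q]; intros Ha HM.
  assert (HM0 : 0 <= M) by (apply Rle_trans with (1 := Rabs_pos (mu z)); apply HM).
  assert (H : Rabs (transfer J l (p, q) mu z - mu z) <= (2 * M) * exp6 ^ 2 * (amp ^ l) ^ 2).
  { apply transfer_diff_bound; [exact Ha |]; intros a.
    pose proof (tweight_ge1 (rad l) a (rad_pos l)).
    apply Rle_trans with (2 * M); [| nra].
    pose proof (HM (z + a)%Z) as H1; pose proof (HM z) as H2.
    apply Rabs_le_between in H1; apply Rabs_le_between in H2; apply Rabs_le; lra. }
  assert (Hh : 0 <= (amp ^ l) ^ 2 <= 1).
  { pose proof (amp_pow_pos l); pose proof (amp_pow_le1 l); split; [apply pow2_ge_0 |]; nra. }
  pose proof (HM z) as Hz; apply Rabs_le_between in Hz; apply Rabs_le_between in H.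
  pose proof (pow2_ge_0 exp6).
  assert ((2 * M) * exp6 ^ 2 * (amp ^ l) ^ 2 <= (2 * M) * exp6 ^ 2).
  { rewrite <- (Rmult_1_r (2 * M * exp6 ^ 2)) at 2; apply Rmult_le_compat_l; [| lra].
    apply Rmult_le_pos; lra. }
  unfold csup; apply Rabs_le; lra.
Qed.

Definition block (l : nat) (c : Z * Z) (al x : R) : C :=
  expi (phase l (fst c) (snd c) (x + al)).

Lemma contR_phase (l : nat) (p q : Z) (al : R) : contR (fun x => phase l p q (x + al)).
Proof.
  unfold phase.
  assert (H : forall k : R, contR (fun x => sin (k * (x + al))))
    by (intros k; apply (contR_comp sin (fun x => k * (x + al))); contR_tac).
  apply contR_mult; [apply contR_const |].
  apply contR_plus; [apply contR_plus |]; apply H.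
Qed.

Lemma contC_block (l : nat) (c : Z * Z) (al : R) : contC (block l c al).
Proof. apply contC_expi, contR_phase. Qed.

Lemma Cmod_block (l : nat) (c : Z * Z) (al x : R) : Cmod (block l c al x) = 1.
Proof. apply Cmod_expi. Qed.

(** The mass is the mean of |ev|^2 over rotations, and |ev| is within [taylor_error] of 1; for e <=
    1 this costs e (2 + e) <= 3 e. *)
Lemma approx_mass (J l : nat) (p q : Z) : taylor_error J <= 1 ->
  Rabs (1 - bil (fun _ => 1) (approx l p q J) (approx l p q J)) <= 3 * taylor_error J.
Proof.
  intros HJ; destruct (wsum_rotation_average (approx l p q J)) as [m [Hm [E _]]].
  rewrite E; clear E.
  pose proof (lt_0_INR m Hm) as Hm'.
  replace (1 - lsum (fun j => Cmod (ev (approx l p q J) (rot m j)) ^ 2) (seq 0 m) / INR m)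
    with (lsum (fun j => 1 + - 1 * Cmod (ev (approx l p q J) (rot m j)) ^ 2) (seq 0 m) / INR m).
  2: { rewrite lsum_plus, lsum_scal, lsum_const, length_seq; field; lra. }
  apply seq_avg_bound; [exact Hm |]; intros j _.
  set (e := ev (approx l p q J) (rot m j)); set (g := expi (phase l p q (rot m j))).
  pose proof (approx_error l p q J (rot m j)) as He; fold e g in He.
  pose proof (taylor_error_pos J).
  assert (Hg : Cmod g = 1) by apply Cmod_expi.
  assert (H1 : Cmod e <= 1 + taylor_error J).
  { replace e with (g + - (g - e))%C by ring.
    apply Rle_trans with (1 := Cmod_triangle _ _); rewrite Cmod_opp; lra. }
  assert (H2 : 1 <= Cmod e + taylor_error J).
  { rewrite <- Hg; replace g with (e + (g - e))%C by ring.
    apply Rle_trans with (1 := Cmod_triangle _ _); lra. }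
  pose proof (Cmod_ge_0 e).
  apply Rabs_le; split; nra.
Qed.

Lemma wsum_plus (s s' : Z -> R) (f : R -> C) (M M' D : R) :
  (forall n, Rabs (s n) <= M) -> (forall n, Rabs (s' n) <= M') -> contC f ->
  (forall x, Cmod (f x) <= D) -> wsum (fun n => s n + s' n) f = wsum s f + wsum s' f.
Proof.
  intros HM HM' Hf HD; unfold wsum.
  rewrite <- Zsum_plus by (eapply wsum_bounded; eassumption).
  apply Zsum_ext; intros; ring.
Qed.

Lemma wsum_scal (c : R) (s : Z -> R) (f : R -> C) : wsum (fun n => c * s n) f = c * wsum s f.
Proof.
  unfold wsum; rewrite <- Zsum_scal; apply Zsum_ext; intros; ring.
Qed.

Lemma wsum_ext (s s' : Z -> R) (f : R -> C) : (forall n, s n = s' n) -> wsum s f = wsum s' f.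
Proof. intros H; apply Zsum_ext; intros; now rewrite H. Qed.

Lemma wsum_lsum {A : Type} (s : A -> Z -> R) (l : list A) (f : R -> C) (M D : R) :
  (forall x n, In x l -> Rabs (s x n) <= M) -> contC f -> (forall x, Cmod (f x) <= D) ->
  wsum (fun n => lsum (fun x => s x n) l) f = lsum (fun x => wsum (s x) f) l.
Proof.
  intros HM Hf HD; unfold wsum.
  rewrite <- (proj2 (Zsum_lsum (fun x n => s x n * nu f n) l
    (fun x Hx => proj1 (wsum_bounded (s x) f M D (fun n => HM x n Hx) Hf HD)))).
  apply Zsum_ext; intros n; rewrite Rmult_comm, <- lsum_scal; apply lsum_ext; intros; ring.
Qed.

(** The hypothesis is averaged over the rotations of the block. Passing to Taylor polynomials costs
    9 and the correction of the mass 3, whence 12. *)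
Lemma transfer_test (J l : nat) (c : Z * Z) (s : Z -> R) (f : R -> C) (M eta : R) :
  admissible l c -> (forall n, Rabs (s n) <= M) -> contC f -> (forall x, Cmod (f x) = 1) ->
  taylor_error J <= 1 ->
  (forall al, Rabs (wsum s (fun x => (f x * block l c al x)%C)) <= eta) ->
  Rabs (wsum (transfer J l c s) f) <= eta + 12 * M * taylor_error J.
Proof.
  destruct c as [p q]; intros Ha HM Hf Hf1 HJ Heta.
  assert (HM0 : 0 <= M) by (apply Rle_trans with (1 := Rabs_pos (s 0%Z)); apply HM).
  pose proof (taylor_error_pos J) as HJ0.
  set (G := approx l p q J).
  assert (HfD : forall x, Cmod (f x) <= 1) by (intros; rewrite Hf1; lra).
  assert (HGb : forall t, Cmod (ev G t) <= 2).
  { intros t; pose proof (approx_error l p q J t) as H; fold G in H.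
    replace (ev G t) with (expi (phase l p q t) + - (expi (phase l p q t) - ev G t))%C by ring.
    apply Rle_trans with (1 := Cmod_triangle _ _).
    rewrite Cmod_opp, Cmod_expi; lra. }
  assert (HfG : forall al x, Cmod (f x * ev G (x + al)) <= 2)
    by (intros; rewrite Cmod_mult, Hf1, Rmult_1_l; apply HGb).
  assert (H1 : forall al, Rabs (wsum s (fun x => (f x * ev G (x + al))%C)) <= eta + 9 * M * taylor_error J).
  { intros al.
    assert (Hl : Rabs (wsum s (fun x => (f x * block l (p, q) al x)%C)
        - wsum s (fun x => (f x * ev G (x + al))%C)) <= 9 * M * taylor_error J).
    { apply wsum_lip; try assumption.
      - apply contC_mult; [exact Hf | apply contC_block].
      - apply contC_mult; [exact Hf | apply contC_ev_shift].
      - intros x; rewrite Cmod_mult, Hf1, Cmod_block; lra.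
      - apply HfG.
      - intros x.
        replace (f x * block l (p, q) al x - f x * ev G (x + al))%C
          with (f x * (block l (p, q) al x - ev G (x + al)))%C by ring.
        rewrite Cmod_mult, Hf1, Rmult_1_l; apply approx_error. }
    specialize (Heta al).
    apply Rabs_le_between in Heta; apply Rabs_le_between in Hl; apply Rabs_le; lra. }
  assert (H2 : Rabs (wsum (fun z => bil (fun a => s (z + a)%Z) G G) f) <= eta + 9 * M * taylor_error J).
  { destruct (wsum_rotation_average G) as [m [Hm [_ E]]].
    rewrite <- (E s f M 1 HM Hf HfD (fun al => ex_intro _ 2 (HfG al))).
    apply seq_avg_bound; [exact Hm | intros j _; apply H1]. }
  unfold transfer; cbn [fst snd]; fold G.
  rewrite (wsum_plus (fun z => bil (fun a => s (z + a)%Z) G G)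
    (fun z => (1 - bil (fun _ => 1) G G) * s z) f (M * tnorm (rad l) G * tnorm (rad l) G)
    (Rabs (1 - bil (fun _ => 1) G G) * M) 1); try assumption.
  - rewrite wsum_scal.
    destruct (wsum_bounded s f M 1 HM Hf HfD) as [_ H3].
    pose proof (approx_mass J l p q HJ) as H4; fold G in H4.
    assert (H5 : Rabs ((1 - bil (fun _ => 1) G G) * wsum s f) <= 3 * taylor_error J * (M * 1 ^ 2)).
    { rewrite Rabs_mult; apply Rmult_le_compat; try apply Rabs_pos; assumption. }
    apply Rle_trans with (1 := Rabs_triang _ _); lra.
  - intros n; apply bil_bound; [apply rad_pos |]; intros a.
    apply Rle_trans with (1 := HM (n + a)%Z).
    pose proof (tweight_ge1 (rad l) a (rad_pos l)); nra.
  - intros n; rewrite Rabs_mult; apply Rmult_le_compat_l; [apply Rabs_pos | apply HM].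
Qed.

(** * Cascades of averaged blocks *)

Definition families : Type := list (list (Z * Z)).

Definition transfer_avg (J l : nat) (F : list (Z * Z)) (mu : Z -> R) (z : Z) : R :=
  lsum (fun c => transfer J l c mu z) F / INR (length F).

(** Consecutive levels from l on, with the coarsest operator outermost: the finest family acts first
    on [mu]. *)
Fixpoint cascade (J l : nat) (Fs : families) (mu : Z -> R) : Z -> R :=
  match Fs with
  | [] => mu
  | F :: Fs' => transfer_avg J l F (cascade J (S l) Fs' mu)
  end.

Fixpoint blocks (l : nat) (cs : list (Z * Z * R)) (x : R) : C :=
  match cs with
  | [] => RtoC 1
  | c :: cs' => (block l (fst c) (snd c) x * blocks (S l) cs' x)%C
  end.

Fixpoint choices (Fs : families) (cs : list (Z * Z * R)) : Prop :=
  match Fs, cs with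
  | [], [] => True
  | F :: Fs', c :: cs' => In (fst c) F /\ choices Fs' cs'
  | _, _ => False
  end.

Fixpoint admissible_families (l : nat) (Fs : families) : Prop :=
  match Fs with
  | [] => True
  | F :: Fs' => F <> [] /\ (forall c, In c F -> admissible l c) /\ admissible_families (S l) Fs'
  end.

Lemma cascade_sup (J l : nat) (Fs : families) (mu : Z -> R) (M : R) :
  admissible_families l Fs -> (forall n, Rabs (mu n) <= M) ->
  forall z, Rabs (cascade J l Fs mu z) <= csup ^ length Fs * M.
Proof.
  revert l; induction Fs as [| F Fs IH]; intros l HF HM z.
  - simpl; rewrite Rmult_1_l; apply HM.
  - destruct HF as [HF0 [HF1 HF2]]; cbn [cascade length pow].
    apply lsum_avg_bound; [exact HF0 |]; intros c Hc.
    rewrite Rmult_assoc; apply transfer_sup; [now apply HF1 |].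
    intros n; now apply IH.
Qed.

(** The coarsest block is moved into f, after which the finer levels form a shorter cascade tested
    on a map that is again unimodular. *)
Lemma cascade_test (J l : nat) (Fs : families) (s : Z -> R) (f : R -> C) (M eta : R) :
  admissible_families l Fs -> (forall n, Rabs (s n) <= M) -> contC f ->
  (forall x, Cmod (f x) = 1) -> taylor_error J <= 1 ->
  (forall cs, choices Fs cs -> Rabs (wsum s (fun x => (f x * blocks l cs x)%C)) <= eta) ->
  Rabs (wsum (cascade J l Fs s) f)
    <= eta + INR (length Fs) * (12 * (csup ^ length Fs * M) * taylor_error J).
Proof.
  revert l f; induction Fs as [| F Fs IH]; intros l f HF HM Hf Hf1 HJ Heta.
  - simpl; rewrite Rmult_0_l, Rplus_0_r.
    specialize (Heta [] I); simpl in Heta.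
    replace (wsum s f) with (wsum s (fun x => (f x * 1)%C)); [exact Heta |].
    apply wsum_fun_ext; intros; ring.
  - destruct HF as [HF0 [HF1 HF2]].
    assert (HM0 : 0 <= M) by (apply Rle_trans with (1 := Rabs_pos (s 0%Z)); apply HM).
    pose proof (taylor_error_pos J) as HJ0; pose proof csup_ge1 as HCb.
    assert (HCn : 1 <= csup ^ length Fs) by now apply pow_R1_Rle.
    set (k := length Fs) in *.
    assert (H1 : forall c, In c F -> Rabs (wsum (transfer J l c (cascade J (S l) Fs s)) f)
      <= eta + INR k * (12 * (csup ^ k * M) * taylor_error J) + 12 * (csup ^ k * M) * taylor_error J).
    { intros c Hc; apply transfer_test; try assumption.
      - now apply HF1.
      - intros n; now apply cascade_sup.
      - intros al; apply IH; try assumption.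
        + apply contC_mult; [exact Hf | apply contC_block].
        + intros x; rewrite Cmod_mult, Hf1, Cmod_block; ring.
        + intros cs Hcs.
          replace (wsum s (fun x => (f x * block l c al x * blocks (S l) cs x)%C))
            with (wsum s (fun x => (f x * blocks l ((c, al) :: cs) x)%C)).
          * apply Heta; split; [exact Hc | exact Hcs].
          * apply wsum_fun_ext; intros; cbn [blocks fst snd]; ring. }
    assert (H2 : wsum (cascade J l (F :: Fs) s) f
      = lsum (fun c => wsum (transfer J l c (cascade J (S l) Fs s)) f) F / INR (length F)).
    { cbn [cascade]; unfold transfer_avg.
      rewrite (wsum_ext _ (fun z => / INR (length F)
         * lsum (fun c => transfer J l c (cascade J (S l) Fs s) z) F))
        by (intros; unfold Rdiv; ring).
      rewrite wsum_scal.
      rewrite (wsum_lsum (fun c z => transfer J l c (cascade J (S l) Fs s) z) F f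
         (csup * (csup ^ k * M)) 1).
      - apply Rmult_comm.
      - intros c n Hc; apply transfer_sup; [now apply HF1 |]; intros; now apply cascade_sup.
      - exact Hf.
      - intros x; rewrite Hf1; lra. }
    rewrite H2.
    apply Rle_trans with (1 := lsum_avg_bound _ F _ HF0 H1).
    cbn [length]; fold k; rewrite S_INR; cbn [pow].
    assert (Hk : 0 <= INR k) by apply pos_INR.
    assert (H3 : 12 * (csup ^ k * M) * taylor_error J <= 12 * (csup * csup ^ k * M) * taylor_error J).
    { apply Rmult_le_compat_r; [lra |]; apply Rmult_le_compat_l; [lra |].
      apply Rmult_le_compat_r; [exact HM0 |]; nra. }
    assert (INR k * (12 * (csup ^ k * M) * taylor_error J)
      <= INR k * (12 * (csup * csup ^ k * M) * taylor_error J)) by now apply Rmult_le_compat_l.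
    lra.
Qed.

(** * Expansion of the transfer operator to third order *)

Lemma pairing_ne (a b : Z) (x y : R) : a <> b -> pairing (a, x) (b, y) = 0.
Proof. intros H; unfold pairing; cbn [fst snd]; now destruct (Z.eq_dec a b). Qed.

Lemma pairing_eq (a b : Z) (x y : R) : a = b -> pairing (a, x) (b, y) = x * y.
Proof. intros H; unfold pairing; cbn [fst snd]; now destruct (Z.eq_dec a b). Qed.

Ltac pairing_tac :=
  repeat match goal with
  | |- context [pairing (?a, ?x) (?b, ?y)] =>
      first [ rewrite (pairing_ne a b x y) by lia | rewrite (pairing_eq a b x y) by lia ]
  end.

Lemma bil_mode_diag (l : nat) (p q : Z) (mu : Z -> R) : (0 < p < q)%Z ->
  bil mu (tterm (mode l p q) 1) (tterm (mode l p q) 1) =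
  (amp ^ l / 2) ^ 2 * (mu p + mu (- p)%Z + mu q + mu (- q)%Z + mu (p + q)%Z + mu (- (p + q))%Z).
Proof.
  intros Hpq.
  unfold bil, tterm, tpow, tscal, tmul, mode.
  cbn [flat_map map app fst snd lsum fold_right].
  pairing_tac.
  rewrite !Z.add_0_r; simpl INR; field.
Qed.

(** Every resonance between first and second order is a form of (p) + (q) = p + q; the condition
    [q <> 2 * p] rules out the accidental ones p + p = q and q - p = p. *)
Lemma bil_mode_cubic (l : nat) (p q : Z) (mu : Z -> R) : (0 < p < q)%Z -> q <> (2 * p)%Z ->
  bil mu (tterm (mode l p q) 1) (tterm (mode l p q) 2) =
  - (amp ^ l / 2) ^ 3 * (mu p + mu q - mu (p + q)%Z - mu (- p)%Z - mu (- q)%Z + mu (- (p + q))%Z).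
Proof.
  intros Hpq Hq.
  unfold bil, tterm, tpow, tscal, tmul, mode.
  cbn [flat_map map app fst snd lsum fold_right].
  pairing_tac.
  rewrite !Z.add_0_r; simpl INR; field.
Qed.

Lemma exp_monotone (x y : R) : x <= y -> exp x <= exp y.
Proof.
  intros [H | ->]; [left; now apply exp_increasing | right; reflexivity].
Qed.

Definition kappa : R := 2 * exp6 ^ 2.

Lemma kappa_ge2 : 2 <= kappa.
Proof. unfold kappa; pose proof exp6_ge1; simpl; nra. Qed.

(** The tail is split by degree into X, V and T. The pair X, X gives the second order, even in the
    frequency; the pair X, V, counted twice, gives the odd cubic flux; all other pairs carry at
    least four amplitudes. *)
Lemma transfer_expand (J l : nat) (p q : Z) (mu : Z -> R) (z : Z) (m : R) :
  admissible l (p, q) -> (0 < p < q)%Z -> q <> (2 * p)%Z ->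
  (forall a, Rabs (mu (z + a)%Z - mu z) <= m * tweight (rad l) a) ->
  Rabs (transfer J l (p, q) mu z - (mu z
    + (amp ^ l / 2) ^ 2 * (mu (z + p)%Z + mu (z - p)%Z + mu (z + q)%Z + mu (z - q)%Z
        + mu (z + (p + q))%Z + mu (z - (p + q))%Z - 6 * mu z)
    - 2 * (amp ^ l / 2) ^ 3 * (mu (z + p)%Z + mu (z + q)%Z - mu (z + (p + q))%Z
        - mu (z - p)%Z - mu (z - q)%Z + mu (z - (p + q))%Z)))
  <= m * (2 * kappa) * (amp ^ l) ^ 4.
Proof.
  intros Ha Hpq Hq Hm.
  rewrite transfer_eq.
  set (k := fun a => mu (z + a)%Z - mu z).
  change (approx_tail l p q J) with (tterm (mode l p q) 1 ++ (tterm (mode l p q) 2 ++ texp (mode l p q) 3 J)).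
  set (X := tterm (mode l p q) 1); set (V := tterm (mode l p q) 2); set (T := texp (mode l p q) 3 J).
  rewrite (bil_app_l k X), !(bil_app_r k _ X), (bil_sym k (V ++ T) X), (bil_app_r k X V T).
  assert (E1 : bil k X X = _) by (apply (bil_mode_diag l p q k Hpq)); rewrite E1; clear E1.
  assert (E2 : bil k X V = _) by (apply (bil_mode_cubic l p q k Hpq Hq)); rewrite E2; clear E2.
  pose proof (bil_bound (rad l) m k X T (rad_pos l) Hm) as B1.
  pose proof (bil_bound (rad l) m k (V ++ T) (V ++ T) (rad_pos l) Hm) as B2.
  assert (N1 : tnorm (rad l) X <= amp ^ l * exp6).
  { pose proof (tnorm_texp l p q 1 1 Ha) as H; cbn [texp] in H; rewrite app_nil_r, pow_1 in H; exact H. }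
  assert (N2 : tnorm (rad l) (V ++ T) <= (amp ^ l) ^ 2 * exp6) by exact (tnorm_texp l p q 2 (S J) Ha).
  assert (N3 : tnorm (rad l) T <= (amp ^ l) ^ 3 * exp6) by exact (tnorm_texp l p q 3 J Ha).
  pose proof (tnorm_nonneg (rad l) X (rad_pos l)) as P1.
  pose proof (tnorm_nonneg (rad l) (V ++ T) (rad_pos l)) as P2.
  pose proof (tnorm_nonneg (rad l) T (rad_pos l)) as P3.
  pose proof (tweight_bound_nonneg _ m _ (rad_pos l) Hm) as Hm0.
  assert (B1' : Rabs (bil k X T) <= m * exp6 ^ 2 * (amp ^ l) ^ 4).
  { apply Rle_trans with (1 := B1).
    replace (m * exp6 ^ 2 * (amp ^ l) ^ 4) with (m * (amp ^ l * exp6) * ((amp ^ l) ^ 3 * exp6)) by ring.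
    apply Rmult_le_compat; try assumption; [now apply Rmult_le_pos | now apply Rmult_le_compat_l]. }
  assert (B2' : Rabs (bil k (V ++ T) (V ++ T)) <= m * exp6 ^ 2 * (amp ^ l) ^ 4).
  { apply Rle_trans with (1 := B2).
    replace (m * exp6 ^ 2 * (amp ^ l) ^ 4) with (m * ((amp ^ l) ^ 2 * exp6) * ((amp ^ l) ^ 2 * exp6)) by ring.
    apply Rmult_le_compat; try assumption; [now apply Rmult_le_pos | now apply Rmult_le_compat_l]. }
  clear B1 B2 N1 N2 N3 P1 P2 P3.
  assert (Hpos : 0 <= m * exp6 ^ 2 * (amp ^ l) ^ 4).
  { apply Rle_trans with (2 := B1'), Rabs_pos. }
  assert (Ek : forall a, k a = mu (z + a)%Z - mu z) by reflexivity.
  clear Hm; clearbody k; rewrite !Ek, !Z.add_opp_r.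
  match goal with |- Rabs ?e <= _ => replace e with (2 * bil k X T + bil k (V ++ T) (V ++ T)) end.
  - apply Rabs_le_between in B1'; apply Rabs_le_between in B2'; unfold kappa; apply Rabs_le; lra.
  - rewrite (bil_app_r k (V ++ T) V T); ring.
Qed.

(** * Symmetry and linearity of cascades *)

Lemma tpow_neg (U : tpoly) (n : nat) :
  tpow (map (fun u => ((- fst u)%Z, snd u)) U) n = map (fun u => ((- fst u)%Z, snd u)) (tpow U n).
Proof.
  assert (Hm : forall A B, tmul (map (fun u => ((- fst u)%Z, snd u)) A)
      (map (fun u => ((- fst u)%Z, snd u)) B)
    = map (fun u => ((- fst u)%Z, snd u)) (tmul A B)).
  { intros A B; induction A as [| a A IH]; [reflexivity |].
    cbn [map tmul flat_map]; fold (tmul A B); rewrite map_app, <- IH.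
    unfold tmul at 1; f_equal.
    rewrite !map_map; apply map_ext; intros b; cbn [fst snd]; f_equal; lia. }
  induction n as [| n IH]; [reflexivity |].
  cbn [tpow]; rewrite IH; apply Hm.
Qed.

Lemma approx_neg (l : nat) (p q : Z) (J : nat) :
  approx l (- p) (- q) J = map (fun u => ((- fst u)%Z, snd u)) (approx l p q J).
Proof.
  assert (H : mode l (- p) (- q) = map (fun u => ((- fst u)%Z, snd u)) (mode l p q)).
  { unfold mode; cbn [map fst snd]; rewrite <- Z.opp_add_distr; reflexivity. }
  assert (Ht : forall n k, texp (mode l (- p) (- q)) k n
     = map (fun u => ((- fst u)%Z, snd u)) (texp (mode l p q) k n)); [| apply Ht].
  induction n as [| n IH]; intros k; [reflexivity |].
  cbn [texp]; rewrite map_app, IH; f_equal.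
  unfold tterm, tscal; rewrite H, tpow_neg, !map_map; reflexivity.
Qed.

Lemma bil_neg (mu : Z -> R) (U V : tpoly) :
  bil mu (map (fun u => ((- fst u)%Z, snd u)) U) (map (fun u => ((- fst u)%Z, snd u)) V)
    = bil (fun a => mu (- a)%Z) U V.
Proof.
  unfold bil; rewrite lsum_map; apply lsum_ext; intros u _.
  rewrite lsum_map; apply lsum_ext; intros v _; cbn [fst snd]; f_equal.
  unfold pairing; cbn [fst snd].
  destruct (Z.eq_dec (fst u) (fst v)); destruct (Z.eq_dec (- fst u) (- fst v)); try lia; reflexivity.
Qed.

Definition neg_pair (c : Z * Z) : Z * Z := ((- fst c)%Z, (- snd c)%Z).

Lemma transfer_neg (J l : nat) (c : Z * Z) (mu : Z -> R) (z : Z) :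
  transfer J l (neg_pair c) mu z = transfer J l c (fun n => mu (- n)%Z) (- z).
Proof.
  unfold transfer, neg_pair; cbn [fst snd]; rewrite approx_neg, !bil_neg, Z.opp_involutive.
  f_equal; apply bil_ext; intros a; f_equal; lia.
Qed.

Lemma transfer_ext (J l : nat) (c : Z * Z) (mu mu' : Z -> R) (z : Z) :
  (forall n, mu n = mu' n) -> transfer J l c mu z = transfer J l c mu' z.
Proof.
  intros H; unfold transfer; rewrite H; f_equal; apply bil_ext; intros; apply H.
Qed.

Lemma transfer_plus (J l : nat) (c : Z * Z) (mu mu' : Z -> R) (z : Z) :
  transfer J l c (fun n => mu n + mu' n) z = transfer J l c mu z + transfer J l c mu' z.
Proof.
  unfold transfer; rewrite (bil_plus (fun a => mu (z + a)%Z) (fun a => mu' (z + a)%Z)); ring.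
Qed.

Lemma transfer_scal (J l : nat) (c : Z * Z) (k : R) (mu : Z -> R) (z : Z) :
  transfer J l c (fun n => k * mu n) z = k * transfer J l c mu z.
Proof.
  unfold transfer; rewrite (bil_scal_l k (fun a => mu (z + a)%Z)); ring.
Qed.

Lemma transfer_const (J l : nat) (c : Z * Z) (k : R) (z : Z) :
  transfer J l c (fun _ => k) z = k.
Proof.
  unfold transfer.
  rewrite (bil_ext (fun _ => k) (fun _ => k * 1)) by (intros; ring).
  rewrite (bil_scal_l k (fun _ => 1)); ring.
Qed.

Lemma transfer_avg_neg (J l : nat) (F : list (Z * Z)) (mu : Z -> R) (z : Z) :
  transfer_avg J l (map neg_pair F) mu z = transfer_avg J l F (fun n => mu (- n)%Z) (- z).
Proof.
  unfold transfer_avg; rewrite lsum_map, length_map; f_equal.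
  apply lsum_ext; intros; apply transfer_neg.
Qed.

Lemma transfer_avg_ext (J l : nat) (F : list (Z * Z)) (mu mu' : Z -> R) (z : Z) :
  (forall n, mu n = mu' n) -> transfer_avg J l F mu z = transfer_avg J l F mu' z.
Proof.
  intros H; unfold transfer_avg; f_equal; apply lsum_ext; intros; now apply transfer_ext.
Qed.

(** Reversing all frequencies reflects the multiplier. Tests on reversed families therefore control
    the reflected multiplier, and with it the odd part. *)
Lemma cascade_neg (J l : nat) (Fs : families) (mu : Z -> R) (z : Z) :
  cascade J l (map (map neg_pair) Fs) mu z = cascade J l Fs (fun n => mu (- n)%Z) (- z).
Proof.
  revert l z; induction Fs as [| F Fs IH]; intros l z.
  - cbn [map cascade]; now rewrite Z.opp_involutive.
  - cbn [map cascade]; rewrite transfer_avg_neg; apply transfer_avg_ext; intros n.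
    now rewrite IH, Z.opp_involutive.
Qed.

Lemma cascade_plus (J l : nat) (Fs : families) (mu mu' : Z -> R) (z : Z) :
  cascade J l Fs (fun n => mu n + mu' n) z = cascade J l Fs mu z + cascade J l Fs mu' z.
Proof.
  revert l z; induction Fs as [| F Fs IH]; intros l z; [reflexivity |].
  cbn [cascade]; rewrite (transfer_avg_ext _ _ _ _ _ z (fun n => IH (S l) n)).
  unfold transfer_avg, Rdiv; rewrite <- Rmult_plus_distr_r, <- lsum_plus; f_equal.
  apply lsum_ext; intros; apply transfer_plus.
Qed.

Lemma cascade_scal (J l : nat) (Fs : families) (k : R) (mu : Z -> R) (z : Z) :
  cascade J l Fs (fun n => k * mu n) z = k * cascade J l Fs mu z.
Proof.
  revert l z; induction Fs as [| F Fs IH]; intros l z; [reflexivity |].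
  cbn [cascade]; rewrite (transfer_avg_ext _ _ _ _ _ z (fun n => IH (S l) n)).
  unfold transfer_avg, Rdiv; rewrite <- Rmult_assoc, <- lsum_scal; f_equal.
  apply lsum_ext; intros; apply transfer_scal.
Qed.

Lemma lsum_avg_const {A : Type} (k : R) (l : list A) : l <> [] ->
  lsum (fun _ => k) l / INR (length l) = k.
Proof.
  intros Hl; rewrite lsum_const; field.
  apply not_0_INR; destruct l; [easy | simpl; lia].
Qed.

(** Exactness comes from the mass correction in [transfer]; it lets the value at 0 of an increment
    leave a cascade without error. *)
Lemma cascade_const (J l : nat) (Fs : families) (k : R) (z : Z) :
  admissible_families l Fs -> cascade J l Fs (fun _ => k) z = k.
Proof.
  revert l z; induction Fs as [| F Fs IH]; intros l z HF; [reflexivity |].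
  destruct HF as [HF0 [_ HF2]]; cbn [cascade].
  rewrite (transfer_avg_ext _ _ _ _ (fun _ => k) z (fun n => IH (S l) n HF2)).
  unfold transfer_avg.
  rewrite (lsum_ext _ (fun _ => k)) by (intros; apply transfer_const).
  now apply lsum_avg_const.
Qed.

Lemma cascade_ext (J l : nat) (Fs : families) (mu mu' : Z -> R) (z : Z) :
  (forall n, mu n = mu' n) -> cascade J l Fs mu z = cascade J l Fs mu' z.
Proof.
  revert l z; induction Fs as [| F Fs IH]; intros l z H; [apply H |].
  cbn [cascade]; apply transfer_avg_ext; intros; now apply IH.
Qed.

(** The telescoping refines at the fine end, where the new family meets the bare multiplier. *)
Lemma cascade_last (J l : nat) (Fs : families) (F : list (Z * Z)) (mu : Z -> R) :
  cascade J l (Fs ++ [F]) mu = cascade J l Fs (transfer_avg J (l + length Fs) F mu).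
Proof.
  revert l; induction Fs as [| F' Fs IH]; intros l.
  - cbn [app cascade length]; now rewrite Nat.add_0_r.
  - cbn [app cascade length]; rewrite IH, Nat.add_succ_comm; reflexivity.
Qed.

Lemma admissible_families_last (l : nat) (Fs : families) (F : list (Z * Z)) :
  admissible_families l Fs -> F <> [] ->
  (forall c, In c F -> admissible (l + length Fs) c) -> admissible_families l (Fs ++ [F]).
Proof.
  revert l; induction Fs as [| F' Fs IH]; intros l HFs HF0 HF.
  - rewrite Nat.add_0_r in HF; now repeat split; try apply HF.
  - destruct HFs as [H1 [H2 H3]]; split; [exact H1 |]; split; [exact H2 |].
    apply IH; [exact H3 | exact HF0 |].
    cbn [length] in HF; now rewrite Nat.add_succ_comm.
Qed.

Lemma admissible_families_neg (l : nat) (Fs : families) :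
  admissible_families l Fs -> admissible_families l (map (map neg_pair) Fs).
Proof.
  revert l; induction Fs as [| F Fs IH]; intros l; [easy |].
  intros [H1 [H2 H3]]; cbn [map]; split; [| split; [| now apply IH]].
  - intros H; apply H1; now destruct F.
  - intros c Hc; apply in_map_iff in Hc; destruct Hc as [c' [<- Hc']].
    destruct (H2 c' Hc'); unfold admissible, neg_pair; cbn [fst snd].
    now rewrite !opp_IZR, !Rabs_Ropp.
Qed.

(* The value 0 at the origin matters: a cascade is evaluated at 0, and only the
   blocks that move it away from 0 are to be paid for. *)
Definition gauge (L0 : R) (z : Z) : R := if Z.eq_dec z 0 then 0 else Rabs (IZR z) + L0.

Lemma gauge_le (L0 : R) (z : Z) : 0 <= L0 ->
  Rabs (IZR z) <= gauge L0 z <= Rabs (IZR z) + L0.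
Proof.
  intros H; unfold gauge; pose proof (Rabs_pos (IZR z)).
  destruct (Z.eq_dec z 0) as [-> | _]; [rewrite Rabs_R0; lra | lra].
Qed.

Lemma gauge_nonneg (L0 : R) (z : Z) : 0 <= L0 -> 0 <= gauge L0 z.
Proof. intros H; pose proof (gauge_le L0 z H); pose proof (Rabs_pos (IZR z)); lra. Qed.

Lemma gauge_plus (L0 : R) (a b : Z) : 0 <= L0 ->
  gauge L0 (a + b) <= gauge L0 a + (Rabs (IZR b) + L0).
Proof.
  intros H; pose proof (gauge_le L0 (a + b) H); pose proof (gauge_le L0 a H).
  rewrite plus_IZR in *; pose proof (Rabs_triang (IZR a) (IZR b)).
  pose proof (Rabs_pos (IZR b)).
  unfold gauge in *.
  destruct (Z.eq_dec (a + b) 0); destruct (Z.eq_dec a 0) as [-> | ?]; rewrite ?plus_IZR in *; try lra.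
Qed.

(** * Linear growth through a cascade *)

Lemma rad_weight (l : nat) (L0 : R) (a : Z) : L0 <= 2 ^ l ->
  Rabs (IZR a) + L0 <= rad l * tweight (rad l) a.
Proof.
  intros H; pose proof (pow_two_pos l); pose proof (rad_pos l).
  unfold tweight; rewrite Rmult_plus_distr_l.
  replace (rad l * (Rabs (IZR a) / rad l)) with (Rabs (IZR a)) by (field; lra).
  unfold rad; lra.
Qed.

Lemma gauge_increment (l : nat) (L0 A1 A0 : R) (mu : Z -> R) (z a : Z) :
  0 <= L0 <= 2 ^ l -> 0 <= A1 -> 0 <= A0 -> (forall n, Rabs (mu n) <= A1 * gauge L0 n + A0) ->
  Rabs (mu (z + a)%Z - mu z) <= (A1 * (2 * gauge L0 z + rad l) + 2 * A0) * tweight (rad l) a.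
Proof.
  intros [HL HL'] H1 H0 Hmu.
  pose proof (Hmu (z + a)%Z) as Ha; pose proof (Hmu z) as Hz.
  pose proof (gauge_plus L0 z a HL) as Hg; pose proof (rad_weight l L0 a HL') as Hr.
  pose proof (tweight_ge1 (rad l) a (rad_pos l)) as Hw; pose proof (gauge_nonneg L0 z HL) as Hgz.
  assert (Rabs (mu (z + a)%Z - mu z) <= A1 * (2 * gauge L0 z + rad l * tweight (rad l) a) + 2 * A0).
  { apply Rabs_le_between in Ha; apply Rabs_le_between in Hz; apply Rabs_le.
    assert (A1 * gauge L0 (z + a) <= A1 * (gauge L0 z + rad l * tweight (rad l) a))
      by (apply Rmult_le_compat_l; lra).
    lra. }
  apply Rle_trans with (1 := H).
  assert (P1 : 0 <= A1 * gauge L0 z) by now apply Rmult_le_pos.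
  assert (0 <= (2 * (A1 * gauge L0 z) + 2 * A0) * (tweight (rad l) a - 1))
    by (apply Rmult_le_pos; lra).
  lra.
Qed.

(** The additive loss stems from amp^(2l) rad l = 16 / amp^l, which grows with the level. A cascade
    is thus affordable only for multipliers whose slope [A1] is already small. *)
Lemma transfer_avg_growth (J l : nat) (F : list (Z * Z)) (L0 A1 A0 : R) (mu : Z -> R) (z : Z) :
  F <> [] -> (forall c, In c F -> admissible l c) ->
  0 <= L0 <= 2 ^ l -> 0 <= A1 -> 0 <= A0 -> (forall n, Rabs (mu n) <= A1 * gauge L0 n + A0) ->
  Rabs (transfer_avg J l F mu z) <=
    (1 + kappa * (amp ^ l) ^ 2) * (A1 * gauge L0 z + A0) + 16 * kappa * A1 / amp ^ l.
Proof.
  intros HF0 HF HL H1 H0 Hmu; apply lsum_avg_bound; [exact HF0 |]; intros [p q] Hc.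
  pose proof (transfer_diff_bound J l p q mu z _ (HF _ Hc)
    (fun a => gauge_increment l L0 A1 A0 mu z a HL H1 H0 Hmu)) as H.
  pose proof (Hmu z) as Hz; pose proof (amp_pow_pos l) as Hh; pose proof (amp_pow_cube l) as Hc3.
  assert (E : (amp ^ l) ^ 2 * rad l = 16 / amp ^ l).
  { unfold rad.
    replace (16 / amp ^ l) with (16 * (amp ^ l * amp ^ l * amp ^ l * 2 ^ l) / amp ^ l)
      by (rewrite Hc3; field; lra).
    field; lra. }
  assert (E2 : (A1 * (2 * gauge L0 z + rad l) + 2 * A0) * exp6 ^ 2 * (amp ^ l) ^ 2
    = kappa * (amp ^ l) ^ 2 * (A1 * gauge L0 z + A0) + kappa / 2 * A1 * ((amp ^ l) ^ 2 * rad l))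
    by (unfold kappa; field).
  rewrite E2, E in H.
  assert (Hp : 0 <= kappa * A1 * (16 / amp ^ l)).
  { pose proof kappa_ge2; apply Rmult_le_pos; [apply Rmult_le_pos; lra |].
    apply Rdiv_le_0_compat; lra. }
  replace (16 * kappa * A1 / amp ^ l) with (kappa * A1 * (16 / amp ^ l)) by (field; lra).
  apply Rabs_le_between in H; apply Rabs_le_between in Hz; apply Rabs_le; lra.
Qed.

(** The factors 1 + kappa amp^(2l) have a bounded product. The additive losses form a geometric sum
    dominated by the finest level; since 1 / amp - 1 >= 1/4, a loss 16 / amp^l is at most 64 times
    the next difference of inverse powers. *)
Lemma cascade_growth (J : nat) (Fs : families) (L0 A1 A0 : R) (mu : Z -> R) (l : nat) (z : Z) :
  admissible_families l Fs ->
  0 <= L0 <= 2 ^ l -> 0 <= A1 -> 0 <= A0 -> (forall n, Rabs (mu n) <= A1 * gauge L0 n + A0) ->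
  Rabs (cascade J l Fs mu z) <= exp (3 * kappa * (amp ^ l) ^ 2) *
    (A1 * gauge L0 z + A0 + 64 * kappa * A1 * (/ amp ^ (l + length Fs) - / amp ^ l)).
Proof.
  intros HF HL H1 H0 Hmu; revert l z HF HL.
  pose proof kappa_ge2 as HD; pose proof amp_bounds as Hb.
  induction Fs as [| F Fs IH]; intros l z HF HL.
  - cbn [cascade length]; rewrite Nat.add_0_r, Rminus_diag, Rmult_0_r, Rplus_0_r.
    assert (0 <= A1 * gauge L0 z + A0).
    { pose proof (Rmult_le_pos _ _ H1 (gauge_nonneg L0 z (proj1 HL))); lra. }
    assert (1 <= exp (3 * kappa * (amp ^ l) ^ 2)).
    { rewrite <- exp_0; apply exp_monotone.
      pose proof (pow2_ge_0 (amp ^ l)); nra. }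
    specialize (Hmu z); nra.
  - destruct HF as [HF0 [HF1 HF2]]; cbn [cascade length].
    assert (HL' : 0 <= L0 <= 2 ^ S l) by (pose proof (pow_two_pos l); simpl; lra).
    set (e := exp (3 * kappa * (amp ^ S l) ^ 2)).
    assert (He : 0 < e) by apply exp_pos.
    set (y := / amp ^ (S l + length Fs)).
    pose proof (amp_pow_pos l) as Hl; pose proof (amp_pow_pos (S l)) as Hl1.
    assert (Hy : / amp ^ S l <= y).
    { unfold y; apply Rinv_le_contravar; [apply amp_pow_pos |].
      rewrite pow_add; pose proof (amp_pow_le1 (length Fs)); nra. }
    pose proof (transfer_avg_growth J l F L0 (e * A1)
      (e * (A0 + 64 * kappa * A1 * (y - / amp ^ S l))) (cascade J (S l) Fs mu) z HF0 HF1 HL) as H.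
    assert (Hyp : 0 <= A0 + 64 * kappa * A1 * (y - / amp ^ S l)).
    { assert (0 <= 64 * kappa * A1 * (y - / amp ^ S l)) 
        by (apply Rmult_le_pos; [apply Rmult_le_pos; lra | lra]); lra. }
    assert (Hin : forall n, Rabs (cascade J (S l) Fs mu n)
      <= e * A1 * gauge L0 n + e * (A0 + 64 * kappa * A1 * (y - / amp ^ S l))).
    { intros n; apply Rle_trans with (1 := IH (S l) n HF2 HL'); fold e y; right; ring. }
    apply Rle_trans with (1 := H (Rmult_le_pos _ _ (Rlt_le _ _ He) H1)
      (Rmult_le_pos _ _ (Rlt_le _ _ He) Hyp) Hin); clear H Hin.
    replace (l + S (length Fs))%nat with (S l + length Fs)%nat by lia; fold y.
    (* The 3 in the exponent closes the induction because 1 + 3 amp^2 <= 1 + 48/25 <= 3. *)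
    assert (Hg : (1 + kappa * (amp ^ l) ^ 2) * e <= exp (3 * kappa * (amp ^ l) ^ 2)).
    { apply Rle_trans with (exp (kappa * (amp ^ l) ^ 2) * e).
      - apply Rmult_le_compat_r; [lra |]; apply Rlt_le.
        assert (0 < kappa * (amp ^ l) ^ 2) by (apply Rmult_lt_0_compat; [lra | now apply pow_lt]).
        now apply exp_ineq1; apply Rgt_not_eq.
      - unfold e; rewrite <- exp_plus; apply exp_monotone.
        cbn [pow]; assert (amp * amp <= 16 / 25) by nra.
        assert (0 <= kappa * (amp ^ l * amp ^ l)) by (apply Rmult_le_pos; nra).
        nra. }
    assert (Hinv : / amp ^ S l - / amp ^ l >= / 4 * / amp ^ l).
    { cbn [pow]; rewrite Rinv_mult.
      assert (5 / 4 <= / amp).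
      { apply Rmult_le_reg_l with amp; [lra |]; rewrite Rinv_r by lra; lra. }
      pose proof (Rinv_0_lt_compat _ Hl); nra. }
    assert (H1e : 1 <= 1 + kappa * (amp ^ l) ^ 2).
    { pose proof (pow2_ge_0 (amp ^ l)); nra. }
    set (S0 := A1 * gauge L0 z + A0 + 64 * kappa * A1 * (y - / amp ^ S l)).
    assert (HS0 : 0 <= S0).
    { unfold S0; pose proof (Rmult_le_pos _ _ H1 (gauge_nonneg L0 z (proj1 HL))); lra. }
    assert (Hq : 0 <= kappa * A1) by (apply Rmult_le_pos; lra).
    assert (Hil : 0 < / amp ^ l) by now apply Rinv_0_lt_compat.
    apply Rle_trans with ((1 + kappa * (amp ^ l) ^ 2) * e * (S0 + 16 * kappa * A1 * / amp ^ l)).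
    + replace (16 * kappa * (e * A1) / amp ^ l) with (1 * e * (16 * kappa * A1 * / amp ^ l)) by (field; lra).
      replace (e * A1 * gauge L0 z + e * (A0 + 64 * kappa * A1 * (y - / amp ^ S l))) with (e * S0)
        by (unfold S0; ring).
      replace ((1 + kappa * (amp ^ l) ^ 2) * e * (S0 + 16 * kappa * A1 * / amp ^ l)) with
        ((1 + kappa * (amp ^ l) ^ 2) * (e * S0)
          + (1 + kappa * (amp ^ l) ^ 2) * e * (16 * kappa * A1 * / amp ^ l)) by ring.
      apply Rplus_le_compat_l.
      apply Rmult_le_compat_r; [| apply Rmult_le_compat_r; lra].
      replace (16 * kappa * A1 * / amp ^ l) with (16 * (kappa * A1 * / amp ^ l)) by ring.
      pose proof (Rmult_le_pos _ _ Hq (Rlt_le _ _ Hil)); lra.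
    + apply Rmult_le_compat.
      * apply Rmult_le_pos; lra.
      * pose proof (Rmult_le_pos _ _ Hq (Rlt_le _ _ Hil)); lra.
      * exact Hg.
      * unfold S0.
        assert (64 * (kappa * A1) * (/ 4 * / amp ^ l) <= 64 * (kappa * A1) * (/ amp ^ S l - / amp ^ l))
          by (apply Rmult_le_compat_l; lra).
        lra.
Qed.

(** * Interval averages and families of pairs *)

Definition isum (mu : Z -> R) (a : Z) (N : nat) : R :=
  lsum (fun k => mu (a + Z.of_nat k)%Z) (seq 0 N).

Lemma isum_S (mu : Z -> R) (a : Z) (N : nat) :
  isum mu a (S N) = isum mu a N + mu (a + Z.of_nat N)%Z.
Proof. unfold isum; rewrite seq_S, lsum_app, lsum_cons; simpl; ring. Qed.

Lemma isum_step (mu : Z -> R) (a : Z) (N : nat) :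
  isum mu (a + 1) N = isum mu a N + mu (a + Z.of_nat N)%Z - mu a.
Proof.
  induction N as [| N IH].
  - unfold isum; simpl; rewrite Z.add_0_r; ring.
  - rewrite !isum_S, IH.
    replace (a + 1 + Z.of_nat N)%Z with (a + Z.of_nat (S N))%Z by lia; ring.
Qed.

Lemma isum_bound (mu : Z -> R) (a : Z) (N : nat) (Y : R) :
  (forall k, (k < N)%nat -> Rabs (mu (a + Z.of_nat k)%Z) <= Y) ->
  Rabs (isum mu a N) <= INR N * Y.
Proof.
  intros H; apply Rle_trans with (1 := lsum_Rabs _ _).
  rewrite <- (length_seq N 0) at 2; rewrite <- lsum_const; apply lsum_le.
  intros k Hk; apply in_seq in Hk; apply H; lia.
Qed.

Lemma Rabs_nat_shift (a : Z) (k N : nat) : (k < N)%nat ->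
  Rabs (IZR (a + Z.of_nat k)) <= Rabs (IZR a) + INR N.
Proof.
  intros Hk; rewrite plus_IZR, <- INR_IZR_INZ.
  apply Rle_trans with (1 := Rabs_triang _ _); apply lt_INR in Hk; pose proof (pos_INR k).
  rewrite (Rabs_pos_eq (INR k)); lra.
Qed.

(** Each unit shift drops one term and gains one, so the cost is twice the shift and does not see
    the length of the interval. *)
Lemma isum_shift_nat (mu : Z -> R) (a : Z) (N k : nat) (X Y : R) :
  (forall n, Rabs (IZR n) <= X -> Rabs (mu n) <= Y) ->
  Rabs (IZR a) + INR N + INR k <= X ->
  Rabs (isum mu (a + Z.of_nat k) N - isum mu a N) <= 2 * INR k * Y.
Proof.
  intros HY; induction k as [| k IH]; intros HX.
  - simpl; rewrite Z.add_0_r, Rminus_diag, Rabs_R0; lra.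
  - rewrite S_INR in *; pose proof (pos_INR k); pose proof (pos_INR N).
    replace (a + Z.of_nat (S k))%Z with (a + Z.of_nat k + 1)%Z by lia.
    rewrite isum_step.
    assert (H1 : Rabs (mu (a + Z.of_nat k)%Z) <= Y).
    { apply HY; rewrite plus_IZR, <- INR_IZR_INZ.
      apply Rle_trans with (1 := Rabs_triang _ _); rewrite (Rabs_pos_eq (INR k)); lra. }
    assert (H2 : Rabs (mu (a + Z.of_nat k + Z.of_nat N)%Z) <= Y).
    { apply HY; rewrite !plus_IZR, <- !INR_IZR_INZ.
      apply Rle_trans with (1 := Rabs_triang _ _); rewrite (Rabs_pos_eq (INR N)) by lra.
      pose proof (Rabs_triang (IZR a) (INR k)); rewrite (Rabs_pos_eq (INR k)) in *; lra. }
    assert (IH' := IH ltac:(lra)).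
    apply Rabs_le_between in H1; apply Rabs_le_between in H2; apply Rabs_le_between in IH'.
    apply Rabs_le; lra.
Qed.

(* Averaging over an interval of length comparable to its position makes a
   multiplier of linear growth Lipschitz. *)
Lemma isum_shift (mu : Z -> R) (L0 B Nr : R) (N : nat) (a z : Z) :
  0 <= L0 <= Nr -> 0 < Nr <= INR N -> Rabs (IZR a) + INR N <= 15 * Nr -> 0 <= B ->
  (forall n, Rabs (mu n) <= B * gauge L0 n) ->
  Rabs (isum mu (a + z) N - isum mu a N) <= INR N * (36 * B * Rabs (IZR z)).
Proof.
  intros HL HN Ha HB Hmu.
  assert (Hmu' : forall n, Rabs (mu n) <= B * (Rabs (IZR n) + L0)).
  { intros n; apply Rle_trans with (1 := Hmu n); apply Rmult_le_compat_l; [exact HB |].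
    apply gauge_le; lra. }
  assert (Hz0 : 0 <= Rabs (IZR z)) by apply Rabs_pos.
  destruct (Rle_dec Nr (Rabs (IZR z))) as [Hz | Hz].
  - assert (H1 : Rabs (isum mu (a + z) N) <= INR N * (B * (17 * Rabs (IZR z)))).
    { apply isum_bound; intros k Hk; apply Rle_trans with (1 := Hmu' _).
      apply Rmult_le_compat_l; [exact HB |].
      pose proof (Rabs_nat_shift (a + z) k N Hk); rewrite (plus_IZR a z) in *.
      pose proof (Rabs_triang (IZR a) (IZR z)); lra. }
    assert (H2 : Rabs (isum mu a N) <= INR N * (B * (17 * Rabs (IZR z)))).
    { apply isum_bound; intros k Hk; apply Rle_trans with (1 := Hmu' _).
      apply Rmult_le_compat_l; [exact HB |].
      pose proof (Rabs_nat_shift a k N Hk); lra. }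
    assert (0 <= INR N * (B * Rabs (IZR z))).
    { apply Rmult_le_pos; [lra |]; now apply Rmult_le_pos. }
    apply Rabs_le_between in H1; apply Rabs_le_between in H2; apply Rabs_le; lra.
  - assert (Hk : INR (Z.to_nat (Z.abs z)) = Rabs (IZR z)).
    { rewrite INR_IZR_INZ, Z2Nat.id, abs_IZR by lia; reflexivity. }
    assert (HY : forall n, Rabs (IZR n) <= 17 * Nr -> Rabs (mu n) <= 18 * (B * Nr)).
    { intros n Hn; apply Rle_trans with (1 := Hmu' n).
      assert (B * (Rabs (IZR n) + L0) <= B * (18 * Nr)) by (apply Rmult_le_compat_l; lra); lra. }
    apply Rle_trans with (2 * INR (Z.to_nat (Z.abs z)) * (18 * (B * Nr))).
    + destruct (Z_le_gt_dec 0 z) as [Hs | Hs].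
      * replace z with (Z.of_nat (Z.to_nat (Z.abs z))) at 1 by lia.
        apply (isum_shift_nat mu a N _ (17 * Nr)); [exact HY | rewrite Hk; lra].
      * rewrite Rabs_minus_sym.
        replace a with (a + z + Z.of_nat (Z.to_nat (Z.abs z)))%Z at 1 by lia.
        apply (isum_shift_nat mu (a + z) N _ (17 * Nr)); [exact HY |].
        rewrite Hk, plus_IZR; pose proof (Rabs_triang (IZR a) (IZR z)); lra.
    + rewrite Hk.
      assert (0 <= B * Rabs (IZR z)) by now apply Rmult_le_pos.
      replace (2 * Rabs (IZR z) * (18 * (B * Nr))) with (36 * (Nr * (B * Rabs (IZR z)))) by ring.
      replace (INR N * (36 * B * Rabs (IZR z))) with (36 * (INR N * (B * Rabs (IZR z)))) by ring.
      apply Rmult_le_compat_l; [lra |]; apply Rmult_le_compat_r; lra.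
Qed.

(* The sums [p + q] cover the interval of length [2 * N] from [2 * a + 1] exactly once. *)
Definition pair_family (a : Z) (N : nat) : list (Z * Z) :=
  flat_map (fun k => let p := (a + Z.of_nat k)%Z in [(p, (p + 1)%Z); (p, (p + 2)%Z)]) (seq 0 N).

Lemma length_family (a : Z) (N : nat) : length (pair_family a N) = (2 * N)%nat.
Proof.
  unfold pair_family; induction N as [| N IH]; [reflexivity |].
  rewrite seq_S, flat_map_app, length_app, IH; simpl; lia.
Qed.

Lemma in_family (a : Z) (N : nat) (c : Z * Z) : In c (pair_family a N) ->
  (a <= fst c < a + Z.of_nat N)%Z /\ (snd c = fst c + 1 \/ snd c = fst c + 2)%Z.
Proof.
  intros H; apply in_flat_map in H; destruct H as [k [Hk Hc]].
  apply in_seq in Hk; destruct Hc as [<- | [<- | []]]; cbn [fst snd]; lia.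
Qed.

Lemma lsum_family (F : Z * Z -> R) (a : Z) (N : nat) :
  lsum F (pair_family a N) = lsum (fun k => F ((a + Z.of_nat k)%Z, (a + Z.of_nat k + 1)%Z)
    + F ((a + Z.of_nat k)%Z, (a + Z.of_nat k + 2)%Z)) (seq 0 N).
Proof.
  unfold pair_family; induction N as [| N IH]; [reflexivity |].
  rewrite seq_S, flat_map_app, !lsum_app, IH; simpl; ring.
Qed.

Lemma lsum_family_fst (g : Z -> R) (a : Z) (N : nat) :
  lsum (fun c => g (fst c)) (pair_family a N) = 2 * isum g a N.
Proof.
  rewrite lsum_family; unfold isum; rewrite <- lsum_scal; apply lsum_ext; intros; simpl; ring.
Qed.

Lemma lsum_family_snd (g : Z -> R) (a : Z) (N : nat) :
  lsum (fun c => g (snd c)) (pair_family a N) = isum g (a + 1) N + isum g (a + 2) N.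
Proof.
  rewrite lsum_family; unfold isum; rewrite <- lsum_plus; apply lsum_ext; intros; cbn [snd].
  f_equal; f_equal; lia.
Qed.

Lemma lsum_family_sum (g : Z -> R) (a : Z) (N : nat) :
  lsum (fun c => g (fst c + snd c)%Z) (pair_family a N) = isum g (2 * a + 1) (2 * N).
Proof.
  rewrite lsum_family; cbn [fst snd].
  induction N as [| N IH]; [reflexivity |].
  rewrite seq_S, lsum_app, IH, lsum_cons.
  replace (2 * S N)%nat with (S (S (2 * N))) by lia; rewrite !isum_S.
  replace (2 * a + 1 + Z.of_nat (2 * N))%Z
    with (a + Z.of_nat (0 + N) + (a + Z.of_nat (0 + N) + 1))%Z by lia.
  replace (2 * a + 1 + Z.of_nat (S (2 * N)))%Z
    with (a + Z.of_nat (0 + N) + (a + Z.of_nat (0 + N) + 2))%Z by lia.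
  simpl lsum; ring.
Qed.

Lemma isum_translate (mu : Z -> R) (z a : Z) (N : nat) :
  isum (fun n => mu (z + n)%Z) a N = isum mu (a + z) N.
Proof. unfold isum; apply lsum_ext; intros; f_equal; lia. Qed.

Lemma isum_reflect (mu : Z -> R) (z a : Z) (N : nat) : (forall n, mu (- n)%Z = - mu n) ->
  isum (fun n => mu (z - n)%Z) a N = - isum mu (a + - z) N.
Proof.
  intros Hodd; unfold isum.
  replace (- lsum (fun k => mu (a + - z + Z.of_nat k)%Z) (seq 0 N))
    with (-1 * lsum (fun k => mu (a + - z + Z.of_nat k)%Z) (seq 0 N)) by ring.
  rewrite <- lsum_scal; apply lsum_ext; intros k _.
  replace (z - (a + Z.of_nat k))%Z with (- (a + - z + Z.of_nat k))%Z by lia.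
  rewrite Hodd; ring.
Qed.

Lemma INR_pow2_nat (l : nat) : INR (Nat.pow 2 l) = 2 ^ l.
Proof. rewrite pow_INR; reflexivity. Qed.

Lemma family_admissible (l : nat) (a : Z) (c : Z * Z) : 4 * 2 ^ l <= IZR a <= 6 * 2 ^ l ->
  In c (pair_family a (Nat.pow 2 l)) -> admissible l c.
Proof.
  intros Ha Hc; apply in_family in Hc; destruct Hc as [[H1 H2] H3].
  apply IZR_le in H1; assert (H4 := H2); apply Zlt_le_succ, IZR_le in H4.
  rewrite succ_IZR, plus_IZR, <- INR_IZR_INZ, INR_pow2_nat in H4.
  assert (Hl : 1 <= 2 ^ l) by (apply pow_R1_Rle; lra).
  unfold admissible; split.
  - rewrite Rabs_pos_eq; lra.
  - destruct H3 as [-> | ->]; rewrite plus_IZR, Rabs_pos_eq; lra.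
Qed.

Lemma family_generic (l : nat) (a : Z) (c : Z * Z) : 4 * 2 ^ l <= IZR a <= 6 * 2 ^ l ->
  In c (pair_family a (Nat.pow 2 l)) ->
  (0 < fst c < snd c)%Z /\ snd c <> (2 * fst c)%Z.
Proof.
  intros Ha Hc; apply in_family in Hc; destruct Hc as [[H1 H2] H3].
  assert (Hl : 1 <= 2 ^ l) by (apply pow_R1_Rle; lra).
  assert (4 <= a)%Z by (apply le_IZR; lra).
  lia.
Qed.

Lemma family_nonempty (l : nat) (a : Z) : pair_family a (Nat.pow 2 l) <> [].
Proof.
  intros H; apply (f_equal (@length _)) in H; rewrite length_family in H; simpl in H.
  assert (Nat.pow 2 l <> 0)%nat by (apply Nat.pow_nonzero; lia); lia.
Qed.

(** Fourth-order terms on a multiplier of size 2^l thus leave an error that is summable over the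
    levels. *)
Lemma rad_amp (l : nat) : rad l * (amp ^ l) ^ 4 = 16 * amp ^ l.
Proof.
  unfold rad.
  replace (16 * 2 ^ l * (amp ^ l) ^ 4) with (16 * (amp ^ l * amp ^ l * amp ^ l * 2 ^ l) * amp ^ l) by ring.
  rewrite amp_pow_cube; ring.
Qed.

(** * One averaged level *)

Section Level.

Variables (J l : nat) (a : Z) (L0 B : R) (mu : Z -> R).
Let N : nat := Nat.pow 2 l.
Let h : R := amp ^ l.
Hypothesis (HL : 0 <= L0 <= 2 ^ l) (HB : 0 <= B) (Ha : 4 * 2 ^ l <= IZR a <= 6 * 2 ^ l).
Hypothesis (Hodd : forall n, mu (- n)%Z = - mu n).
Hypothesis (Hmu : forall n, Rabs (mu n) <= B * gauge L0 n).

(** The averages of [mu] over z + p, z + q and z + p + q are [P z], [Q z] and [T z]. The last two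
    are divided by 2N because each p occurs with two values of q. *)
Let P (z : Z) : R := isum mu (a + z) N / INR N.
Let Q (z : Z) : R := (isum mu (a + 1 + z) N + isum mu (a + 2 + z) N) / (2 * INR N).
Let T (z : Z) : R := isum mu (2 * a + 1 + z) (2 * N) / (2 * INR N).

Lemma Hmu_zero : mu 0%Z = 0.
Proof. pose proof (Hodd 0) as H; change (- 0)%Z with 0%Z in H; lra. Qed.

(** The averaged second and third orders; oddness turns the averages over z - p into [- P (- z)],
    and likewise for q and p + q. *)
Let Phi (z : Z) : R :=
  (h / 2) ^ 2 * (P z - P (- z) + Q z - Q (- z) + T z - T (- z) - 6 * mu z)
  - 2 * (h / 2) ^ 3 * (P z + P (- z) + Q z + Q (- z) - T z - T (- z)).

Lemma level_expand (z : Z) :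
  Rabs (transfer_avg J l (pair_family a N) mu z - mu z - Phi z)
    <= B * (2 * gauge L0 z + rad l) * (2 * kappa) * h ^ 4.
Proof.
  assert (HN : 0 < INR N) by (unfold N; rewrite INR_pow2_nat; apply pow_two_pos).
  pose (e := fun c : Z * Z => mu z
    + (amp ^ l / 2) ^ 2 * (mu (z + fst c)%Z + mu (z - fst c)%Z + mu (z + snd c)%Z + mu (z - snd c)%Z
        + mu (z + (fst c + snd c))%Z + mu (z - (fst c + snd c))%Z - 6 * mu z)
    - 2 * (amp ^ l / 2) ^ 3 * (mu (z + fst c)%Z + mu (z + snd c)%Z - mu (z + (fst c + snd c))%Z
        - mu (z - fst c)%Z - mu (z - snd c)%Z + mu (z - (fst c + snd c))%Z)).
  assert (He : lsum e (pair_family a N) / INR (length (pair_family a N)) = mu z + Phi z).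
  { pose proof (lsum_family_fst (fun n => mu (z + n)%Z) a N) as S1.
    pose proof (lsum_family_fst (fun n => mu (z - n)%Z) a N) as S1'.
    pose proof (lsum_family_snd (fun n => mu (z + n)%Z) a N) as S2.
    pose proof (lsum_family_snd (fun n => mu (z - n)%Z) a N) as S2'.
    pose proof (lsum_family_sum (fun n => mu (z + n)%Z) a N) as S3.
    pose proof (lsum_family_sum (fun n => mu (z - n)%Z) a N) as S3'.
    rewrite isum_translate in S1, S3.
    rewrite isum_reflect in S1', S3' by exact Hodd.
    rewrite (isum_translate mu z (a + 1)), (isum_translate mu z (a + 2)) in S2.
    rewrite (isum_reflect mu z (a + 1)), (isum_reflect mu z (a + 2)) in S2' by exact Hodd.
    rewrite (lsum_ext e (fun c => mu z * (1 - 6 * (amp ^ l / 2) ^ 2) +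
      (((amp ^ l / 2) ^ 2 - 2 * (amp ^ l / 2) ^ 3) * mu (z + fst c)%Z
      + (((amp ^ l / 2) ^ 2 + 2 * (amp ^ l / 2) ^ 3) * mu (z - fst c)%Z
      + (((amp ^ l / 2) ^ 2 - 2 * (amp ^ l / 2) ^ 3) * mu (z + snd c)%Z
      + (((amp ^ l / 2) ^ 2 + 2 * (amp ^ l / 2) ^ 3) * mu (z - snd c)%Z
      + (((amp ^ l / 2) ^ 2 + 2 * (amp ^ l / 2) ^ 3) * mu (z + (fst c + snd c))%Z
      + ((amp ^ l / 2) ^ 2 - 2 * (amp ^ l / 2) ^ 3) * mu (z - (fst c + snd c))%Z)))))))
      by (intros c _; unfold e; ring).
    rewrite !lsum_plus, !lsum_scal, lsum_const, S1, S1', S2, S2', S3, S3', length_family, mult_INR.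
    unfold Phi, P, Q, T, h; simpl (INR 2); field; lra. }
  assert (HF : forall c, In c (pair_family a N) -> Rabs (transfer J l c mu z + - e c)
     <= B * (2 * gauge L0 z + rad l) * (2 * kappa) * h ^ 4).
  { intros [p q] Hc; destruct (family_generic l a _ Ha Hc) as [G1 G2].
    apply transfer_expand; try assumption; [now apply family_admissible with a |].
    intros b.
    pose proof (gauge_increment l L0 B 0 mu z b HL HB (Rle_refl 0)) as G.
    rewrite Rmult_0_r, Rplus_0_r in G; apply G.
    intros n; rewrite Rplus_0_r; apply Hmu. }
  pose proof (lsum_avg_bound _ _ _ (family_nonempty l a) HF) as K.
  rewrite lsum_plus in K.
  rewrite (lsum_ext (fun c => - e c) (fun c => - 1 * e c)) in K by (intros; ring).
  rewrite lsum_scal in K.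
  replace (transfer_avg J l (pair_family a N) mu z - mu z - Phi z) with
    ((lsum (fun c => transfer J l c mu z) (pair_family a N) + -1 * lsum e (pair_family a N))
      / INR (length (pair_family a N))); [exact K |].
  unfold transfer_avg, Rdiv; rewrite Rmult_plus_distr_r.
  unfold Rdiv in He; rewrite Rmult_assoc, He; ring.
Qed.

Lemma smear_avg (b : Z) (n : nat) (z : Z) :
  2 ^ l <= INR n -> Rabs (IZR b) + INR n <= 15 * 2 ^ l ->
  Rabs (isum mu (b + z) n / INR n - isum mu b n / INR n) <= 36 * B * Rabs (IZR z).
Proof.
  intros Hn Hb; pose proof (pow_two_pos l).
  pose proof (isum_shift mu L0 B (2 ^ l) n b z HL ltac:(lra) Hb HB Hmu) as H1.
  replace (isum mu (b + z) n / INR n - isum mu b n / INR n)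
    with ((isum mu (b + z) n - isum mu b n) * / INR n) by (unfold Rdiv; ring).
  assert (0 < / INR n) by (apply Rinv_0_lt_compat; lra).
  rewrite Rabs_mult, (Rabs_pos_eq (/ INR n)) by lra.
  apply Rle_trans with (INR n * (36 * B * Rabs (IZR z)) * / INR n).
  - apply Rmult_le_compat_r; lra.
  - right; field; lra.
Qed.

(** All bounds are Lipschitz bounds for interval averages. In the last one q exceeds p by 1 or 2,
    whence (36 + 72) / 2 = 54. *)
Lemma level_smear (z : Z) :
  Rabs (P z - P 0) <= 36 * B * Rabs (IZR z) /\ Rabs (Q z - Q 0) <= 36 * B * Rabs (IZR z) /\
  Rabs (T z - T 0) <= 36 * B * Rabs (IZR z) /\ Rabs (Q 0 - P 0) <= 54 * B.
Proof.
  assert (Hl : 1 <= 2 ^ l) by (apply pow_R1_Rle; lra).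
  assert (HN : INR N = 2 ^ l) by apply INR_pow2_nat.
  assert (H1 : forall i : Z, (0 <= i <= 2)%Z -> Rabs (IZR (a + i)) + INR N <= 15 * 2 ^ l).
  { intros i [Hi1 Hi2]; apply IZR_le in Hi1; apply IZR_le in Hi2.
    rewrite plus_IZR, Rabs_pos_eq by lra; lra. }
  assert (H2 : Rabs (IZR (2 * a + 1)) + INR (2 * N) <= 15 * 2 ^ l).
  { rewrite mult_INR, plus_IZR, mult_IZR; simpl (INR 2); rewrite Rabs_pos_eq by lra; lra. }
  assert (Ka : forall z, Rabs (isum mu (a + z) N / INR N - isum mu a N / INR N)
     <= 36 * B * Rabs (IZR z)).
  { intros y; apply smear_avg; [lra |].
    pose proof (H1 0%Z ltac:(lia)) as H; now rewrite Z.add_0_r in H. }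
  pose proof (Ka z) as K0.
  pose proof (smear_avg (a + 1) N z ltac:(lra) (H1 1%Z ltac:(lia))) as K1.
  pose proof (smear_avg (a + 2) N z ltac:(lra) (H1 2%Z ltac:(lia))) as K2.
  pose proof (smear_avg (2 * a + 1) (2 * N) z ltac:(rewrite mult_INR; simpl (INR 2); lra) H2) as K3.
  pose proof (Ka 1%Z) as K4; pose proof (Ka 2%Z) as K5.
  rewrite Rabs_R1 in K4; rewrite (Rabs_pos_eq 2) in K5 by lra.
  assert (EQ : forall y, Q y = (isum mu (a + 1 + y) N / INR N + isum mu (a + 2 + y) N / INR N) / 2).
  { intros y; unfold Q; field; lra. }
  assert (ET : forall y, T y = isum mu (2 * a + 1 + y) (2 * N) / INR (2 * N)).
  { intros y; unfold T; rewrite mult_INR; reflexivity. }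
  rewrite !EQ, !ET; unfold P; rewrite !Z.add_0_r.
  repeat split; try assumption; apply Rabs_le.
  - apply Rabs_le_between in K1; apply Rabs_le_between in K2; lra.
  - apply Rabs_le_between in K4; apply Rabs_le_between in K5; lra.
Qed.

(** This is what the coarser levels see of the present one. Without the average over p the second
    order would be of size B 2^l h^2; the Lipschitz bounds reduce it to B h^2 times the gauge of
    z. *)
Lemma level_increment (z : Z) :
  Rabs ((transfer_avg J l (pair_family a N) mu z - mu z) - (transfer_avg J l (pair_family a N) mu 0 - mu 0%Z))
    <= B * (110 + 4 * kappa) * h ^ 2 * gauge L0 z + 64 * kappa * B * h.
Proof.
  pose proof (level_expand z) as E1; pose proof (level_expand 0) as E2.
  destruct (level_smear z) as [S1 [S2 [S3 _]]]; destruct (level_smear (- z)) as [S1' [S2' [S3' _]]].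
  rewrite opp_IZR, Rabs_Ropp in S1', S2', S3'.
  pose proof (Hmu z) as Hz; pose proof (gauge_le L0 z (proj1 HL)) as [Hg _].
  pose proof (gauge_nonneg L0 z (proj1 HL)) as Hg0.
  pose proof (amp_pow_pos l) as Hh; fold h in Hh; pose proof (amp_pow_le1 l) as Hh1; fold h in Hh1.
  assert (G0 : gauge L0 0 = 0) by reflexivity; rewrite G0 in E2.
  pose proof (rad_amp l) as Erad; fold h in Erad.
  pose proof kappa_ge2 as HD.
  set (g := B * gauge L0 z) in *.
  assert (Hgp : 0 <= g) by now apply Rmult_le_pos.
  assert (HBz : B * Rabs (IZR z) <= g) by now apply Rmult_le_compat_l.
  assert (Hd : Rabs (Phi z - Phi 0) <= 110 * h ^ 2 * g).
  { unfold Phi; rewrite Hmu_zero; change (- 0)%Z with 0%Z.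
    match goal with |- Rabs ?x <= _ => replace x with
      ((h / 2) ^ 2 * ((P z - P 0) - (P (- z) - P 0) + (Q z - Q 0) - (Q (- z) - Q 0)
          + (T z - T 0) - (T (- z) - T 0) - 6 * mu z)
       - 2 * (h / 2) ^ 3 * ((P z - P 0) + (P (- z) - P 0) + (Q z - Q 0) + (Q (- z) - Q 0)
          - (T z - T 0) - (T (- z) - T 0))) by ring end.
    apply Rabs_le_between in S1; apply Rabs_le_between in S2; apply Rabs_le_between in S3.
    apply Rabs_le_between in S1'; apply Rabs_le_between in S2'; apply Rabs_le_between in S3'.
    apply Rabs_le_between in Hz.
    (* Six differences of at most 36 g each, and 6 g more from [6 * mu z]; as h <= 1, the total is
       at most (222 + 216) / 4 <= 110. *)
    match goal with |- Rabs (_ * ?x - _ * ?y) <= _ =>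
      assert (X1 : Rabs x <= 222 * g) by (apply Rabs_le; lra);
      assert (X2 : Rabs y <= 216 * g) by (apply Rabs_le; lra);
      generalize x y X1 X2 end.
    clear - Hh Hh1 Hgp; intros x y X1 X2.
    apply Rabs_le_between in X1; apply Rabs_le_between in X2.
    assert (Hp2 : 0 <= (h / 2) ^ 2) by apply pow2_ge_0.
    assert (Hp3 : 0 <= 2 * (h / 2) ^ 3 <= (h / 2) ^ 2).
    { replace (2 * (h / 2) ^ 3) with (h * (h / 2) ^ 2) by field; nra. }
    replace (110 * h ^ 2 * g) with ((h / 2) ^ 2 * (440 * g)) by field.
    apply Rabs_le; split; nra. }
  assert (E2' : B * (2 * 0 + rad l) * (2 * kappa) * h ^ 4 = 32 * kappa * B * h).
  { replace (B * (2 * 0 + rad l) * (2 * kappa) * h ^ 4) with (2 * B * kappa * (rad l * h ^ 4)) by ring.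
    rewrite Erad; ring. }
  assert (E1' : B * (2 * gauge L0 z + rad l) * (2 * kappa) * h ^ 4
     <= 4 * kappa * h ^ 2 * g + 32 * kappa * B * h).
  { replace (B * (2 * gauge L0 z + rad l) * (2 * kappa) * h ^ 4)
      with (4 * kappa * h ^ 4 * g + 2 * B * kappa * (rad l * h ^ 4)) by (unfold g; ring).
    rewrite Erad.
    assert (h ^ 4 <= h ^ 2).
    { assert (Hh2 : h ^ 2 <= 1) by (simpl; nra).
      replace (h ^ 4) with (h ^ 2 * h ^ 2) by ring; pose proof (pow2_ge_0 h); nra. }
    assert (4 * kappa * g * h ^ 4 <= 4 * kappa * g * h ^ 2).
    { apply Rmult_le_compat_l; [| assumption]; apply Rmult_le_pos; lra. }
    lra. }
  rewrite E2' in E2.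
  replace (B * (110 + 4 * kappa) * h ^ 2 * gauge L0 z) with (110 * h ^ 2 * g + 4 * kappa * h ^ 2 * g)
    by (unfold g; ring).
  apply Rabs_le_between in E1; apply Rabs_le_between in E2; apply Rabs_le_between in Hd.
  apply Rabs_le; lra.
Qed.

(** At 0 the second order cancels by oddness, and h^3 = 2^(-l) turns the cubic flux into a
    difference of consecutive terms average / 2^level. The error consists of Q - P, contributing 54
    / 2 = 27, and of the fourth order. *)
Lemma level_main :
  Rabs (transfer_avg J l (pair_family a N) mu 0 - mu 0%Z
    + (isum mu a N / INR N / 2 ^ l - isum mu (2 * a + 1) (2 * N) / INR (2 * N) / 2 ^ S l))
  <= (27 + 32 * kappa) * B * h.
Proof.
  pose proof (level_expand 0) as E2.
  destruct (level_smear 0) as [_ [_ [_ S4]]].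
  pose proof (amp_pow_pos l) as Hh; fold h in Hh; pose proof (amp_pow_le1 l) as Hh1; fold h in Hh1.
  assert (G0 : gauge L0 0 = 0) by reflexivity; rewrite G0 in E2.
  pose proof (amp_pow_cube l) as Hc; fold h in Hc; pose proof (pow_two_pos l) as Hl.
  pose proof (rad_amp l) as Erad; fold h in Erad.
  assert (E2' : B * (2 * 0 + rad l) * (2 * kappa) * h ^ 4 = 32 * kappa * B * h).
  { replace (B * (2 * 0 + rad l) * (2 * kappa) * h ^ 4) with (2 * B * kappa * (rad l * h ^ 4)) by ring.
    rewrite Erad; ring. }
  rewrite E2' in E2.
  assert (EP : isum mu a N / INR N = P 0) by (unfold P; now rewrite Z.add_0_r).
  assert (ET : isum mu (2 * a + 1) (2 * N) / INR (2 * N) = T 0)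
    by (unfold T; rewrite Z.add_0_r, mult_INR; reflexivity).
  rewrite EP, ET.
  assert (Ei : / 2 ^ l = h * h * h) by (apply Rmult_eq_reg_r with (2 ^ l); [rewrite Rinv_l |]; lra).
  assert (EPhi : Phi 0 = - (h ^ 3 / 2) * (2 * P 0 - T 0 + (Q 0 - P 0))).
  { unfold Phi; rewrite Hmu_zero; change (- 0)%Z with 0%Z; field. }
  rewrite EPhi in E2; unfold Rdiv at 1 2; cbn [pow]; rewrite Rinv_mult, Ei.
  replace (P 0 * (h * h * h) - T 0 * (/ 2 * (h * h * h)))
    with ((h ^ 3 / 2) * (2 * P 0 - T 0)) by field.
  assert (Hq : Rabs (h ^ 3 / 2 * (Q 0 - P 0)) <= 27 * B * h).
  { rewrite Rabs_mult, Rabs_pos_eq.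
    - replace (27 * B * h) with (h / 2 * (54 * B)) by field.
      apply Rmult_le_compat; [| apply Rabs_pos | | exact S4].
      + apply Rdiv_le_0_compat; [left; now apply pow_lt | lra].
      + assert (h ^ 3 <= h); [| lra].
        replace (h ^ 3) with (h * h ^ 2) by ring.
        assert (h ^ 2 <= 1) by (simpl; nra); nra.
    - apply Rdiv_le_0_compat; [left; now apply pow_lt | lra]. }
  apply Rabs_le_between in Hq; apply Rabs_le_between in E2; apply Rabs_le; lra.
Qed.

End Level.

(** * The telescoping cascade *)

Fixpoint doubled (a : Z) (k : nat) : Z :=
  match k with O => a | S m => (2 * doubled a m + 1)%Z end.

Fixpoint cascade_families (l : nat) (a : Z) (K : nat) : families :=
  match K with
  | O => []
  | S m => cascade_families l a m ++ [pair_family (doubled a m) (Nat.pow 2 (l + m))]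
  end.

Lemma length_cascade_families (l : nat) (a : Z) (K : nat) : length (cascade_families l a K) = K.
Proof. induction K as [| K IH]; [reflexivity |]. cbn; rewrite length_app, IH; simpl; lia. Qed.

(** Since [doubled a k] is 2^k (a + 1) - 1, the offsets add up to less than one unit of the scale;
    this is why 5 relaxes to 6. *)
Lemma doubled_bounds (l : nat) (a : Z) (k : nat) : 4 * 2 ^ l <= IZR a <= 5 * 2 ^ l ->
  4 * 2 ^ (l + k) <= IZR (doubled a k) <= 6 * 2 ^ (l + k).
Proof.
  intros Ha.
  assert (Hl : 1 <= 2 ^ l) by (apply pow_R1_Rle; lra).
  assert (H : 4 * (2 ^ l * 2 ^ k) <= IZR (doubled a k) <= 5 * (2 ^ l * 2 ^ k) + 2 ^ k - 1).
  { induction k as [| k IH]; [simpl; lra |].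
    cbn [doubled]; rewrite plus_IZR, mult_IZR; cbn [pow]; lra. }
  rewrite pow_add; pose proof (pow_two_pos k); nra.
Qed.

Lemma cascade_families_admissible (l : nat) (a : Z) (K : nat) : 4 * 2 ^ l <= IZR a <= 5 * 2 ^ l ->
  admissible_families l (cascade_families l a K).
Proof.
  intros Ha; induction K as [| K IH]; [exact I |].
  cbn [cascade_families]; apply admissible_families_last; [exact IH | |].
  - apply family_nonempty.
  - rewrite length_cascade_families; intros c Hc.
    apply (family_admissible (l + K) (doubled a K)); [now apply doubled_bounds | exact Hc].
Qed.

(** [cstep] prices the passage of one level through the coarser ones and [ctel] adds the error of
    the flux identity. [clev] serves two interval averages with 5 [ctel] each and one single flux
    with 2 times 32 [kappa]. *)
Definition cstep : R := exp (3 * kappa) * (64 * kappa * (111 + 4 * kappa)).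
Definition ctel : R := cstep + 27 + 32 * kappa.
Definition clev : R := 10 * ctel + 64 * kappa.

Lemma cstep_pos : 0 < cstep.
Proof.
  pose proof kappa_ge2; unfold cstep; apply Rmult_lt_0_compat; [apply exp_pos |].
  apply Rmult_lt_0_compat; lra.
Qed.

Lemma ctel_pos : 0 < ctel.
Proof. pose proof cstep_pos; pose proof kappa_ge2; unfold ctel; lra. Qed.

Lemma clev_pos : 0 < clev.
Proof. pose proof ctel_pos; pose proof kappa_ge2; unfold clev; lra. Qed.

Definition iavg (mu : Z -> R) (a : Z) (l : nat) : R :=
  isum mu a (Nat.pow 2 l) / INR (Nat.pow 2 l).

(** The coarser levels act on the increment made by the new family. Its value at 0 passes unchanged;
    the remainder has slope of order B h^2 and is amplified by a multiple of 1 / h, which leaves B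
    h. *)
Lemma cascade_step (J l : nat) (Fs : families) (F : list (Z * Z)) (L0 B : R)
  (mu : Z -> R) :
  admissible_families l Fs -> 0 <= L0 <= 2 ^ l -> 0 <= B ->
  (forall z, Rabs ((transfer_avg J (l + length Fs) F mu z - mu z)
       - (transfer_avg J (l + length Fs) F mu 0 - mu 0%Z))
    <= B * (110 + 4 * kappa) * (amp ^ (l + length Fs)) ^ 2 * gauge L0 z
       + 64 * kappa * B * amp ^ (l + length Fs)) ->
  Rabs (cascade J l (Fs ++ [F]) mu 0 - cascade J l Fs mu 0
     - (transfer_avg J (l + length Fs) F mu 0 - mu 0%Z)) <= cstep * B * amp ^ (l + length Fs).
Proof.
  intros HF HL HB Hz.
  set (h := amp ^ (l + length Fs)) in *; set (t := transfer_avg J (l + length Fs) F mu) in *.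
  set (t0 := t 0%Z - mu 0%Z) in *.
  set (zeta := fun n => (t n - mu n) - t0) in Hz.
  pose proof kappa_ge2 as HD.
  assert (Hh : 0 < h) by apply amp_pow_pos; assert (Hh1 : h <= 1) by apply amp_pow_le1.
  assert (E : cascade J l (Fs ++ [F]) mu 0 = cascade J l Fs mu 0 + (t0 + cascade J l Fs zeta 0)).
  { rewrite cascade_last; fold t.
    rewrite (cascade_ext J l Fs t (fun n => mu n + (t0 + zeta n)))
      by (intros; unfold zeta; ring).
    rewrite (cascade_plus J l Fs mu (fun n => t0 + zeta n)),
      (cascade_plus J l Fs (fun _ => t0) zeta), cascade_const by exact HF; reflexivity. }
  rewrite E.
  replace (cascade J l Fs mu 0 + (t0 + cascade J l Fs zeta 0) - cascade J l Fs mu 0 - t0)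
    with (cascade J l Fs zeta 0) by ring.
  assert (HA1 : 0 <= B * (110 + 4 * kappa) * h ^ 2).
  { apply Rmult_le_pos; [apply Rmult_le_pos; lra | apply pow2_ge_0]. }
  assert (HA0 : 0 <= 64 * kappa * B * h).
  { apply Rmult_le_pos; [apply Rmult_le_pos; lra | lra]. }
  apply Rle_trans with (1 := cascade_growth J Fs L0 _ _ zeta l 0 HF HL HA1 HA0 Hz).
  assert (G0 : gauge L0 0 = 0) by reflexivity; rewrite G0; fold h.
  replace (cstep * B * h) with (exp (3 * kappa) * (64 * kappa * (111 + 4 * kappa) * B * h))
    by (unfold cstep; ring).
  apply Rmult_le_compat.
  - left; apply exp_pos.
  - rewrite Rmult_0_r, Rplus_0_l.
    assert (/ amp ^ l <= / h).
    { apply Rinv_le_contravar; [exact Hh |]; unfold h; rewrite pow_add.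
      pose proof (amp_pow_le1 (length Fs)); pose proof (amp_pow_pos l); nra. }
    apply Rplus_le_le_0_compat; [lra |].
    apply Rmult_le_pos; [apply Rmult_le_pos; lra | lra].
  - apply exp_monotone.
    assert ((amp ^ l) ^ 2 <= 1).
    { pose proof (amp_pow_pos l); pose proof (amp_pow_le1 l); simpl; nra. }
    assert (3 * kappa * (amp ^ l) ^ 2 <= 3 * kappa * 1) by (apply Rmult_le_compat_l; lra).
    lra.
  - assert (Hi : / h - / amp ^ l <= / h).
    { pose proof (Rinv_0_lt_compat _ (amp_pow_pos l)); lra. }
    assert (H1 : 64 * kappa * (B * (110 + 4 * kappa) * h ^ 2) * (/ h - / amp ^ l)
       <= 64 * kappa * (B * (110 + 4 * kappa) * h ^ 2) * / h).
    { apply Rmult_le_compat_l; [| exact Hi]; apply Rmult_le_pos; lra. }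
    replace (64 * kappa * (B * (110 + 4 * kappa) * h ^ 2) * / h)
      with (64 * kappa * (110 + 4 * kappa) * (B * h)) in H1 by (field; lra).
    rewrite !Rmult_0_r, Rplus_0_l; lra.
Qed.

Lemma cascade_telescope (J l : nat) (a : Z) (L0 B : R) (mu : Z -> R) (K : nat) :
  0 <= L0 <= 2 ^ l -> 0 <= B -> 4 * 2 ^ l <= IZR a <= 5 * 2 ^ l ->
  (forall n, mu (- n)%Z = - mu n) -> (forall n, Rabs (mu n) <= B * gauge L0 n) ->
  Rabs (cascade J l (cascade_families l a K) mu 0
      + (iavg mu a l / 2 ^ l - iavg mu (doubled a K) (l + K) / 2 ^ (l + K)))
    <= 5 * ctel * B * (amp ^ l - amp ^ (l + K)).
Proof.
  intros HL HB Ha Hodd Hmu; pose proof amp_bounds as Hb.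
  induction K as [| K IH].
  - cbn [cascade_families cascade doubled]; rewrite Nat.add_0_r, !Rminus_diag, !Rmult_0_r.
    pose proof (Hmu 0%Z) as H0; replace (gauge L0 0) with 0 in H0 by reflexivity.
    rewrite Rmult_0_r in H0; now rewrite Rplus_0_r.
  - cbn [cascade_families].
    pose proof (cascade_families_admissible l a K Ha) as HF.
    pose proof (doubled_bounds l a K Ha) as HaK.
    assert (HLK : 0 <= L0 <= 2 ^ (l + K)).
    { rewrite pow_add; pose proof (pow_R1_Rle 2 K ltac:(lra)); pose proof (pow_two_pos l); nra. }
    pose proof (cascade_step J l (cascade_families l a K)
      (pair_family (doubled a K) (Nat.pow 2 (l + K))) L0 B mu HF HL HB) as S1.
    rewrite length_cascade_families in S1.
    specialize (S1 (level_increment J (l + K) (doubled a K) L0 B mu HLK HB HaK Hodd Hmu)).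
    pose proof (level_main J (l + K) (doubled a K) L0 B mu HLK HB HaK Hodd Hmu) as S2.
    rewrite Nat.add_succ_r; cbn [doubled].
    change (2 * Nat.pow 2 (l + K))%nat with (Nat.pow 2 (S (l + K))) in S2.
    fold (iavg mu (doubled a K) (l + K)) in S2.
    fold (iavg mu (2 * doubled a K + 1) (S (l + K))) in S2.
    set (h := amp ^ (l + K)) in *.
    assert (Hh : 0 < h) by apply amp_pow_pos.
    (* From amp < 4/5 follows 5 (1 - amp) >= 1, so the level errors are absorbed in differences of
       powers. *)
    assert (Hstep : ctel * B * h <= 5 * ctel * B * (h - amp ^ S (l + K))).
    { cbn [pow]; fold h.
      replace (5 * ctel * B * (h - amp * h)) with (ctel * B * h * (5 * (1 - amp))) by ring.
      assert (0 <= ctel * B * h).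
      { pose proof ctel_pos; apply Rmult_le_pos; [apply Rmult_le_pos |]; lra. }
      nra. }
    assert (HC : ctel * B * h = cstep * B * h + (27 + 32 * kappa) * B * h) by (unfold ctel; ring).
    apply Rabs_le_between in IH; apply Rabs_le_between in S1; apply Rabs_le_between in S2.
    apply Rabs_le; lra.
Qed.

(** At 0 and for odd [mu] the expansion is -h^3 / 2 times the flux up to fourth order; the factor 2
    * 2^l inverts h^3 / 2. *)
Lemma transfer_single (J l : nat) (p q : Z) (L0 B : R) (mu : Z -> R) :
  admissible l (p, q) -> (0 < p < q)%Z -> q <> (2 * p)%Z ->
  0 <= L0 <= 2 ^ l -> 0 <= B ->
  (forall n, mu (- n)%Z = - mu n) -> (forall n, Rabs (mu n) <= B * gauge L0 n) ->
  Rabs (mu p + mu q - mu (p + q)%Z)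
    <= 2 * 2 ^ l * (Rabs (transfer J l (p, q) mu 0) + 32 * kappa * B * amp ^ l).
Proof.
  intros Ha Hpq Hq HL HB Hodd Hmu.
  assert (H0 : mu 0%Z = 0) by (pose proof (Hodd 0%Z) as H; change (- 0)%Z with 0%Z in H; lra).
  assert (Hinc : forall b, Rabs (mu (0 + b)%Z - mu 0%Z) <= B * rad l * tweight (rad l) b).
  { intros b.
    pose proof (gauge_increment l L0 B 0 mu 0 b HL HB (Rle_refl 0)) as G.
    replace (gauge L0 0) with 0 in G by reflexivity.
    rewrite !Rmult_0_r, Rplus_0_r, Rplus_0_l in G; apply G.
    intros n; rewrite Rplus_0_r; apply Hmu. }
  pose proof (transfer_expand J l p q mu 0 _ Ha Hpq Hq Hinc) as E.
  rewrite !Z.add_0_l, !Z.sub_0_l, !Hodd, H0 in E.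
  pose proof (amp_pow_cube l) as Hc; pose proof (amp_pow_pos l) as Hh; pose proof (pow_two_pos l) as Hl.
  set (h := amp ^ l) in *; set (X := mu p + mu q - mu (p + q)%Z).
  replace (B * rad l * (2 * kappa) * h ^ 4) with (32 * kappa * B * h * (h * h * h * 2 ^ l)) in E
    by (unfold rad; ring).
  rewrite Hc, Rmult_1_r in E.
  match type of E with Rabs (?t - ?y) <= _ =>
    replace (t - y) with (t + h ^ 3 / 2 * X) in E by (unfold X; field) end.
  assert (EX : X = 2 * 2 ^ l * (h ^ 3 / 2 * X)).
  { replace (2 * 2 ^ l * (h ^ 3 / 2 * X)) with ((h * h * h * 2 ^ l) * X) by field.
    rewrite Hc; ring. }
  rewrite EX, Rabs_mult, (Rabs_pos_eq (2 * 2 ^ l)) by lra.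
  apply Rmult_le_compat_l; [lra |].
  set (t := transfer J l (p, q) mu 0) in *.
  replace (h ^ 3 / 2 * X) with ((t + h ^ 3 / 2 * X) + - t) by ring.
  apply Rle_trans with (1 := Rabs_triang _ _); rewrite Rabs_Ropp; lra.
Qed.

Lemma wsum_transfer (J l : nat) (c : Z * Z) (s : Z -> R) (f : R -> C) (M D : R) (z : Z) :
  (forall n, Rabs (s n) <= M) -> contC f -> (forall x, Cmod (f x) <= D) ->
  wsum (fun n => transfer J l c s (n + z)) f = transfer J l c (fun y => wsum (fun n => s (n + y)%Z) f) z.
Proof.
  intros HM Hf HD; unfold transfer; set (G := approx l (fst c) (snd c) J).
  assert (H0 : forall a : Z, Zsummable (fun n => s (n + a)%Z * nu f n))
    by (intros a; apply (wsum_bounded _ f M D); auto).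
  assert (H1 : Zsummable (fun n => bil (fun a => s (n + (z + a))%Z * nu f n) G G)).
  { unfold bil; apply Zsum_lsum; intros u _; apply Zsum_lsum; intros v _.
    apply (Zsummable_scal _ (fun n => s (n + (z + fst u))%Z * nu f n)), H0. }
  unfold wsum.
  rewrite (Zsum_ext _ (fun n => bil (fun a => s (n + (z + a))%Z * nu f n) G G
     + (1 - bil (fun _ => 1) G G) * (s (n + z)%Z * nu f n))).
  - rewrite (Zsum_plus _ _ H1 (Zsummable_scal _ _ (H0 z))), Zsum_scal.
    rewrite (Zsum_bil (fun a n => s (n + (z + a))%Z * nu f n)) by (intros; apply H0).
    reflexivity.
  - intros n.
    rewrite (bil_ext (fun a => s (n + (z + a))%Z * nu f n) (fun a => nu f n * s (n + z + a)%Z))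
      by (intros; rewrite Z.add_assoc; ring).
    rewrite (bil_scal_l (nu f n)); ring.
Qed.

(** Cascades commute with translations, hence with averaging over the spectrum of f. Tests on f
    times blocks thereby become statements at the single point 0. *)
Lemma wsum_cascade (J l : nat) (Fs : families) (s : Z -> R) (f : R -> C) (M D : R) (z : Z) :
  admissible_families l Fs ->
  (forall n, Rabs (s n) <= M) -> contC f -> (forall x, Cmod (f x) <= D) ->
  wsum (fun n => cascade J l Fs s (n + z)) f
    = cascade J l Fs (fun y => wsum (fun n => s (n + y)%Z) f) z.
Proof.
  revert l z; induction Fs as [| F Fs IH]; intros l z HF HM Hf HD; [reflexivity |].
  destruct HF as [HF0 [HF1 HF2]]; cbn [cascade].
  rewrite <- (transfer_avg_ext J l F (fun y => wsum (fun n => cascade J (S l) Fs s (n + y)) f)).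
  2: { intros y; now apply IH. }
  unfold transfer_avg.
  rewrite (wsum_ext _ (fun n => / INR (length F)
     * lsum (fun c => transfer J l c (cascade J (S l) Fs s) (n + z)) F))
    by (intros; unfold Rdiv; ring).
  rewrite wsum_scal.
  rewrite (wsum_lsum (fun c n => transfer J l c (cascade J (S l) Fs s) (n + z)) F f
     (csup * (csup ^ length Fs * M)) D); try assumption.
  - unfold Rdiv; rewrite Rmult_comm; f_equal; apply lsum_ext; intros c _.
    apply (wsum_transfer J l c _ f (csup ^ length Fs * M) D); try assumption.
    intros; now apply cascade_sup.
  - intros c n Hc; apply transfer_sup; [now apply HF1 |]; intros; now apply cascade_sup.
Qed.

(** * Uniform bound on the multiplier *)

Section Core.

Variables (s : Z -> R) (f : R -> C) (M eta : R) (l1 : nat).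
Hypothesis (Hs : forall n, Rabs (s n) <= M) (Hf : contC f) (Hf1 : forall x, Cmod (f x) = 1).
Hypothesis (Heta : 0 < eta) (Hl1 : 2 * clev * amp ^ l1 <= 1 / 2).
Hypothesis (Htest : forall l Fs cs, (l1 <= l)%nat -> admissible_families l Fs -> choices Fs cs ->
  Rabs (wsum s (fun x => (f x * blocks l cs x)%C)) <= eta).

(** The multiplier as seen by blocks placed on top of f. Its odd part [lam] is singled out because
    only there is the cubic flux the leading term at 0. *)
Let Lam (y : Z) : R := wsum (fun n => s (n + y)%Z) f.
Let lam (y : Z) : R := (Lam y - Lam (- y)) / 2.
Let L0 : R := 2 ^ l1.

Lemma lam_odd (n : Z) : lam (- n) = - lam n.
Proof. unfold lam; rewrite Z.opp_involutive; field. Qed.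

Lemma Lam_bound (n : Z) : Rabs (Lam n) <= M.
Proof.
  replace M with (M * 1 ^ 2) by ring.
  apply (wsum_bounded (fun k => s (k + n)%Z) f M 1); [intros; apply Hs | exact Hf |].
  intros x; rewrite Hf1; lra.
Qed.

Lemma lam_bound (n : Z) : Rabs (lam n) <= M.
Proof.
  pose proof (Lam_bound n) as H1; pose proof (Lam_bound (- n)) as H2.
  apply Rabs_le_between in H1; apply Rabs_le_between in H2; unfold lam; apply Rabs_le; lra.
Qed.

Lemma M_nonneg : 0 <= M.
Proof. apply Rle_trans with (1 := Rabs_pos (s 0%Z)); apply Hs. Qed.

Lemma cascade_lam_small (l : nat) (Fs : families) :
  (l1 <= l)%nat -> admissible_families l Fs ->
  exists J, Rabs (cascade J l Fs lam 0) <= 2 * eta.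
Proof.
  intros Hl HF.
  set (w := INR (length Fs) * (12 * (csup ^ length Fs * M))).
  assert (Hw : 0 <= w).
  { pose proof M_nonneg; pose proof csup_ge1; unfold w.
    apply Rmult_le_pos; [apply pos_INR |]; apply Rmult_le_pos; [lra |].
    apply Rmult_le_pos; [apply pow_le; lra | lra]. }
  (* The order depends on the families and on [M], which neutralises the exponentially large factor
     in [w]. *)
  destruct (taylor_error_small (Rmin 1 (eta / (w + 1)))) as [J HJ].
  { apply Rmin_glb_lt; [lra |]; apply Rdiv_lt_0_compat; lra. }
  exists J.
  assert (HJ1 : taylor_error J <= 1) by (left; apply Rlt_le_trans with (1 := HJ), Rmin_l).
  assert (HJ2 : w * taylor_error J <= eta).
  { apply Rle_trans with (w * (eta / (w + 1))).
    - apply Rmult_le_compat_l; [exact Hw |]; left; apply Rlt_le_trans with (1 := HJ), Rmin_r.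
    - apply Rmult_le_reg_r with (w + 1); [lra |].
      replace (w * (eta / (w + 1)) * (w + 1)) with (w * eta) by (field; lra); nra. }
  assert (HT : forall Gs, admissible_families l Gs -> length Gs = length Fs ->
     Rabs (cascade J l Gs Lam 0) <= 2 * eta).
  { intros Gs HG HlG.
    rewrite <- (wsum_cascade J l Gs s f M 1) by (try assumption; intros x; rewrite Hf1; lra).
    rewrite (wsum_ext _ (cascade J l Gs s)) by (intros; now rewrite Z.add_0_r).
    apply Rle_trans with (eta + INR (length Gs) * (12 * (csup ^ length Gs * M) * taylor_error J)).
    - apply cascade_test; try assumption.
      intros cs Hcs; now apply Htest with Gs.
    - rewrite HlG; replace (INR (length Fs) * (12 * (csup ^ length Fs * M) * taylor_error J))
        with (w * taylor_error J) by (unfold w; ring); lra. }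
  pose proof (HT Fs HF eq_refl) as H1.
  pose proof (HT (map (map neg_pair) Fs) (admissible_families_neg l Fs HF) (length_map _ _)) as H2.
  rewrite cascade_neg in H2; change (- 0)%Z with 0%Z in H2.
  rewrite (cascade_ext J l Fs lam (fun n => / 2 * Lam n + (- / 2) * Lam (- n)%Z))
    by (intros; unfold lam; field).
  rewrite (cascade_plus J l Fs (fun n => / 2 * Lam n)), (cascade_scal J l Fs (/ 2) Lam),
    (cascade_scal J l Fs (- / 2) (fun n => Lam (- n)%Z)).
  apply Rabs_le_between in H1; apply Rabs_le_between in H2; apply Rabs_le; lra.
Qed.

Lemma iavg_lam_bound (B : R) (l : nat) (a : Z) : (l1 <= l)%nat -> 0 <= B ->
  (forall n, Rabs (lam n) <= B * gauge L0 n) -> 4 * 2 ^ l <= IZR a <= 5 * 2 ^ l ->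
  Rabs (iavg lam a l) <= 2 ^ l * (3 * eta + 5 * ctel * B * amp ^ l).
Proof.
  intros Hl HB Hlam Ha; pose proof (pow_two_pos l) as Hpl.
  assert (HL : 0 <= L0 <= 2 ^ l).
  { unfold L0; split; [left; apply pow_two_pos | apply Rle_pow; [lra | exact Hl]]. }
  (* The cascade is long enough for the far end of the telescope, at most M / 2^(l+K), to be below
     [eta]; with the 2 [eta] of the tests this makes 3 [eta]. *)
  destruct (Pow_x_infinity 2 ltac:(rewrite Rabs_pos_eq; lra) (M / eta + 1)) as [K HK].
  specialize (HK K (le_n K)); rewrite Rabs_pos_eq in HK by (left; apply pow_two_pos).
  destruct (cascade_lam_small l (cascade_families l a K) Hl (cascade_families_admissible l a K Ha))
    as [J HJ].
  pose proof (cascade_telescope J l a L0 B lam K HL HB Ha lam_odd Hlam) as HT.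
  assert (HKb : Rabs (iavg lam (doubled a K) (l + K) / 2 ^ (l + K)) <= eta).
  { pose proof (pow_two_pos (l + K)) as Hp.
    apply Rabs_div_le; [exact Hp |]; rewrite Rmult_comm.
    apply Rle_trans with M.
    - unfold iavg.
      set (n := Nat.pow 2 (l + K)).
      apply Rabs_div_le; [apply lt_0_INR, Nat.neq_0_lt_0, Nat.pow_nonzero; lia |].
      apply isum_bound; intros; apply lam_bound.
    - assert (M <= eta * 2 ^ K).
      { apply (Rmult_le_reg_r (/ eta)); [now apply Rinv_0_lt_compat |].
        replace (eta * 2 ^ K * / eta) with (2 ^ K) by (field; lra); unfold Rdiv in HK; lra. }
      rewrite pow_add.
      assert (1 <= 2 ^ l) by (apply pow_R1_Rle; lra); pose proof (pow_two_pos K).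
      assert (eta * 2 ^ K <= eta * (2 ^ l * 2 ^ K)); [| lra].
      apply Rmult_le_compat_l; [lra |]; nra. }
  assert (Hmain : Rabs (iavg lam a l / 2 ^ l) <= 3 * eta + 5 * ctel * B * amp ^ l).
  { assert (0 <= 5 * ctel * B * amp ^ (l + K)).
    { pose proof ctel_pos; pose proof (amp_pow_pos (l + K)).
      apply Rmult_le_pos; [apply Rmult_le_pos |]; lra. }
    apply Rabs_le_between in HJ; apply Rabs_le_between in HT; apply Rabs_le_between in HKb.
    apply Rabs_le; lra. }
  replace (iavg lam a l) with (2 ^ l * (iavg lam a l / 2 ^ l)) by (field; lra).
  rewrite Rabs_mult, (Rabs_pos_eq (2 ^ l)) by lra.
  apply Rmult_le_compat_l; lra.
Qed.

(** Averaging the fluxes of the blocks (n, b + k) over k leaves [lam n] plus a difference of two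
    interval averages, which are already controlled; 10 = 2 * 2 + 2 * 3. *)
Lemma lam_level_bound (B : R) (l : nat) (n : Z) : (l1 <= l)%nat -> 0 <= B ->
  (forall n, Rabs (lam n) <= B * gauge L0 n) -> (1 <= n)%Z -> IZR n <= 2 ^ l ->
  Rabs (lam n) <= 2 ^ l * (10 * eta + clev * B * amp ^ l).
Proof.
  intros Hl HB Hlam Hn1 Hn; pose proof (pow_two_pos l) as Hpl.
  assert (HL : 0 <= L0 <= 2 ^ l).
  { unfold L0; split; [left; apply pow_two_pos | apply Rle_pow; [lra | exact Hl]]. }
  set (N := Nat.pow 2 l).
  assert (HN : INR N = 2 ^ l) by (unfold N; rewrite pow_INR; reflexivity).
  (* As n <= 2^l, both b and b + n lie between 4 * 2^l and 5 * 2^l, and b + k > 2n excludes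
     resonances. *)
  set (b := (4 * Z.of_nat N)%Z).
  assert (Hb : IZR b = 4 * 2 ^ l) by (unfold b; rewrite mult_IZR, <- INR_IZR_INZ, HN; ring).
  assert (Hn0 : 1 <= IZR n) by (apply IZR_le; exact Hn1).
  assert (HnN : (n <= Z.of_nat N)%Z) by (apply le_IZR; rewrite <- INR_IZR_INZ, HN; exact Hn).
  pose proof (iavg_lam_bound B l b Hl HB Hlam ltac:(lra)) as A1.
  pose proof (iavg_lam_bound B l (b + n) Hl HB Hlam ltac:(rewrite plus_IZR; lra)) as A2.
  assert (HT : forall k, (k < N)%nat ->
     Rabs (lam n + lam (b + Z.of_nat k)%Z - lam (b + n + Z.of_nat k)%Z)
       <= 2 * 2 ^ l * (2 * eta + 32 * kappa * B * amp ^ l)).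
  { intros k Hk.
    assert (HkN : INR k + 1 <= 2 ^ l) by (rewrite <- HN, <- S_INR; apply le_INR; lia).
    pose proof (pos_INR k).
    assert (Ha : admissible l (n, (b + Z.of_nat k)%Z)).
    { unfold admissible; cbn [fst snd]; rewrite plus_IZR, <- INR_IZR_INZ, !Rabs_pos_eq; lra. }
    destruct (cascade_lam_small l [[(n, (b + Z.of_nat k)%Z)]] Hl) as [J HJ].
    { split; [discriminate |]; split; [intros c [<- | []]; exact Ha | exact I]. }
    assert (EJ : cascade J l [[(n, (b + Z.of_nat k)%Z)]] lam 0
       = transfer J l (n, (b + Z.of_nat k)%Z) lam 0).
    { cbn [cascade]; unfold transfer_avg; simpl; field. }
    rewrite EJ in HJ.
    replace (b + n + Z.of_nat k)%Z with (n + (b + Z.of_nat k))%Z by lia.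
    apply Rle_trans with (1 := transfer_single J l n (b + Z.of_nat k) L0 B lam Ha
      ltac:(lia) ltac:(lia) HL HB lam_odd Hlam).
    apply Rmult_le_compat_l; lra. }
  assert (HS : Rabs (INR N * lam n + isum lam b N - isum lam (b + n) N)
     <= INR N * (2 * 2 ^ l * (2 * eta + 32 * kappa * B * amp ^ l))).
  { replace (INR N * lam n + isum lam b N - isum lam (b + n) N)
      with (lsum (fun k => lam n + lam (b + Z.of_nat k)%Z + - 1 * lam (b + n + Z.of_nat k)%Z) (seq 0 N)).
    - apply Rle_trans with (1 := lsum_Rabs _ _).
      rewrite <- (length_seq N 0) at 2; rewrite <- lsum_const; apply lsum_le.
      intros k Hk; apply in_seq in Hk.
      replace (lam n + lam (b + Z.of_nat k)%Z + -1 * lam (b + n + Z.of_nat k)%Z)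
        with (lam n + lam (b + Z.of_nat k)%Z - lam (b + n + Z.of_nat k)%Z) by ring.
      apply HT; lia.
    - rewrite !lsum_plus, lsum_scal, lsum_const, length_seq; unfold isum; ring. }
  assert (HNp : 0 < INR N) by lra.
  assert (E : lam n = (INR N * lam n + isum lam b N - isum lam (b + n) N) / INR N
     - iavg lam b l + iavg lam (b + n) l).
  { unfold iavg; fold N; field; lra. }
  assert (HS' : Rabs ((INR N * lam n + isum lam b N - isum lam (b + n) N) / INR N)
     <= 2 * 2 ^ l * (2 * eta + 32 * kappa * B * amp ^ l)).
  { apply Rabs_div_le; [exact HNp | exact HS]. }
  rewrite E.
  assert (Ef : 2 ^ l * (10 * eta + clev * B * amp ^ l)
     = 2 * 2 ^ l * (2 * eta + 32 * kappa * B * amp ^ l)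
       + 2 * (2 ^ l * (3 * eta + 5 * ctel * B * amp ^ l))) by (unfold clev; ring).
  rewrite Ef.
  apply Rabs_le_between in A1; apply Rabs_le_between in A2; apply Rabs_le_between in HS'.
  apply Rabs_le; lra.
Qed.

Lemma dyadic_level (n : R) : exists l, (l1 <= l)%nat /\ n <= 2 ^ l /\ 2 ^ l <= 2 * (Rabs n + L0).
Proof.
  assert (HL0 : 0 < L0) by apply pow_two_pos.
  destruct (Pow_x_infinity 2 ltac:(rewrite Rabs_pos_eq; lra) n) as [K HK].
  specialize (HK (l1 + K)%nat ltac:(lia)); rewrite Rabs_pos_eq in HK by (left; apply pow_two_pos).
  apply Rge_le in HK; induction K as [| K IH].
  - exists l1; rewrite Nat.add_0_r in HK; pose proof (Rabs_pos n); fold L0.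
    split; [lia |]; split; [exact HK | lra].
  - destruct (Rle_dec n (2 ^ (l1 + K))) as [H | H]; [now apply IH |].
    exists (l1 + S K)%nat; split; [lia |]; split; [exact HK |].
    rewrite Nat.add_succ_r; cbn [pow]; pose proof (Rle_abs n); lra.
Qed.

(** At levels from [l1] on, the part of the level bound containing [B] is at most B / 4. Choosing
    2^l <= 2 (|n| + L0) doubles this to B / 2 and 10 [eta] to 20 [eta]. *)
Lemma lam_improve (B : R) : 0 <= B -> (forall n, Rabs (lam n) <= B * gauge L0 n) ->
  forall n, Rabs (lam n) <= (20 * eta + B / 2) * gauge L0 n.
Proof.
  intros HB Hlam; pose proof clev_pos as HC3.
  assert (HL0 : 0 < L0) by apply pow_two_pos.
  assert (Hpos : forall n, (1 <= n)%Z -> Rabs (lam n) <= (20 * eta + B / 2) * gauge L0 n).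
  { intros n Hn; destruct (dyadic_level (IZR n)) as [l [Hl [H1 H2]]].
    apply Rle_trans with (1 := lam_level_bound B l n Hl HB Hlam Hn H1).
    assert (G : gauge L0 n = Rabs (IZR n) + L0)
      by (unfold gauge; destruct (Z.eq_dec n 0); [lia | reflexivity]).
    rewrite G.
    assert (Hh : amp ^ l <= amp ^ l1).
    { replace l with (l1 + (l - l1))%nat by lia; rewrite pow_add.
      pose proof (amp_pow_le1 (l - l1)); pose proof (amp_pow_pos l1); nra. }
    assert (HCB : clev * B * amp ^ l <= B / 4).
    { apply Rle_trans with (clev * B * amp ^ l1).
      - apply Rmult_le_compat_l; [apply Rmult_le_pos; lra | exact Hh].
      - replace (clev * B * amp ^ l1) with (B * (2 * clev * amp ^ l1) / 2) by field.
        apply (Rmult_le_compat_l B) in Hl1; lra. }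
    apply Rle_trans with (2 * (Rabs (IZR n) + L0) * (10 * eta + B / 4)).
    - apply Rmult_le_compat; try lra; [left; apply pow_two_pos |].
      assert (0 <= clev * B * amp ^ l); [| lra].
      pose proof (amp_pow_pos l); apply Rmult_le_pos; [apply Rmult_le_pos |]; lra.
    - right; field. }
  intros n; destruct (Z.lt_trichotomy n 0) as [H | [-> | H]].
  - replace n with (- - n)%Z by lia; rewrite lam_odd, Rabs_Ropp.
    replace (gauge L0 (- - n)) with (gauge L0 (- n)).
    + apply Hpos; lia.
    + unfold gauge; destruct (Z.eq_dec (- n) 0); destruct (Z.eq_dec (- - n) 0); try lia.
      now rewrite (opp_IZR (- n)), Rabs_Ropp.
  - pose proof (lam_odd 0) as H0; change (- 0)%Z with 0%Z in H0.
    replace (lam 0) with 0 by lra; rewrite Rabs_R0.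
    replace (gauge L0 0) with 0 by reflexivity; lra.
  - apply Hpos; lia.
Qed.

(* [lam] is bounded, so the improvement can be iterated from the crude bound [M]. *)
Lemma lam_uniform_bound (n : Z) : Rabs (lam n) <= 40 * eta * gauge L0 n.
Proof.
  pose proof M_nonneg as HM.
  assert (HL0 : 1 <= L0) by (apply pow_R1_Rle; lra).
  assert (Hk : forall k n, Rabs (lam n) <= (40 * eta + M * (/ 2) ^ k) * gauge L0 n).
  { induction k as [| k IH]; intros m.
    - simpl; rewrite Rmult_1_r.
      unfold gauge; destruct (Z.eq_dec m 0) as [-> | Hm].
      + pose proof (lam_odd 0) as H0; change (- 0)%Z with 0%Z in H0.
        replace (lam 0) with 0 by lra; rewrite Rabs_R0; lra.
      + apply Rle_trans with (1 := lam_bound m); pose proof (Rabs_pos (IZR m)).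
        assert (0 <= eta * (Rabs (IZR m) + L0)) by (apply Rmult_le_pos; lra); nra.
    - pose proof (pow_lt (/ 2) k ltac:(lra)) as Hp.
      pose proof (Rmult_le_pos _ _ HM (Rlt_le _ _ Hp)).
      assert (HB : 0 <= 40 * eta + M * (/ 2) ^ k) by lra.
      apply Rle_trans with (1 := lam_improve _ HB IH m); right; simpl; field. }
  apply Rnot_lt_le; intros Hlt.
  pose proof (gauge_nonneg L0 n ltac:(lra)) as Hg.
  set (d := Rabs (lam n) - 40 * eta * gauge L0 n).
  assert (Hd : 0 < d) by (unfold d; lra).
  destruct (pow_lt_1_zero (/ 2) ltac:(rewrite Rabs_pos_eq; lra) (d / (M * gauge L0 n + 1))) as [k Hk'].
  { apply Rdiv_lt_0_compat; [exact Hd |]; pose proof (Rmult_le_pos _ _ HM Hg); lra. }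
  specialize (Hk' k (le_n k)); rewrite Rabs_pos_eq in Hk' by (apply pow_le; lra).
  specialize (Hk k n).
  set (g := M * gauge L0 n) in *.
  assert (Hg' : 0 <= g) by now apply Rmult_le_pos.
  assert (g * (/ 2) ^ k < d).
  { apply Rle_lt_trans with (g * (d / (g + 1))).
    - apply Rmult_le_compat_l; lra.
    - apply Rmult_lt_reg_r with (g + 1); [lra |].
      replace (g * (d / (g + 1)) * (g + 1)) with (g * d) by (field; lra); nra. }
  replace ((40 * eta + M * (/ 2) ^ k) * gauge L0 n)
    with (40 * eta * gauge L0 n + g * (/ 2) ^ k) in Hk by (unfold g; ring).
  unfold d in *; lra.
Qed.

End Core.

(** * Lacunary phases *)

(* At level [l], the two frequencies and the rotation of a block. *)
Definition config : Type := nat -> Z * Z * R.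

Definition good (c : config) : Prop := forall l, admissible l (fst (c l)).

Definition level_phase (c : config) (l : nat) (x : R) : R :=
  phase l (fst (fst (c l))) (snd (fst (c l))) (x + snd (c l)).

Definition total_phase (c : config) (x : R) : R := Series (fun l => level_phase c l x).

Definition partial_phase (c : config) (n : nat) (x : R) : R :=
  lsum (fun l => level_phase c l x) (seq 0 n).

Definition agree (n : nat) (c c' : config) : Prop := forall l, (l < n)%nat -> c l = c' l.

(** Zero frequencies give zero phase, so finite phases are eventually trivial configurations and
    share one type with their limits. *)
Definition silent (n : nat) (c : config) : Prop := forall l, (n <= l)%nat -> c l = (0%Z, 0%Z, 0).

Lemma level_phase_bound (c : config) (l : nat) (x : R) : Rabs (level_phase c l x) <= 3 * amp ^ l.
Proof. apply phase_bound. Qed.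

Lemma is_series_amp (n : nat) : is_series (fun k => 3 * amp ^ (n + k)) (3 * amp ^ n / (1 - amp)).
Proof.
  pose proof amp_bounds as Hb.
  assert (E : forall k, 3 * amp ^ n * amp ^ k = 3 * amp ^ (n + k)) by (intros; rewrite pow_add; ring).
  apply (is_series_ext _ _ _ E).
  apply (is_series_scal_l (3 * amp ^ n) (fun k => amp ^ k) (/ (1 - amp))).
  apply is_series_geom; rewrite Rabs_pos_eq; lra.
Qed.

Lemma ex_series_level_phase (c : config) (x : R) : ex_series (fun l => level_phase c l x).
Proof.
  apply (ex_series_le (V := R_CompleteNormedModule)) with (fun l => 3 * amp ^ l).
  - intros l; apply level_phase_bound.
  - eexists; exact (is_series_amp 0).
Qed.

Lemma total_phase_tail (c : config) (n : nat) (x : R) :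
  Rabs (total_phase c x - partial_phase c n x) <= 15 * amp ^ n.
Proof.
  pose proof amp_bounds as Hb; pose proof (amp_pow_pos n) as Hh.
  assert (E : total_phase c x = partial_phase c n x + Series (fun k => level_phase c (n + k) x)).
  { unfold total_phase; destruct n as [| n].
    - unfold partial_phase; simpl; rewrite Rplus_0_l; reflexivity.
    - rewrite (Series_incr_n _ (S n)) by (try lia; apply ex_series_level_phase); f_equal.
      clear Hh; cbn [pred]; unfold partial_phase; induction n as [| n IH]; [simpl; ring |].
      rewrite seq_S, lsum_app, <- IH; cbn [sum_f_R0 lsum fold_right Nat.add]; ring. }
  rewrite E; replace (partial_phase c n x + Series (fun k => level_phase c (n + k) x)
    - partial_phase c n x) with (Series (fun k => level_phase c (n + k) x)) by ring.
  assert (Hex : ex_series (fun k => Rabs (level_phase c (n + k) x))).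
  { apply (ex_series_le (V := R_CompleteNormedModule)) with (fun k => 3 * amp ^ (n + k)).
    - intros k; unfold norm; simpl; unfold abs; simpl; rewrite Rabs_Rabsolu; apply level_phase_bound.
    - eexists; apply is_series_amp. }
  apply Rle_trans with (1 := Series_Rabs _ Hex).
  apply Rle_trans with (Series (fun k => 3 * amp ^ (n + k))).
  - apply Series_le; [| eexists; apply is_series_amp].
    intros k; split; [apply Rabs_pos | apply level_phase_bound].
  - rewrite (is_series_unique _ _ (is_series_amp n)).
    (* amp < 4/5 turns 3 / (1 - amp) into 15. *)
    apply Rmult_le_reg_r with (1 - amp); [lra |].
    replace (3 * amp ^ n / (1 - amp) * (1 - amp)) with (3 * amp ^ n) by (field; lra); nra.
Qed.

Lemma amp_pow_to_0 (e : R) : 0 < e -> exists n, forall k, (n <= k)%nat -> amp ^ k < e.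
Proof.
  intros He; pose proof amp_bounds as Hb.
  destruct (pow_lt_1_zero amp ltac:(rewrite Rabs_pos_eq; lra) e He) as [n Hn].
  exists n; intros k Hk; specialize (Hn k Hk).
  now rewrite Rabs_pos_eq in Hn by (left; apply amp_pow_pos).
Qed.

Lemma level_phase_silent (l : nat) (c : config) (x : R) : c l = (0%Z, 0%Z, 0) ->
  level_phase c l x = 0.
Proof.
  intros H; unfold level_phase; rewrite H; unfold phase; cbn [fst snd Z.add].
  rewrite !Rmult_0_l, sin_0; ring.
Qed.

Lemma partial_phase_silent (c : config) (n m : nat) (x : R) : silent n c -> (n <= m)%nat ->
  partial_phase c m x = partial_phase c n x.
Proof.
  intros Hs Hm; unfold partial_phase.
  replace m with (n + (m - n))%nat by lia; rewrite seq_app, lsum_app.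
  rewrite (lsum_ext _ (fun _ => 0) (seq (0 + n) (m - n))).
  - rewrite lsum_const; ring.
  - intros l Hl; apply in_seq in Hl; apply level_phase_silent, Hs; lia.
Qed.

Lemma total_phase_silent (c : config) (n : nat) (x : R) : silent n c ->
  total_phase c x = partial_phase c n x.
Proof.
  intros Hs; apply Rminus_diag_uniq; apply Rabs_eq_0.
  apply Rle_antisym; [| apply Rabs_pos].
  apply Rnot_lt_le; intros Hd.
  destruct (amp_pow_to_0 (Rabs (total_phase c x - partial_phase c n x) / 15)) as [k Hk]; [lra |].
  specialize (Hk (n + k)%nat ltac:(lia)).
  pose proof (total_phase_tail c (n + k) x) as H.
  rewrite (partial_phase_silent c n (n + k)) in H by (try assumption; lia); lra.
Qed.

Lemma partial_phase_agree (c c' : config) (n : nat) (x : R) : agree n c c' ->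
  partial_phase c n x = partial_phase c' n x.
Proof.
  intros H; unfold partial_phase; apply lsum_ext; intros l Hl; apply in_seq in Hl.
  unfold level_phase; rewrite H by lia; reflexivity.
Qed.

Lemma sin_lipschitz (a b : R) : Rabs (sin a - sin b) <= Rabs (a - b).
Proof.
  destruct (MVT_gen sin b a cos) as [c [_ E]].
  - intros x _; apply is_derive_sin.
  - intros x _; apply continuity_sin.
  - rewrite E, Rabs_mult; pose proof (COS_bound c); pose proof (Rabs_pos (a - b)).
    assert (Rabs (cos c) <= 1) by (apply Rabs_le; lra); nra.
Qed.

Lemma cos_lipschitz (a b : R) : Rabs (cos a - cos b) <= Rabs (a - b).
Proof.
  rewrite <- !sin_shift; apply Rle_trans with (1 := sin_lipschitz _ _).
  replace (PI / 2 - a - (PI / 2 - b)) with (- (a - b)) by ring; now rewrite Rabs_Ropp; right.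
Qed.

Lemma expi_lipschitz (a b : R) : Cmod (expi a - expi b) <= 2 * Rabs (a - b).
Proof.
  apply Rle_trans with (1 := Cmod_2Rmax _).
  assert (Hs : sqrt 2 <= 2).
  { rewrite <- (sqrt_square 2) at 2 by lra; apply sqrt_le_1; lra. }
  apply Rmult_le_compat; [apply sqrt_pos | | exact Hs |].
  - apply Rle_trans with (2 := Rmax_l _ _), Rabs_pos.
  - apply Rmax_lub; [apply cos_lipschitz | apply sin_lipschitz].
Qed.

Lemma level_phase_lipschitz (c : config) (l : nat) (x y : R) : good c ->
  Rabs (level_phase c l x - level_phase c l y) <= 32 * (2 * amp) ^ l * Rabs (x - y).
Proof.
  intros Hc; destruct (Hc l) as [Hp Hq]; unfold level_phase, phase.
  set (p := fst (fst (c l))) in *; set (q := snd (fst (c l))) in *; set (al := snd (c l)).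
  pose proof (amp_pow_pos l) as Hh; pose proof (pow_two_pos l) as H2; pose proof (Rabs_pos (x - y)) as Ht.
  assert (Hs : forall k : Z, Rabs (sin (IZR k * (x + al)) - sin (IZR k * (y + al)))
     <= Rabs (IZR k) * Rabs (x - y)).
  { intros k; apply Rle_trans with (1 := sin_lipschitz _ _).
    rewrite <- Rabs_mult; right; f_equal; ring. }
  assert (Hpq : Rabs (IZR (p + q)) <= 16 * 2 ^ l).
  { rewrite plus_IZR; apply Rle_trans with (1 := Rabs_triang _ _); lra. }
  assert (Hs' : forall k : Z, forall W, Rabs (IZR k) <= W ->
     Rabs (sin (IZR k * (x + al)) - sin (IZR k * (y + al))) <= W * Rabs (x - y)).
  { intros k W HW; apply Rle_trans with (1 := Hs k); now apply Rmult_le_compat_r. }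
  pose proof (Hs' p _ Hp) as K1; pose proof (Hs' q _ Hq) as K2; pose proof (Hs' _ _ Hpq) as K3.
  rewrite Rpow_mult_distr.
  rewrite <- Rmult_minus_distr_l, Rabs_mult, (Rabs_pos_eq (amp ^ l)) by lra.
  replace (32 * (2 ^ l * amp ^ l) * Rabs (x - y)) with (amp ^ l * (32 * (2 ^ l * Rabs (x - y)))) by ring.
  apply Rmult_le_compat_l; [lra |].
  apply Rabs_le_between in K1; apply Rabs_le_between in K2; apply Rabs_le_between in K3.
  apply Rabs_le; lra.
Qed.

(** Ensures 2 amp - 1 >= 1/2, so that the Lipschitz constants 32 (2 amp)^l sum to at most 64 ((2
    amp)^n - 1). *)
Lemma amp_ge : 3 / 4 <= amp.
Proof.
  pose proof amp_bounds as Hb; pose proof amp_cube as E; simpl in E.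
  apply Rnot_lt_le; intros H1.
  assert (amp * amp <= 9 / 16) by nra.
  assert (amp * (amp * amp) <= 27 / 64) by nra; lra.
Qed.

Lemma partial_phase_lipschitz (c : config) (n : nat) (x y : R) : good c ->
  Rabs (partial_phase c n x - partial_phase c n y) <= 64 * ((2 * amp) ^ n - 1) * Rabs (x - y).
Proof.
  intros Hc; pose proof amp_ge as Hh; pose proof (Rabs_pos (x - y)) as Ht.
  induction n as [| n IH].
  - unfold partial_phase; simpl; rewrite !Rminus_diag, Rabs_R0; lra.
  - unfold partial_phase in *; rewrite seq_S, !lsum_app, !lsum_cons; cbn [Nat.add lsum fold_right].
    pose proof (level_phase_lipschitz c n x y Hc) as H.
    assert (Hp : 0 <= (2 * amp) ^ n * Rabs (x - y)).
    { apply Rmult_le_pos; [apply pow_le; lra | exact Ht]. }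
    assert (Hp' : 32 * ((2 * amp) ^ n * Rabs (x - y)) <= 64 * (2 * amp - 1) * ((2 * amp) ^ n * Rabs (x - y)))
      by (apply Rmult_le_compat_r; lra).
    cbn [pow]; apply Rabs_le_between in IH; apply Rabs_le_between in H; apply Rabs_le; lra.
Qed.

Lemma dyadic_scale (t : R) : 0 < t <= 1 -> exists n, 2 ^ n * t <= 1 /\ 1 <= 2 * (2 ^ n * t).
Proof.
  intros [Ht Ht1].
  destruct (Pow_x_infinity 2 ltac:(rewrite Rabs_pos_eq; lra) (/ t)) as [K HK].
  specialize (HK K (le_n K)); rewrite Rabs_pos_eq in HK by (left; apply pow_two_pos).
  apply Rge_le in HK; apply (Rmult_le_compat_r t) in HK; [| lra].
  rewrite Rinv_l in HK by lra.
  induction K as [| K IH].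
  - exists 0%nat; simpl in *; lra.
  - destruct (Rle_dec 1 (2 ^ K * t)) as [H | H]; [now apply IH |].
    exists K; cbn [pow] in HK; lra.
Qed.

(** At the level n with 2^n t in [1/2, 1] the increment is at most amp^n (64 + 30), and (amp^n)^3 =
    2^(-n) <= 2 t. *)
Definition holder_const : R := 2 * 94 ^ 3.

(* Frequencies up to [2 ^ n ~ 1 / |x - y|] are estimated by their derivative, the others by their size. *)
Lemma total_phase_holder (c : config) (x y : R) : good c ->
  Rabs (total_phase c x - total_phase c y) ^ 3 <= holder_const * Rabs (x - y).
Proof.
  intros Hc; set (t := Rabs (x - y)).
  assert (Hn : forall n, Rabs (total_phase c x - total_phase c y) <= amp ^ n * (64 * (2 ^ n * t) + 30)
    /\ (n = 0%nat -> Rabs (total_phase c x - total_phase c y) <= 30)).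
  { intros n.
    pose proof (total_phase_tail c n x) as H1; pose proof (total_phase_tail c n y) as H2.
    pose proof (partial_phase_lipschitz c n x y Hc) as H3; fold t in H3.
    assert (Ht : 0 <= t) by apply Rabs_pos.
    apply Rabs_le_between in H1; apply Rabs_le_between in H2; apply Rabs_le_between in H3.
    replace (amp ^ n * (64 * (2 ^ n * t) + 30)) with (64 * (2 * amp) ^ n * t + 30 * amp ^ n)
      by (rewrite Rpow_mult_distr; ring).
    split; [apply Rabs_le; lra |].
    intros ->; simpl in H1, H2, H3; apply Rabs_le; lra. }
  set (a := Rabs (total_phase c x - total_phase c y)) in *.
  assert (Ha : 0 <= a) by apply Rabs_pos.
  destruct (Rle_dec t 1) as [Ht1 | Ht1].
  - destruct (Req_dec t 0) as [Ht0 | Ht0].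
    + assert (x = y).
      { unfold t in Ht0; apply Rminus_diag_uniq.
        destruct (Req_dec (x - y) 0) as [E | E]; [exact E |].
        apply Rabs_no_R0 in E; contradiction. }
      assert (a = 0) by (unfold a; subst y; rewrite Rminus_diag; apply Rabs_R0).
      rewrite H0, Ht0; simpl; lra.
    + assert (Ht : 0 < t) by (pose proof (Rabs_pos (x - y)); fold t in H; lra).
      destruct (dyadic_scale t (conj Ht Ht1)) as [n [Hn1 Hn2]].
      destruct (Hn n) as [H _].
      assert (H' : a <= amp ^ n * 94).
      { apply Rle_trans with (1 := H); pose proof (amp_pow_pos n); apply Rmult_le_compat_l; lra. }
      apply Rle_trans with ((amp ^ n * 94) ^ 3); [apply pow_incr; lra |].
      pose proof (amp_pow_cube n) as E; pose proof (pow_two_pos n) as H2n.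
      rewrite Rpow_mult_distr; unfold holder_const.
      replace (2 * 94 ^ 3 * t) with (2 * t * 94 ^ 3) by ring.
      apply Rmult_le_compat_r; [apply pow_le; lra |].
      apply Rmult_le_reg_r with (2 ^ n); [exact H2n |].
      replace ((amp ^ n) ^ 3 * 2 ^ n) with (amp ^ n * amp ^ n * amp ^ n * 2 ^ n) by ring; lra.
  - destruct (Hn 0%nat) as [_ H]; specialize (H eq_refl).
    apply Rle_trans with (30 ^ 3); [apply pow_incr; lra |].
    unfold holder_const; simpl; lra.
Qed.

Lemma contR_total_phase (c : config) : good c -> contR (total_phase c).
Proof.
  intros Hc x; apply filterlim_locally; intros eps.
  assert (HK : 0 < holder_const) by (unfold holder_const; simpl; lra).
  assert (Hd : 0 < eps ^ 3 / holder_const).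
  { apply Rdiv_lt_0_compat; [apply pow_lt, cond_pos | exact HK]. }
  exists (mkposreal _ Hd); intros y Hy.
  unfold ball in *; simpl in *; unfold AbsRing_ball, abs, minus, plus, opp in *; simpl in *.
  apply Rnot_le_lt; intros H.
  pose proof (total_phase_holder c y x Hc) as H1.
  assert (H2 : eps ^ 3 <= Rabs (total_phase c y - total_phase c x) ^ 3).
  { apply pow_incr; split; [left; apply cond_pos | exact H]. }
  assert (H3 : holder_const * Rabs (y - x) < eps ^ 3).
  { replace (eps ^ 3) with (holder_const * (eps ^ 3 / holder_const)) by (field; lra).
    apply Rmult_lt_compat_l; [exact HK | exact Hy]. }
  lra.
Qed.

Lemma total_phase_period (c : config) (x : R) : total_phase c (x + 2 * PI) = total_phase c x.
Proof.
  apply Series_ext; intros l; unfold level_phase, phase.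
  assert (H : forall k : Z, sin (IZR k * (x + 2 * PI + snd (c l))) = sin (IZR k * (x + snd (c l)))).
  { intros k.
    replace (IZR k * (x + 2 * PI + snd (c l))) with (IZR k * (x + snd (c l)) + 2 * PI * IZR k) by ring.
    exact (f_equal snd (expi_period (IZR k * (x + snd (c l))) k)). }
  now rewrite !H.
Qed.

Definition test_map (c : config) (d : Z) (x : R) : C := expi (total_phase c x + IZR d * x).

Lemma contR_test_phase (c : config) (d : Z) : good c ->
  contR (fun x => total_phase c x + IZR d * x).
Proof.
  intros Hc; apply contR_plus; [now apply contR_total_phase |].
  apply contR_mult; [apply contR_const | apply contR_id].
Qed.

Lemma contC_test_map (c : config) (d : Z) : good c -> contC (test_map c d).
Proof. intros Hc; apply contC_expi; now apply contR_test_phase. Qed.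

Lemma test_phase_period (c : config) (d : Z) (x : R) :
  total_phase c (x + 2 * PI) + IZR d * (x + 2 * PI)
    = total_phase c x + IZR d * x + 2 * PI * IZR d.
Proof. rewrite total_phase_period; ring. Qed.

Lemma test_map_circle (c : config) (d : Z) : circle_map (test_map c d).
Proof.
  split.
  - intros x; unfold test_map; rewrite test_phase_period; apply expi_period.
  - intros x; apply Cmod_expi.
Qed.

Lemma test_map_degree (c : config) (d : Z) : good c -> has_degree (test_map c d) d.
Proof.
  intros Hc; exists (fun x => total_phase c x + IZR d * x); split; [| split].
  - now apply contR_test_phase.
  - reflexivity.
  - apply test_phase_period.
Qed.

(** Cubes postpone real powers. Up to distance 1 the winding term is absorbed through (a + b)^3 <= 4
    (a^3 + b^3); beyond it the trivial bound 2 suffices. *)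
Lemma test_map_cube (c : config) (d : Z) : good c -> exists K, 0 < K /\
  forall x y, Cmod (test_map c d x - test_map c d y) ^ 3 <= K * Rabs (x - y).
Proof.
  intros Hc.
  assert (HK : 0 < holder_const) by (unfold holder_const; simpl; lra).
  pose proof (pow_le (Rabs (IZR d)) 3 (Rabs_pos _)) as Hd3.
  exists (32 * (holder_const + Rabs (IZR d) ^ 3) + 8); split; [lra |]; intros x y.
  set (t := Rabs (x - y)); assert (Ht : 0 <= t) by apply Rabs_pos.
  set (F := Cmod (test_map c d x - test_map c d y)).
  assert (HF0 : 0 <= F) by apply Cmod_ge_0.
  assert (HF2 : F <= 2).
  { unfold F, Cminus; apply Rle_trans with (1 := Cmod_triangle _ _).
    rewrite Cmod_opp; unfold test_map; rewrite !Cmod_expi; lra. }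
  destruct (Rle_dec t 1) as [Ht1 | Ht1].
  - pose proof (total_phase_holder c x y Hc) as H; fold t in H.
    set (a := Rabs (total_phase c x - total_phase c y)) in *.
    set (b := Rabs (IZR d)) in *.
    assert (Ha : 0 <= a) by apply Rabs_pos; assert (Hb : 0 <= b) by apply Rabs_pos.
    assert (HF : F <= 2 * (a + b * t)).
    { apply Rle_trans with (1 := expi_lipschitz _ _); apply Rmult_le_compat_l; [lra |].
      replace (total_phase c x + IZR d * x - (total_phase c y + IZR d * y))
        with ((total_phase c x - total_phase c y) + IZR d * (x - y)) by ring.
      apply Rle_trans with (1 := Rabs_triang _ _); rewrite Rabs_mult; fold a b t; lra. }
    apply Rle_trans with ((2 * (a + b * t)) ^ 3); [apply pow_incr; lra |].
    assert (Hbt : 0 <= b * t) by now apply Rmult_le_pos.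
    assert (Hconv : (a + b * t) ^ 3 <= 4 * (a ^ 3 + (b * t) ^ 3)).
    { assert (0 <= (a + b * t) * (a - b * t) ^ 2).
      { apply Rmult_le_pos; [lra | apply pow2_ge_0]. }
      replace (4 * (a ^ 3 + (b * t) ^ 3)) with
        ((a + b * t) ^ 3 + 3 * ((a + b * t) * (a - b * t) ^ 2)) by ring; lra. }
    assert (Ht3 : (b * t) ^ 3 <= b ^ 3 * t).
    { rewrite Rpow_mult_distr; apply Rmult_le_compat_l; [exact Hd3 |].
      assert (t * t <= 1) by nra; simpl; nra. }
    rewrite Rpow_mult_distr; simpl (2 ^ 3); lra.
  - apply Rle_trans with (2 ^ 3); [apply pow_incr; lra |].
    assert (0 <= (holder_const + Rabs (IZR d) ^ 3) * t) by (apply Rmult_le_pos; lra).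
    simpl (2 ^ 3); lra.
Qed.

Lemma periodic_Z (f : R -> C) (x : R) (k : Z) : periodic f -> f (x + 2 * PI * IZR k) = f x.
Proof.
  intros Hf.
  assert (Hn : forall (n : nat) (y : R), f (y + 2 * PI * INR n) = f y).
  { induction n as [| n IH]; intros y; [simpl; f_equal; ring |].
    rewrite S_INR, <- (IH y), <- (Hf (y + 2 * PI * INR n)); f_equal; ring. }
  destruct (Z_le_gt_dec 0 k) as [Hk | Hk].
  - rewrite <- (Z2Nat.id k Hk), <- INR_IZR_INZ; apply Hn.
  - rewrite <- (Hn (Z.to_nat (- k)) (x + 2 * PI * IZR k)).
    f_equal; rewrite INR_IZR_INZ, Z2Nat.id by lia; rewrite opp_IZR; ring.
Qed.

(** [real] sends infinite values to 0, so finiteness of the infimum must be checked: [A] bounds it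
    from below and the element with k = 0 from above. *)
Lemma dT_lower_bound (x y A : R) :
  (forall k : Z, A <= Rabs (x - y + 2 * PI * IZR k)) -> A <= dT x y.
Proof.
  intros H; unfold dT.
  set (E := fun d => exists k : Z, d = Rabs (x - y + 2 * PI * IZR k)).
  destruct (Glb_Rbar_correct E) as [H1 H2].
  assert (HA : Rbar_le A (Glb_Rbar E)).
  { apply H2; intros d [k ->]; apply H. }
  assert (HB : Rbar_le (Glb_Rbar E) (Rabs (x - y + 2 * PI * IZR 0))).
  { apply H1; now exists 0%Z. }
  destruct (Glb_Rbar E) as [g | |]; [exact HA | contradiction HB | contradiction HA].
Qed.

(** By periodicity the cubic bound holds for every representative of the difference and so passes to
    the infimum, without a minimiser. *)
Lemma holder_third (f : R -> C) (K : R) : circle_map f -> 0 < K ->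
  (forall x y, Cmod (f x - f y) ^ 3 <= K * Rabs (x - y)) -> holder (1 / 3) f.
Proof.
  intros [Hper Hmod] HK H.
  exists (2 + Rpower K (1 / 3)); intros x y _.
  set (F := Cmod (f x - f y)).
  assert (HF0 : 0 <= F) by apply Cmod_ge_0.
  assert (HF2 : F <= 2).
  { unfold F, Cminus; apply Rle_trans with (1 := Cmod_triangle _ _).
    rewrite Cmod_opp, !Hmod; lra. }
  assert (HP : 0 < Rpower K (1 / 3)) by apply exp_pos.
  assert (Hd : F ^ 3 / K <= dT x y).
  { apply dT_lower_bound; intros k; apply Rmult_le_reg_l with K; [exact HK |].
    replace (K * (F ^ 3 / K)) with (F ^ 3) by (field; lra).
    unfold F; rewrite <- (periodic_Z f x k Hper).
    replace (x - y + 2 * PI * IZR k) with (x + 2 * PI * IZR k - y) by ring; apply H. }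
  assert (HD : 0 < Rpower (dT x y) (1 / 3)) by apply exp_pos.
  apply Rle_div_l; [exact HD |].
  (* [Rpower] inverts the cube only on positive numbers, so F = 0 is treated apart. *)
  destruct HF0 as [HF0 | <-].
  - assert (H3 : 0 < F ^ 3 / K) by (apply Rdiv_lt_0_compat; [now apply pow_lt | exact HK]).
    assert (HFp : F = Rpower K (1 / 3) * Rpower (F ^ 3 / K) (1 / 3)).
    { rewrite Rpower_mult_distr by assumption.
      replace (K * (F ^ 3 / K)) with (F ^ 3) by (field; lra).
      rewrite <- Rpower_pow, Rpower_mult by exact HF0.
      replace (INR 3 * (1 / 3)) with 1 by (simpl; field); now rewrite Rpower_1. }
    assert (Hle : Rpower (F ^ 3 / K) (1 / 3) <= Rpower (dT x y) (1 / 3)).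
    { apply Rle_Rpower_l; lra. }
    rewrite HFp; apply Rle_trans with (Rpower K (1 / 3) * Rpower (dT x y) (1 / 3)).
    + apply Rmult_le_compat_l; lra.
    + apply Rmult_le_compat_r; lra.
  - apply Rmult_le_pos; lra.
Qed.

(** * Gliding hump *)

(** Beyond the list the default of [nth] is the silent block, so a graft is again a finite phase. *)
Definition graft (c : config) (l : nat) (cs : list (Z * Z * R)) : config :=
  fun k => if (k <? l)%nat then c k else nth (k - l) cs (0%Z, 0%Z, 0).

Lemma graft_silent (c : config) (l : nat) (cs : list (Z * Z * R)) :
  silent (l + length cs) (graft c l cs).
Proof.
  intros k Hk; unfold graft; destruct (Nat.ltb_spec k l); [lia |].
  apply nth_overflow; lia.
Qed.

Lemma choices_admissible (l : nat) (Fs : families) (cs : list (Z * Z * R)) (j : nat) :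
  admissible_families l Fs -> choices Fs cs -> (j < length cs)%nat ->
  admissible (l + j) (fst (nth j cs (0%Z, 0%Z, 0))).
Proof.
  revert l cs j; induction Fs as [| F Fs IH]; intros l [| c cs] j HF Hc Hj; simpl in Hj; try lia.
  - destruct Hc.
  - destruct HF as [_ [H1 H2]]; destruct Hc as [H3 H4]; destruct j as [| j].
    + rewrite Nat.add_0_r; now apply H1.
    + rewrite Nat.add_succ_r; apply (IH (S l) cs j); [assumption | assumption | lia].
Qed.

Lemma admissible_zero (l : nat) : admissible l (0%Z, 0%Z).
Proof.
  pose proof (pow_two_pos l); unfold admissible; cbn [fst snd]; rewrite Rabs_R0; lra.
Qed.

Lemma graft_good (c : config) (l : nat) (Fs : families) (cs : list (Z * Z * R)) :
  good c -> admissible_families l Fs -> choices Fs cs -> good (graft c l cs).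
Proof.
  intros Hc HF Hcs k; unfold graft; destruct (Nat.ltb_spec k l) as [Hk | Hk]; [apply Hc |].
  destruct (Nat.lt_ge_cases (k - l) (length cs)) as [Hj | Hj].
  - pose proof (choices_admissible l Fs cs (k - l) HF Hcs Hj) as H.
    now replace (l + (k - l))%nat with k in H by lia.
  - rewrite nth_overflow by exact Hj; apply admissible_zero.
Qed.

Lemma blocks_phase (c : config) (cs : list (Z * Z * R)) (l : nat) (x : R) :
  (forall j, (j < length cs)%nat -> c (l + j)%nat = nth j cs (0%Z, 0%Z, 0)) ->
  blocks l cs x = expi (lsum (fun k => level_phase c k x) (seq l (length cs))).
Proof.
  revert l; induction cs as [| b cs IH]; intros l H.
  - simpl; now rewrite expi_0.
  - cbn [blocks length seq]; rewrite lsum_cons, expi_plus, IH.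
    + f_equal; unfold block, level_phase; pose proof (H 0%nat ltac:(simpl; lia)) as H0.
      rewrite Nat.add_0_r in H0; cbn [nth] in H0; now rewrite H0.
    + intros j Hj; replace (S l + j)%nat with (l + S j)%nat by lia.
      now rewrite H by (simpl; lia).
Qed.

Lemma graft_map (c : config) (n l : nat) (cs : list (Z * Z * R)) (x : R) :
  silent n c -> (n <= l)%nat ->
  (test_map c 0 x * blocks l cs x)%C = test_map (graft c l cs) 0 x.
Proof.
  intros Hs Hl; unfold test_map.
  rewrite (blocks_phase (graft c l cs)), <- expi_plus.
  - f_equal.
    rewrite (total_phase_silent c n x Hs), (total_phase_silent _ _ x (graft_silent c l cs)).
    rewrite <- (partial_phase_silent c n l x Hs Hl).
    rewrite (partial_phase_agree c (graft c l cs)).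
    + unfold partial_phase; rewrite seq_app, lsum_app; cbn [Nat.add]; ring.
    + intros k Hk; unfold graft; now destruct (Nat.ltb_spec k l); [| lia].
  - intros j Hj; unfold graft; destruct (Nat.ltb_spec (l + j) l); [lia |].
    f_equal; lia.
Qed.

(** With this [eta] the uniform bound at L is 40 / 200 * 2 L = 2 L / 5, below the 3 L / 4 forced by
    the limits assumed in degrees L and -L. *)
Definition threshold : R := / 200.

Section Hump.

Variable (s : R -> Z -> R).
Hypothesis (Hs : forall e, 0 < e < 1 -> exists M, forall n, Rabs (s e n) <= M).
Hypothesis (Hlim : forall c d, good c -> forall e, 0 < e -> exists del, 0 < del /\
  forall eps, 0 < eps < del -> eps < 1 -> Rabs (wsum (s eps) (test_map c d) - IZR d) < e).

(** If all finite extensions had small sums at all small [eps], every test required by the uniform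
    bound would succeed, with the map of c as the fixed factor. *)
Lemma hump_exists (c : config) (n : nat) (e0 : R) : good c -> silent n c -> 0 < e0 ->
  exists c' n' eps, good c' /\ agree n c c' /\ silent n' c' /\ 0 < eps < e0 /\ eps < 1 /\
    threshold < Rabs (wsum (s eps) (test_map c' 0)).
Proof.
  intros Hc Hn He0; apply NNPP; intros Hcon.
  pose proof clev_pos as HC3.
  destruct (amp_pow_to_0 (/ (4 * clev))) as [k Hk]; [apply Rinv_0_lt_compat; lra |].
  set (l1 := (n + k)%nat).
  assert (Hl1 : 2 * clev * amp ^ l1 <= 1 / 2).
  { specialize (Hk l1 ltac:(lia)).
    apply Rlt_le, (Rmult_le_compat_l (2 * clev)) in Hk; [| lra].
    replace (2 * clev * / (4 * clev)) with (1 / 2) in Hk by (field; lra); exact Hk. }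
  set (f := test_map c 0).
  assert (Hf : contC f) by now apply contC_test_map.
  assert (Hf1 : forall x, Cmod (f x) = 1) by (intros; apply Cmod_expi).
  (* The degree equals the additive constant of the gauge, so the gauge at L is only 2 L. *)
  set (L := (2 ^ Z.of_nat l1)%Z).
  assert (HL : IZR L = 2 ^ l1) by (unfold L; now rewrite <- pow_IZR).
  pose proof (pow_two_pos l1) as HLp.
  destruct (Hlim c L Hc (2 ^ l1 / 4)) as [d1 [Hd1 K1]]; [lra |].
  destruct (Hlim c (- L)%Z Hc (2 ^ l1 / 4)) as [d2 [Hd2 K2]]; [lra |].
  set (eps := Rmin (Rmin d1 d2) (Rmin e0 1) / 2).
  assert (Hm : 0 < Rmin (Rmin d1 d2) (Rmin e0 1)) by (repeat apply Rmin_glb_lt; lra).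
  pose proof (Rmin_l (Rmin d1 d2) (Rmin e0 1)); pose proof (Rmin_r (Rmin d1 d2) (Rmin e0 1)).
  pose proof (Rmin_l d1 d2); pose proof (Rmin_r d1 d2); pose proof (Rmin_l e0 1); pose proof (Rmin_r e0 1).
  assert (Heps : 0 < eps /\ eps < d1 /\ eps < d2 /\ eps < e0 /\ eps < 1) by (unfold eps; lra).
  specialize (K1 eps ltac:(lra) ltac:(lra)); specialize (K2 eps ltac:(lra) ltac:(lra)).
  destruct (Hs eps ltac:(lra)) as [M HM].
  assert (Htest : forall l Fs cs, (l1 <= l)%nat -> admissible_families l Fs -> choices Fs cs ->
     Rabs (wsum (s eps) (fun x => (f x * blocks l cs x)%C)) <= threshold).
  { intros l Fs cs Hl HF Hcs; apply Rnot_lt_le; intros Hlt; apply Hcon.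
    exists (graft c l cs), (l + length cs)%nat, eps.
    split; [now apply graft_good with Fs |].
    split; [intros j Hj; unfold graft; destruct (Nat.ltb_spec j l); [reflexivity | lia] |].
    split; [apply graft_silent |]; split; [lra |]; split; [lra |].
    now rewrite <- (wsum_fun_ext (s eps) _ _ (fun x => graft_map c n l cs x Hn ltac:(lia))). }
  assert (Hth : 0 < threshold) by (unfold threshold; lra).
  pose proof (lam_uniform_bound (s eps) f M threshold l1 HM Hf Hf1 Hth Hl1 Htest L) as HB.
  assert (HLam : forall d, wsum (fun m => s eps (m + d)%Z) f = wsum (s eps) (test_map c d)).
  { intros d; rewrite <- (wsum_modulate (s eps) f M 1 d HM Hf) by (intros x; rewrite Hf1; lra).
    apply wsum_fun_ext; intros x; unfold f, test_map; rewrite <- expi_plus; f_equal; ring. }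
  cbv zeta beta in HB; rewrite !HLam in HB.
  assert (HG : gauge (2 ^ l1) L <= 2 * 2 ^ l1).
  { pose proof (gauge_le (2 ^ l1) L ltac:(lra)) as [_ H6].
    rewrite HL, Rabs_pos_eq in H6; lra. }
  rewrite opp_IZR, HL in K2; rewrite HL in K1.
  assert (HB' : 40 * threshold * gauge (2 ^ l1) L <= 40 * threshold * (2 * 2 ^ l1)).
  { apply Rmult_le_compat_l; lra. }
  unfold threshold in *; apply Rabs_def2 in K1; apply Rabs_def2 in K2.
  apply Rabs_le_between in HB; lra.
Qed.

(** At fixed [eps] the sum is Lipschitz in the uniform norm, so a hump survives every later change
    at sufficiently high levels. *)
Lemma hump_stable (c : config) (eps : R) : good c -> 0 < eps < 1 ->
  threshold < Rabs (wsum (s eps) (test_map c 0)) ->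
  exists n0, forall n, (n0 <= n)%nat -> forall c', good c' -> agree n c c' ->
    threshold / 2 <= Rabs (wsum (s eps) (test_map c' 0)).
Proof.
  intros Hc Heps Hth; destruct (Hs eps Heps) as [M HM].
  assert (HM0 : 0 <= M) by (apply Rle_trans with (1 := Rabs_pos (s eps 0%Z)); apply HM).
  (* Agreement below level n leaves phases within 30 amp^n and maps within 60 amp^n; then 9 * 60 =
     540 <= 600 makes the loss at most half the threshold. *)
  destruct (amp_pow_to_0 (threshold / (1200 * (M + 1)))) as [n0 Hn0].
  { apply Rdiv_lt_0_compat; unfold threshold; lra. }
  exists n0; intros n Hn c' Hc' Hag; specialize (Hn0 n Hn).
  pose proof (amp_pow_pos n) as Hh.
  assert (HD : Rabs (wsum (s eps) (test_map c 0) - wsum (s eps) (test_map c' 0))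
     <= 9 * M * (60 * amp ^ n)).
  { apply wsum_lip.
    - exact HM.
    - now apply contC_test_map.
    - now apply contC_test_map.
    - lra.
    - intros x; unfold test_map; rewrite Cmod_expi; lra.
    - intros x; unfold test_map; rewrite Cmod_expi; lra.
    - intros x; apply Rle_trans with (1 := expi_lipschitz _ _).
      pose proof (total_phase_tail c n x) as H1; pose proof (total_phase_tail c' n x) as H2.
      rewrite (partial_phase_agree c c' n x Hag) in H1.
      assert (Rabs (total_phase c x + 0 * x - (total_phase c' x + 0 * x)) <= 30 * amp ^ n); [| lra].
      apply Rabs_le_between in H1; apply Rabs_le_between in H2; apply Rabs_le; lra. }
  assert (HD' : 9 * M * (60 * amp ^ n) <= threshold / 2).
  { apply Rle_trans with (600 * ((M + 1) * amp ^ n)).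
    - assert (0 <= M * amp ^ n) by (apply Rmult_le_pos; lra); lra.
    - apply (Rmult_lt_compat_l (M + 1)) in Hn0; [| lra].
      replace ((M + 1) * (threshold / (1200 * (M + 1)))) with (threshold / 1200) in Hn0
        by (field; lra); lra. }
  pose proof (Rabs_triang_inv (wsum (s eps) (test_map c 0)) (wsum (s eps) (test_map c 0)
     - wsum (s eps) (test_map c' 0))) as H.
  replace (wsum (s eps) (test_map c 0) - (wsum (s eps) (test_map c 0)
     - wsum (s eps) (test_map c' 0))) with (wsum (s eps) (test_map c' 0)) in H by ring.
  lra.
Qed.

(** The invariants are part of the type, so that each stage has a successor unconditionally and
    dependent choice applies. *)
Definition stage : Type := {st : config * nat | good (fst st) /\ silent (snd st) (fst st)}.

Definition config_of (st : stage) : config := fst (proj1_sig st).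
Definition level_of (st : stage) : nat := snd (proj1_sig st).

(** The lower bound is demanded of every good configuration that agrees with the new stage, hence
    also of the limit, which is not yet known. *)
Definition refines (m : nat) (st st' : stage) : Prop :=
  (level_of st < level_of st')%nat /\ agree (level_of st) (config_of st) (config_of st') /\
  exists eps, 0 < eps < / INR (S m) /\ eps < 1 /\
    forall c, good c -> agree (level_of st') (config_of st') c ->
      threshold / 2 <= Rabs (wsum (s eps) (test_map c 0)).

Lemma refine_exists (m : nat) (st : stage) : exists st', refines m st st'.
Proof.
  destruct st as [[c n] [Hc Hn]]; cbn [fst snd] in Hc, Hn.
  assert (Hm : 0 < / INR (S m)) by (apply Rinv_0_lt_compat, lt_0_INR; lia).
  destruct (hump_exists c n (/ INR (S m)) Hc Hn Hm) as [c' [n' [eps [H1 [H2 [H3 [H4 [H5 H6]]]]]]]].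
  destruct (hump_stable c' eps H1 ltac:(lra) H6) as [n0 Hn0].
  (* Large enough for silence and stability; the 1 makes the levels strictly increase, on which the
     diagonal limit relies. *)
  set (n2 := (n + n' + n0 + 1)%nat).
  assert (Hs2 : silent n2 c') by (intros l Hl; apply H3; lia).
  exists (exist _ (c', n2) (conj H1 Hs2)).
  unfold refines, level_of, config_of; cbn [proj1_sig fst snd].
  split; [lia |]; split; [exact H2 |].
  exists eps; split; [exact H4 |]; split; [exact H5 |].
  intros c0 Hc0 Hag; apply (Hn0 n2); [lia | exact Hc0 | exact Hag].
Qed.

Lemma stages_exist : exists st : nat -> stage, forall m, refines m (st m) (st (S m)).
Proof.
  assert (H0 : good (fun _ => (0%Z, 0%Z, 0)) /\ silent 0 (fun _ => (0%Z, 0%Z, 0))).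
  { split; [intros l; apply admissible_zero | intros l _; reflexivity]. }
  pose (next := fun m st => proj1_sig (constructive_indefinite_description _ (refine_exists m st))).
  pose (st := fix st (m : nat) : stage := match m with
    | O => exist (fun st => good (fst st) /\ silent (snd st) (fst st)) (fun _ => (0%Z, 0%Z, 0), 0%nat) H0
    | S k => next k (st k) end).
  exists st; intros m; cbn [st]; unfold next.
  exact (proj2_sig (constructive_indefinite_description _ (refine_exists m (st m)))).
Qed.

Lemma no_universal_limit : False.
Proof.
  destruct stages_exist as [st Hst].
  assert (Hlev : forall m, (m <= level_of (st m))%nat).
  { induction m as [| m IH]; [lia |]; destruct (Hst m) as [H _]; lia. }
  assert (Hmono : forall m k : nat, (level_of (st m) <= level_of (st (m + k)%nat))%nat).
  { intros m k; induction k as [| k IH]; [rewrite Nat.add_0_r; lia |].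
    rewrite Nat.add_succ_r; destruct (Hst (m + k)%nat) as [H _]; lia. }
  assert (Hag : forall m k : nat, agree (level_of (st m)) (config_of (st m)) (config_of (st (m + k)%nat))).
  { intros m k l Hl; induction k as [| k IH]; [now rewrite Nat.add_0_r |].
    rewrite Nat.add_succ_r, IH; destruct (Hst (m + k)%nat) as [_ [H _]]; apply H.
    specialize (Hmono m k); lia. }
  (* Stage l + 1 has level at least l + 1, so its entry at l is already frozen. *)
  set (c := fun l => config_of (st (S l)) l).
  assert (Hc : good c) by (intros l; apply (proj2_sig (st (S l)))).
  assert (Hagc : forall m, agree (level_of (st m)) (config_of (st m)) c).
  { intros m l Hl; unfold c.
    destruct (Nat.le_ge_cases m (S l)) as [H | H].
    - replace (S l) with (m + (S l - m))%nat by lia; now apply Hag.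
    - symmetry; replace m with (S l + (m - S l))%nat by lia; apply Hag.
      specialize (Hlev (S l)); lia. }
  destruct (Hlim c 0%Z Hc (threshold / 2)) as [del [Hdel HL]]; [unfold threshold; lra |].
  destruct (archimed_cor1 del Hdel) as [N [HN HN0]].
  destruct N as [| m]; [lia |].
  destruct (Hst m) as [_ [_ [eps [He1 [He2 He3]]]]].
  specialize (HL eps ltac:(lra) He2); rewrite Rminus_0_r in HL.
  specialize (He3 c Hc (Hagc (S m))); lra.
Qed.

End Hump.

(** * The series of the statement *)

Lemma is_series_C (u v : nat -> R) (a b : R) : is_series u a -> is_series v b ->
  is_series (V := C_NormedModule) (fun k => (u k, v k) : C) ((a, b) : C).
Proof.
  intros Hu Hv.
  assert (E : forall N, sum_n (G := C_AbelianMonoid) (fun k => (u k, v k) : C) N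
     = ((sum_n u N, sum_n v N) : C)).
  { induction N as [| N IH]; [now rewrite !sum_O |].
    rewrite !sum_Sn, IH; reflexivity. }
  intros P [eps HP].
  destruct (Hu _ (locally_ball a eps)) as [N1 H1].
  destruct (Hv _ (locally_ball b eps)) as [N2 H2].
  exists (N1 + N2)%nat; intros N HN.
  change (P (sum_n (G := C_AbelianMonoid) (fun k => (u k, v k) : C) N)); rewrite E; apply HP.
  split; [apply H1; lia | apply H2; lia].
Qed.

Lemma is_Zseries_wsum (tau : Z -> C) (f : R -> C) (M : R) :
  (forall n, Rabs (IZR n) * Cmod (tau n) <= M) -> contC f -> (forall x, Cmod (f x) <= 1) ->
  is_Zseries (fun n => (RtoC (IZR n * Cmod (fourier f n) ^ 2) * tau n)%C)
    (wsum (fun n => IZR n * fst (tau n)) f, wsum (fun n => IZR n * snd (tau n)) f).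
Proof.
  intros HM Hf Hf1.
  set (b := fun n => Rabs (IZR n) * Cmod (tau n)).
  set (u := fun n => IZR n * fst (tau n)); set (v := fun n => IZR n * snd (tau n)).
  assert (Hu : forall n, Rabs (u n) <= b n).
  { intros n; unfold u, b; rewrite Rabs_mult; apply Rmult_le_compat_l; [apply Rabs_pos |].
    apply Rle_trans with (2 := Rmax_Cmod _), Rmax_l. }
  assert (Hv : forall n, Rabs (v n) <= b n).
  { intros n; unfold v, b; rewrite Rabs_mult; apply Rmult_le_compat_l; [apply Rabs_pos |].
    apply Rle_trans with (2 := Rmax_Cmod _), Rmax_r. }
  assert (Hb0 : forall n, 0 <= b n).
  { intros n; apply Rmult_le_pos; [apply Rabs_pos | apply Cmod_ge_0]. }
  assert (Sb : Zsummable (fun n => b n * nu f n)).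
  { apply (wsum_bounded b f M 1); try assumption.
    intros n; rewrite Rabs_pos_eq by apply Hb0; apply HM. }
  assert (Su : Zsummable (fun n => u n * nu f n)).
  { apply (wsum_bounded u f M 1); try assumption.
    intros n; apply Rle_trans with (1 := Hu n), HM. }
  assert (Sv : Zsummable (fun n => v n * nu f n)).
  { apply (wsum_bounded v f M 1); try assumption.
    intros n; apply Rle_trans with (1 := Hv n), HM. }
  assert (Eb : forall n, Rabs (b n * nu f n) = Cmod (RtoC (IZR n * Cmod (fourier f n) ^ 2) * tau n)%C).
  { intros n; rewrite Cmod_mult, Cmod_R; fold (nu f n).
    rewrite !Rabs_mult, (Rabs_pos_eq (b n)) by apply Hb0; unfold b; ring. }
  assert (Ec : forall n, ((u n * nu f n, v n * nu f n) : C)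
     = (RtoC (IZR n * Cmod (fourier f n) ^ 2) * tau n)%C).
  { intros n; fold (nu f n); unfold u, v, Cmult, RtoC; cbn [fst snd]; f_equal; ring. }
  unfold wsum; rewrite !Zsum_split by assumption.
  apply Zsummable_split in Sb; apply Zsummable_split in Su; apply Zsummable_split in Sv.
  destruct Sb as [B1 B2]; destruct Su as [U1 U2]; destruct Sv as [V1 V2].
  apply ex_series_Rabs in U1; apply ex_series_Rabs in U2.
  apply ex_series_Rabs in V1; apply ex_series_Rabs in V2.
  split; [apply ex_series_ext with (2 := B1); intros; apply Eb |].
  split; [apply ex_series_ext with (2 := B2); intros; apply Eb |].
  exists (Series (fun k => u (Z.of_nat k) * nu f (Z.of_nat k)),
    Series (fun k => v (Z.of_nat k) * nu f (Z.of_nat k))).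
  exists (Series (fun k => u (- Z.of_nat (S k))%Z * nu f (- Z.of_nat (S k))),
    Series (fun k => v (- Z.of_nat (S k))%Z * nu f (- Z.of_nat (S k)))).
  split; [| split].
  - apply (is_series_ext _ _ _ (fun k => Ec (Z.of_nat k))).
    apply is_series_C; apply Series_correct; assumption.
  - apply (is_series_ext _ _ _ (fun k => Ec (- Z.of_nat (S k))%Z)).
    apply is_series_C; apply Series_correct; assumption.
  - reflexivity.
Qed.

Theorem theorem1p1 (sigma : Z -> R -> C)
  (sigma_bounded : forall eps : R, 0 < eps < 1 ->
     exists M : R, forall n : Z, Rabs (IZR n) * Cmod (sigma n eps) <= M)
  (sigma_lim : forall n : Z,
     filterlim (sigma n) (at_right 0) (locally (T := C_UniformSpace) (RtoC 1))) :
  exists (f : R -> C) (d : Z) (Sum : R -> C),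
    circle_map f /\ holder (1 / 3) f /\ has_degree f d /\
    (forall eps : R, 0 < eps < 1 ->
       is_Zseries
         (fun n : Z => (RtoC (IZR n * Cmod (fourier f n) ^ 2) * sigma n eps)%C)
         (Sum eps)) /\
    ~ filterlim Sum (at_right 0) (locally (T := C_UniformSpace) (RtoC (IZR d))).
Proof.
  apply NNPP; intros Hcon.
  apply (no_universal_limit (fun eps n => IZR n * fst (sigma n eps))).
  - intros eps Heps; destruct (sigma_bounded eps Heps) as [M HM]; exists M; intros n.
    apply Rle_trans with (2 := HM n); rewrite Rabs_mult.
    apply Rmult_le_compat_l; [apply Rabs_pos |].
    apply Rle_trans with (2 := Rmax_Cmod _), Rmax_l.
  - intros c d Hc e He.
    set (f := test_map c d).
    (* For [eps] outside (0,1) the value is whatever the total [Series] returns; the filter at 0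
       from the right does not see it. *)
    set (Sum := fun eps => ((wsum (fun n => IZR n * fst (sigma n eps)) f,
      wsum (fun n => IZR n * snd (sigma n eps)) f) : C)).
    assert (HS : filterlim Sum (at_right 0) (locally (T := C_UniformSpace) (RtoC (IZR d)))).
    { apply NNPP; intros HnS; apply Hcon; exists f, d, Sum.
      split; [apply test_map_circle |]; split; [| split; [now apply test_map_degree | split]].
      - destruct (test_map_cube c d Hc) as [K [HK H]].
        exact (holder_third f K (test_map_circle c d) HK H).
      - intros eps Heps; destruct (sigma_bounded eps Heps) as [M HM].
        apply is_Zseries_wsum with M; [exact HM | now apply contC_test_map |].
        intros x; unfold f, test_map; rewrite Cmod_expi; lra.
      - exact HnS. }
    destruct (HS _ (locally_ball (RtoC (IZR d) : C_UniformSpace) (mkposreal e He))) as [del Hdel].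
    exists del; split; [apply cond_pos |]; intros eps [Heps1 Heps2] _.
    assert (Hb : ball 0 del eps).
    { unfold ball; simpl; unfold AbsRing_ball, abs, minus, plus, opp; simpl.
      rewrite Rabs_pos_eq; lra. }
    destruct (Hdel eps Hb Heps1) as [H _]; exact H.
Qed.
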